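(* Let $\tau\in\mathbb{H}$, $q=e^{2\pi i\tau}$, and let $z\in\mathbb{C}$ be written as $z=z_1+iz_2=\frac{z_3+\sqrt{-3}\,z_4}{2}$ with $z_1,z_2,z_3,z_4\in\mathbb{R}$; put $\zeta_j=e^{2\pi i z_j}$. Define \begin{align*} \phi_{26}(z;\tau)&=\frac12\sum_{n_3,n_4\in\mathbb{Z}}(-1)^{\frac{n_3+n_4-1}{2}}\left(\frac{4}{n_3(n_4+1)}\right)\left(\frac{n_3}{3}\right)\zeta_3^{\frac{n_3}{12}}\zeta_4^{\frac{n_4}{4}}q^{\frac{n_3^2+3n_4^2}{12}} +\frac14\sum_{n_3\equiv\pm n_4\ (\mathrm{mod}\ 8)}\left(\frac{12}{n_3}\right)\zeta_3^{\frac{n_3}{24}}\zeta_4^{\frac{n_4}{8}}q^{\frac{n_3^2+3n_4^2}{48}}\\ &\quad-\frac12\sum_{(n_1,n_2)\equiv(\pm1,0)\ (\mathrm{mod}\ 3)}(-1)^{n_2}\left(\frac{4}{n_1+n_2}\right)\zeta_1^{\frac{n_1}{6}}\zeta_2^{\frac{n_2}{6}}q^{\frac{n_1^2+n_2^2}{12}} +\frac12\sum_{(n_1,n_2)\equiv(0,\pm1)\ (\mathrm{mod}\ 3)}(-1)^{n_2}\left(\frac{4}{n_1+n_2}\right)\zeta_1^{\frac{n_1}{6}}\zeta_2^{\frac{n_2}{6}}q^{\frac{n_1^2+n_2^2}{12}}. \end{align*} Then \begin{align*} \phi_{26}(z;\tau)&=\tfrac12\theta^*\!\left(\tfrac{z_3}{6};2\tau\right)\theta_4\!\left(\tfrac{z_4}{2};2\tau\right)+\tfrac12\theta^*\!\left(\tfrac{z_3}{12};\tfrac{\tau}{2}\right)\theta_2\!\left(\tfrac{z_4}{4};\tfrac{\tau}{2}\right)\\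 &\quad+\tfrac14\Big[\theta^*\!\left(\tfrac{z_3}{12}+\tfrac14;\tfrac{\tau}{2}\right)\theta_2\!\left(\tfrac{z_4}{4}-\tfrac14;\tfrac{\tau}{2}\right)+\theta_2^*\!\left(\tfrac{z_3}{12}+\tfrac14;\tfrac{\tau}{2}\right)\theta\!\left(\tfrac{z_4}{4}-\tfrac14;\tfrac{\tau}{2}\right)\Big]\\ &\quad+\tfrac14\Big[\theta^*\!\left(\tfrac{z_3}{12}+\tfrac14;\tfrac{\tau}{2}\right)\theta_2\!\left(\tfrac{z_4}{4}+\tfrac14;\tfrac{\tau}{2}\right)-\theta_2^*\!\left(\tfrac{z_3}{12}+\tfrac14;\tfrac{\tau}{2}\right)\theta\!\left(\tfrac{z_4}{4}+\tfrac14;\tfrac{\tau}{2}\right)\Big]\\ &\quad-\tfrac12\theta^*\!\left(\tfrac{z_1+z_2}{6};\tau\right)\theta^*\!\left(\tfrac{z_1-z_2}{6};\tau\right), \end{align*} and $$D_z^{12}\big[\phi_{26}(z;\tau)\big]_{z=0}=\frac{1}{2^8\cdot3^4\cdot11^2\cdot13}\,\eta(\tau)^{26}.$$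
   Context: Symbols $\left(\frac{\cdot}{\cdot}\right)$ are Kronecker symbols (e.g. $\left(\frac{4}{n}\right)=1$ for $n$ odd and $0$ for $n$ even). Fractional powers mean $\zeta_j^{x}=e^{2\pi i x z_j}$, $q^x=e^{2\pi i x\tau}$, and for a theta function with argument $w$, $e^{2\pi i x w}$. Theta functions: $\theta(w;\tau)=\sum_{n\in\mathbb{Z}}\left(\frac{-4}{n}\right)e^{\pi i n w}q^{n^2/8}$; $\theta_2(w;\tau)=\sum_{n}\left(\frac{4}{n}\right)e^{\pi i n w}q^{n^2/8}$; $\theta_4(w;\tau)=-\sum_n\left(\frac{-4}{n}\right)e^{\pi i(n+1)w}q^{(n+1)^2/8}$; $\theta^*(w;\tau)=\sum_n\left(\frac{12}{n}\right)e^{\pi i n w}q^{n^2/24}$; $\theta_2^*(w;\tau)=\sum_n\left(\frac{-12}{n}\right)e^{\pi i n w}q^{n^2/24}$. $\eta(\tau)=q^{1/24}\prod_{n\ge1}(1-q^n)$. $\phi_{26}$ is regarded as a smooth function of $z\in\mathbb{C}$ via the stated relations ($z_1=\mathrm{Re}\,z$, $z_2=\mathrm{Im}\,z$, $z_3=2\,\mathrm{Re}\,z$, $z_4=\frac{2}{\sqrt3}\mathrm{Im}\,z$), and $D_z=\frac{1}{2\pi i}\frac{\partial}{\partial z}$ with $\frac{\partial}{\partial z}$ the Wirtinger derivative ($z$ and $\bar z$ treated as independent).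
   Formalization: In the theta formula the coefficients 1/2, 1/4, 1/4 of the τ/2 products are replaced by 1/8, 1/16, 1/16, and the factor of η(τ)^26 by 2^8·3^4·11^2·13/12^12; the printed constants contradict the printed definition of φ_26. *)

(* Defs.v *)
From Stdlib Require Export Reals ZArith List.
From Coquelicot Require Export Coquelicot.
From mathcomp Require prime.

Open Scope R_scope.

(** * Kronecker symbol *)

(* Legendre symbol (a/p) for an odd prime p. *)
Definition legendre (a : Z) (p : nat) : Z :=
  let r := (a mod Z.of_nat p)%Z in
  if (r =? 0)%Z then 0%Z
  else if existsb (fun x => ((Z.of_nat x * Z.of_nat x) mod Z.of_nat p =? r)%Z)
                  (seq 1 (p - 1))
  then 1%Z else (-1)%Z.

Definition kronecker2 (a : Z) : Z :=
  if Z.even a then 0%Z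
  else if ((a mod 8 =? 1) || (a mod 8 =? 7))%Z%bool then 1%Z else (-1)%Z.

Definition kronecker_prime (a : Z) (p : nat) : Z :=
  if Nat.eqb p 2 then kronecker2 a else legendre a p.

(* [prime_decomp] lists the pairs (p, e) with p ^ e exactly dividing |n|. *)
Definition kronecker (a n : Z) : Z :=
  if (n =? 0)%Z then (if (Z.abs a =? 1)%Z then 1%Z else 0%Z)
  else
    ((if ((n <? 0) && (a <? 0))%Z%bool then -1 else 1) *
     fold_right (fun pe acc =>
                   kronecker_prime a (fst pe) ^ Z.of_nat (snd pe) * acc)
                1 (prime.prime_decomp (Z.abs_nat n)))%Z.

Definition KS (a n : Z) : C := RtoC (IZR (kronecker a n)).

(** * Complex exponentials *)

Definition Cexp (w : C) : C :=
  (exp (Re w) * cos (Im w), exp (Re w) * sin (Im w)).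

(* [epow x w] is e^(2 pi i x w): with w = tau it is q^x, with w = z_j it is
   zeta_j^x. *)
Definition epow (x : R) (w : C) : C :=
  Cexp (RtoC (2 * PI) * Ci * RtoC x * w)%C.

(** * Infinite sums and products *)

Definition Clim_seq (u : nat -> C) : C :=
  (real (Lim_seq (fun N => Re (u N))), real (Lim_seq (fun N => Im (u N)))).

Definition sum_sym (f : Z -> C) (N : nat) : C :=
  sum_n (fun k => f (Z.of_nat k - Z.of_nat N)%Z) (2 * N).

(* All the series below converge absolutely when Im tau > 0, so summing over
   |n| <= N, resp. |m|, |n| <= N, with N -> oo gives the unordered sum. *)
Definition sumZ (f : Z -> C) : C := Clim_seq (sum_sym f).

Definition sumZ2 (f : Z -> Z -> C) : C :=
  Clim_seq (fun N => sum_sym (fun m => sum_sym (fun n => f m n) N) N).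

(* Sum of f over the pairs (m, n) satisfying P. *)
Definition sumZ2_in (P : Z -> Z -> bool) (f : Z -> Z -> C) : C :=
  sumZ2 (fun m n => if P m n then f m n else RtoC 0).

Definition Cprod_inf (f : nat -> C) : C :=
  Clim_seq (fun N => fold_right (fun n acc => (f n * acc)%C) (RtoC 1) (seq 1 N)).

(** * Theta functions and eta *)

Definition theta (w tau : C) : C :=
  sumZ (fun n => KS (-4) n * epow (IZR n / 2) w * epow (IZR n ^ 2 / 8) tau)%C.

Definition theta2 (w tau : C) : C :=
  sumZ (fun n => KS 4 n * epow (IZR n / 2) w * epow (IZR n ^ 2 / 8) tau)%C.

Definition theta4 (w tau : C) : C :=
  (- sumZ (fun n => KS (-4) n * epow (IZR (n + 1) / 2) w
                    * epow (IZR (n + 1) ^ 2 / 8) tau))%C.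

Definition theta_star (w tau : C) : C :=
  sumZ (fun n => KS 12 n * epow (IZR n / 2) w * epow (IZR n ^ 2 / 24) tau)%C.

Definition theta2_star (w tau : C) : C :=
  sumZ (fun n => KS (-12) n * epow (IZR n / 2) w * epow (IZR n ^ 2 / 24) tau)%C.

Definition eta (tau : C) : C :=
  (epow (1 / 24) tau * Cprod_inf (fun n => RtoC 1 - epow (INR n) tau))%C.

(** * The function phi_26 *)

(* Two normalizations differ from the printed source, whose values contradict
   this definition of phi_26.
   - The theta products coming from the second sum have coefficients 1/8, 1/16,
     1/16 (printed: 1/2, 1/4, 1/4).  With the printed values they add up to the
     sum over n3 = +-n4 (mod 8) with coefficient 1 instead of the 1/4 it has in
     phi_26; at z = 0 the coefficient of q^(1/12) is 0 in phi_26 but would be 3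
     in the theta expression.
   - The factor of eta^26 is 2^8 3^4 11^2 13 / 12^12 (printed:
     1 / (2^8 3^4 11^2 13)).  D_z multiplies a term of the first sum by
     (n3 - sqrt(-3) n4) / 12, which produces the 12^12. *)

Definition congZ (d a b : Z) : bool := ((a - b) mod d =? 0)%Z.

(* In the first sum the Kronecker symbol (4 / n3(n4+1)) vanishes unless n3 is
   odd and n4 even, so the rounding in (n3 + n4 - 1) / 2 is irrelevant. *)
Definition phi26 (z tau : C) : C :=
  let z1 := RtoC (Re z) in
  let z2 := RtoC (Im z) in
  let z3 := RtoC (2 * Re z) in
  let z4 := RtoC (2 / sqrt 3 * Im z) in
  let term12 (n1 n2 : Z) : C :=
    (RtoC (powerRZ (-1) n2) * KS 4 (n1 + n2)
     * epow (IZR n1 / 6) z1 * epow (IZR n2 / 6) z2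
     * epow ((IZR n1 ^ 2 + IZR n2 ^ 2) / 12) tau)%C in
  (RtoC (1 / 2) *
     sumZ2 (fun n3 n4 =>
       RtoC (powerRZ (-1) ((n3 + n4 - 1) / 2)) * KS 4 (n3 * (n4 + 1)) * KS n3 3
       * epow (IZR n3 / 12) z3 * epow (IZR n4 / 4) z4
       * epow ((IZR n3 ^ 2 + 3 * IZR n4 ^ 2) / 12) tau)
   + RtoC (1 / 4) *
     sumZ2_in (fun n3 n4 => congZ 8 n3 n4 || congZ 8 n3 (- n4))%bool
       (fun n3 n4 =>
       KS 12 n3 * epow (IZR n3 / 24) z3 * epow (IZR n4 / 8) z4
       * epow ((IZR n3 ^ 2 + 3 * IZR n4 ^ 2) / 48) tau)
   - RtoC (1 / 2) *
     sumZ2_in (fun n1 n2 => (congZ 3 n1 1 || congZ 3 n1 (-1)) && congZ 3 n2 0)%bool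
       term12
   + RtoC (1 / 2) *
     sumZ2_in (fun n1 n2 => congZ 3 n1 0 && (congZ 3 n2 1 || congZ 3 n2 (-1)))%bool
       term12)%C.

(** * The operator D_z = (1 / (2 pi i)) d/dz *)

Definition partial_x (f : C -> C) (z : C) : C :=
  (Derive (fun t => Re (f (t, Im z))) (Re z),
   Derive (fun t => Im (f (t, Im z))) (Re z)).

Definition partial_y (f : C -> C) (z : C) : C :=
  (Derive (fun t => Re (f (Re z, t))) (Im z),
   Derive (fun t => Im (f (Re z, t))) (Im z)).

Definition wirtinger (f : C -> C) (z : C) : C :=
  (RtoC (1 / 2) * (partial_x f z - Ci * partial_y f z))%C.

Definition Dz (f : C -> C) (z : C) : C :=
  (/ (RtoC (2 * PI) * Ci) * wirtinger f z)%C.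

Definition Dz_n (n : nat) (f : C -> C) : C -> C := Nat.iter n Dz f.

(* Main.v *)
From Stdlib Require Import Lra Lia ClassicalEpsilon FunctionalExtensionality Permutation.
From mathcomp Require all_boot all_algebra cyclic finfield zify ring.
Require Import Defs.

(** The first identity holds termwise: for the second sum,
    [n3 = +-n4 mod 8] is detected by eighth roots of unity, and the last two sums
    form a product after the lattice rotation [(n1, n2) -> (n1 + n2, n1 - n2)].

    Each application of D_z multiplies a term by a linear form in its indices, so
    the binomial formula turns the value at 0 into bilinear combinations of the
    moments [sum c(n) n^(2j) q^(l n^2)], that is, of derivatives D = q d/dq of
    theta constants.  Up to constants these theta constants are
    eta(2 tau) theta4(2 tau) = eta^2, eta(tau/2) theta2(tau/2) = 2 eta^2, the
    translate of the latter by tau -> tau + 1, and eta.  All logarithmic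
    derivatives lie in the ring generated by the weight 2 Eisenstein series P and
    by A = theta3^4, B = theta2^4, which is closed under D; hence the value at 0 is
    eta^2 times a polynomial of weight 12 in P, A, B.  That polynomial is a
    multiple of (A B (A - B))^2 = 2^8 eta^24.

    The closure under D comes from rotating Z^2 (the bilinear theta relations)
    together with Jacobi's derivative formula theta1' = theta2 theta3 theta4: the
    quotient of its two sides is unchanged under tau -> 2 tau and tends to 1 under
    iteration.  The eta products come from the Jacobi triple product. *)

(** The four bilinear expressions obtained at 0 are, up to factors, sixth Rankin-Cohen brackets of
    two forms of weight 1/2. Their coefficients (-1)^j binom(12, 2j) arise because D_z multiplies a
    term by al m + be n, where al^2 and be^2 are opposite multiples of the two exponents of q. Such
    brackets are modular, here of weight 13, which is why P cancels in the end. No dimension formula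
    is invoked: once the logarithmic derivatives 48 D f / f are known as linear forms in P, A, B
    with integer coefficients, each moment is a theta constant times an explicit integer polynomial,
    and the final identity is one between polynomials, settled by computation. Two sources feed the
    denominator 12^12: the twelve D_z contribute 12^-6 through al^2 and be^2, and the normalisation
    of six D by 48 contributes 48^-6 = 12^-6 4^-6, where 4^6 divides out of the polynomial. For the
    derivative, the congruence modulo 8 is split by the even character (2/n) rather than by eighth
    roots of unity, since odd moments must vanish; the extra piece this produces is the translate by
    1 of the pair at tau/2. *)

Lemma C_eq (a b : C) : Re a = Re b -> Im a = Im b -> a = b.
Proof. destruct a, b; simpl; congruence. Qed.

Lemma Cmod_le_Re_Im (z : C) : Cmod z <= Rabs (Re z) + Rabs (Im z).
Proof.
  replace z with (RtoC (Re z) + RtoC (Im z) * Ci)%C at 1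
    by (apply C_eq; simpl; ring).
  eapply Rle_trans; [apply Cmod_triangle|].
  rewrite Cmod_mult, !Cmod_R.
  replace (Cmod Ci) with 1; [lra|].
  unfold Cmod, Ci; simpl. rewrite <- sqrt_1 at 1. f_equal; ring.
Qed.

Lemma Re_le_Cmod (z : C) : Rabs (Re z) <= Cmod z.
Proof. eapply Rle_trans; [apply Rmax_l|apply (Rmax_Cmod z)]. Qed.

Lemma Im_le_Cmod (z : C) : Rabs (Im z) <= Cmod z.
Proof. eapply Rle_trans; [apply Rmax_r|apply (Rmax_Cmod z)]. Qed.

(** * Unconditional sums *)

Section Sums.
Context {T : Type}.
Implicit Types (F G : T -> C) (L : list T).

Definition lsum F L : C := fold_right (fun t acc => F t + acc)%C (RtoC 0) L.
Definition rsum (g : T -> R) L : R := fold_right (fun t acc => g t + acc) 0 L.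

(** Convergence along the net of finite subsets, represented by duplicate-free lists. The limit does
    not refer to an enumeration of the index type, so reindexing, the rotation of Z^2 and products
    of sums need no rearrangement argument. *)
Definition hs F (S : C) : Prop :=
  forall eps, 0 < eps -> exists L0, forall L, NoDup L -> incl L0 L ->
    Cmod (lsum F L - S) < eps.

Definition asum F : Prop :=
  exists M, forall L, NoDup L -> rsum (fun t => Cmod (F t)) L <= M.

Definition tsum F : C := epsilon (inhabits (RtoC 0)) (hs F).

Lemma T_dec (x y : T) : {x = y} + {x <> y}.
Proof. apply excluded_middle_informative. Qed.

Lemma lsum_app F L1 L2 : lsum F (L1 ++ L2) = (lsum F L1 + lsum F L2)%C.
Proof. induction L1; simpl; [ring|rewrite IHL1; ring]. Qed.

Lemma rsum_app g L1 L2 : rsum g (L1 ++ L2) = rsum g L1 + rsum g L2.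
Proof. induction L1; simpl; [ring|rewrite IHL1; ring]. Qed.

Lemma lsum_ext F G L : (forall t, In t L -> F t = G t) -> lsum F L = lsum G L.
Proof.
  induction L; simpl; intros H; [easy|].
  rewrite IHL, H; auto.
Qed.

Lemma rsum_le (g h : T -> R) L :
  (forall t, In t L -> g t <= h t) -> rsum g L <= rsum h L.
Proof.
  induction L; simpl; intros H; [lra|].
  apply Rplus_le_compat; auto.
Qed.

Lemma rsum_ge0 (g : T -> R) L : (forall t, 0 <= g t) -> 0 <= rsum g L.
Proof. intros H; induction L as [|t L IH]; simpl; [lra|specialize (H t); lra]. Qed.

Lemma lsum_0 F L : (forall t, In t L -> F t = RtoC 0) -> lsum F L = RtoC 0.
Proof.
  induction L; simpl; intros H; [easy|].
  rewrite IHL, H; auto. ring.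
Qed.

Lemma lsum_plus F G L :
  lsum (fun t => F t + G t)%C L = (lsum F L + lsum G L)%C.
Proof. induction L; simpl; [ring|rewrite IHL; ring]. Qed.

Lemma lsum_scal (c : C) F L : lsum (fun t => c * F t)%C L = (c * lsum F L)%C.
Proof. induction L; simpl; [ring|rewrite IHL; ring]. Qed.

Lemma rsum_scal (c : R) g L : rsum (fun t => c * g t) L = c * rsum g L.
Proof. induction L; simpl; [ring|rewrite IHL; ring]. Qed.

Lemma Cmod_lsum F L : Cmod (lsum F L) <= rsum (fun t => Cmod (F t)) L.
Proof.
  induction L; simpl; [rewrite Cmod_0; lra|].
  eapply Rle_trans; [apply Cmod_triangle|lra].
Qed.

Lemma lsum_perm F L1 L2 : Permutation L1 L2 -> lsum F L1 = lsum F L2.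
Proof. induction 1; simpl; [easy|rewrite IHPermutation; easy|ring|congruence]. Qed.

Lemma rsum_perm g L1 L2 : Permutation L1 L2 -> rsum g L1 = rsum g L2.
Proof. induction 1; simpl; [easy|rewrite IHPermutation; easy|ring|congruence]. Qed.

Lemma incl_split L0 L : NoDup L0 -> NoDup L -> incl L0 L ->
  exists L1, Permutation L (L0 ++ L1) /\ NoDup L1.
Proof.
  intros H0; revert L; induction H0 as [|t L0 Ht H0 IH]; intros L HL Hi.
  - exists L; simpl; split; auto.
  - destruct (in_split t L (Hi t (or_introl eq_refl))) as (l1 & l2 & ->).
    assert (HN : NoDup (l1 ++ l2)) by (eapply NoDup_remove_1; eauto).
    destruct (IH (l1 ++ l2) HN) as (L1 & HP & H1).
    + intros x Hx. specialize (Hi x (or_intror Hx)).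
      apply in_app_or in Hi; apply in_or_app; destruct Hi as [|[|]]; auto.
      subst; contradiction.
    + exists L1; split; auto. simpl.
      rewrite <- HP. symmetry; apply Permutation_middle.
Qed.

Lemma rsum_incl (g : T -> R) L0 L : (forall t, 0 <= g t) ->
  NoDup L0 -> NoDup L -> incl L0 L -> rsum g L0 <= rsum g L.
Proof.
  intros Hg H0 H1 Hi. destruct (incl_split L0 L H0 H1 Hi) as (L1 & HP & _).
  rewrite (rsum_perm _ _ _ HP), rsum_app.
  assert (H := rsum_ge0 g L1 Hg); lra.
Qed.

Lemma hs_unique F S1 S2 : hs F S1 -> hs F S2 -> S1 = S2.
Proof.
  intros H1 H2.
  destruct (Req_dec (Cmod (S1 - S2)) 0) as [H|H].
  - apply Cmod_eq_0 in H.
    replace S1 with (S1 - S2 + S2)%C by ring. rewrite H; ring.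
  - exfalso. assert (Hp : 0 < Cmod (S1 - S2) / 2)
      by (assert (X := Cmod_ge_0 (S1 - S2)); lra).
    destruct (H1 _ Hp) as (L1 & K1), (H2 _ Hp) as (L2 & K2).
    set (L := nodup T_dec (L1 ++ L2)).
    assert (HN : NoDup L) by apply NoDup_nodup.
    assert (I1 : incl L1 L)
      by (intros x Hx; apply nodup_In, in_or_app; auto).
    assert (I2 : incl L2 L)
      by (intros x Hx; apply nodup_In, in_or_app; auto).
    specialize (K1 L HN I1); specialize (K2 L HN I2).
    assert (X : Cmod (S1 - S2) <= Cmod (lsum F L - S2) + Cmod (lsum F L - S1)).
    { rewrite <- (Cmod_opp (lsum F L - S1)).
      eapply Rle_trans; [|apply Cmod_triangle]. right; f_equal; ring. }
    lra.
Qed.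

Lemma hs_tsum F S : hs F S -> tsum F = S.
Proof.
  intros H. apply (hs_unique F); auto.
  unfold tsum. apply epsilon_spec. eauto.
Qed.

Lemma hs_plus F G S1 S2 :
  hs F S1 -> hs G S2 -> hs (fun t => F t + G t)%C (S1 + S2)%C.
Proof.
  intros H1 H2 eps He. assert (He2 : 0 < eps / 2) by lra.
  destruct (H1 _ He2) as (L1 & K1), (H2 _ He2) as (L2 & K2).
  exists (L1 ++ L2); intros L HL Hi.
  assert (I1 : incl L1 L) by (intros x Hx; apply Hi, in_or_app; auto).
  assert (I2 : incl L2 L) by (intros x Hx; apply Hi, in_or_app; auto).
  specialize (K1 L HL I1); specialize (K2 L HL I2).
  rewrite lsum_plus.
  replace (lsum F L + lsum G L - (S1 + S2))%C
    with ((lsum F L - S1) + (lsum G L - S2))%C by ring.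
  eapply Rle_lt_trans; [apply Cmod_triangle|lra].
Qed.

Lemma hs_scal (c : C) F S : hs F S -> hs (fun t => c * F t)%C (c * S)%C.
Proof.
  intros H eps He.
  assert (Hc : 0 < Cmod c + 1) by (assert (X := Cmod_ge_0 c); lra).
  destruct (H (eps / (Cmod c + 1))) as (L0 & K).
  { apply Rdiv_lt_0_compat; auto. }
  exists L0; intros L HL Hi. specialize (K L HL Hi).
  rewrite lsum_scal.
  replace (c * lsum F L - c * S)%C with (c * (lsum F L - S))%C by ring.
  rewrite Cmod_mult.
  assert (X := Cmod_ge_0 c). assert (Y := Cmod_ge_0 (lsum F L - S)).
  apply (Rmult_lt_compat_r (Cmod c + 1)) in K; auto.
  replace (eps / (Cmod c + 1) * (Cmod c + 1)) with eps in K by (field; lra).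
  nra.
Qed.

(* The sum is the supremum of the finite sums. *)
Lemma nonneg_hs (g : T -> R) : (forall t, 0 <= g t) ->
  (exists M, forall L, NoDup L -> rsum g L <= M) ->
  exists s, forall eps, 0 < eps -> exists L0, forall L, NoDup L -> incl L0 L ->
    Rabs (rsum g L - s) < eps.
Proof.
  intros Hg (M & HM).
  destruct (completeness (fun x => exists L, NoDup L /\ x = rsum g L)) as (s & Hub & Hlub).
  - exists M; intros x (L & HL & ->); auto.
  - exists 0, nil; split; [constructor|easy].
  - exists s; intros eps He.
    destruct (classic (exists L0, NoDup L0 /\ s - eps < rsum g L0)) as [(L0 & N0 & H0)|H0].
    + exists L0; intros L HL Hi.
      assert (X := rsum_incl g L0 L Hg N0 HL Hi).
      assert (Y : rsum g L <= s) by (apply Hub; eauto).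
      apply Rabs_def1; lra.
    + exfalso. assert (s <= s - eps); [|lra].
      apply Hlub; intros x (L & HL & ->).
      apply Rnot_lt_le; intros X; apply H0; eauto.
Qed.

(** [Re] and [Im] are differences of nonnegative families: if |h| is at most [Cmod], then both
    [Cmod + h] and [Cmod] are nonnegative with bounded finite sums. *)
Lemma asum_hs F : asum F -> hs F (tsum F).
Proof.
  intros (M & HM). unfold tsum; apply epsilon_spec.
  assert (K : forall (h : C -> R), (forall z, Rabs (h z) <= Cmod z) ->
     exists s, forall eps, 0 < eps -> exists L0, forall L, NoDup L -> incl L0 L ->
       Rabs (rsum (fun t => h (F t)) L - s) < eps).
  { intros h Hh.
    destruct (nonneg_hs (fun t => Cmod (F t) + h (F t))) as (s1 & K1).
    - intros t; specialize (Hh (F t)). apply Rabs_le_between in Hh; lra.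
    - exists (2 * M); intros L HL. specialize (HM L HL).
      apply Rle_trans with (rsum (fun t => 2 * Cmod (F t)) L).
      + apply rsum_le; intros t _. specialize (Hh (F t)).
        apply Rabs_le_between in Hh; lra.
      + rewrite rsum_scal; lra.
    - destruct (nonneg_hs (fun t => Cmod (F t))) as (s2 & K2).
      + intros; apply Cmod_ge_0.
      + eauto.
      + exists (s1 - s2); intros eps He. assert (He2 : 0 < eps / 2) by lra.
        destruct (K1 _ He2) as (L1 & Q1), (K2 _ He2) as (L2 & Q2).
        exists (L1 ++ L2); intros L HL Hi.
        assert (I1 : incl L1 L) by (intros x Hx; apply Hi, in_or_app; auto).
        assert (I2 : incl L2 L) by (intros x Hx; apply Hi, in_or_app; auto).
        specialize (Q1 L HL I1); specialize (Q2 L HL I2).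
        replace (rsum (fun t => h (F t)) L) with
          (rsum (fun t => Cmod (F t) + h (F t)) L - rsum (fun t => Cmod (F t)) L).
        2: { clear; induction L; simpl; lra. }
        apply Rabs_def2 in Q1; apply Rabs_def2 in Q2. apply Rabs_def1; lra. }
  destruct (K Re Re_le_Cmod) as (sr & Kr), (K Im Im_le_Cmod) as (si & Ki).
  exists (sr, si); intros eps He. assert (He2 : 0 < eps / 2) by lra.
  destruct (Kr _ He2) as (L1 & Q1), (Ki _ He2) as (L2 & Q2).
  exists (L1 ++ L2); intros L HL Hi.
  assert (I1 : incl L1 L) by (intros x Hx; apply Hi, in_or_app; auto).
  assert (I2 : incl L2 L) by (intros x Hx; apply Hi, in_or_app; auto).
  specialize (Q1 L HL I1); specialize (Q2 L HL I2).
  eapply Rle_lt_trans; [apply Cmod_le_Re_Im|].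
  assert (E : lsum F L = (rsum (fun t => Re (F t)) L, rsum (fun t => Im (F t)) L)).
  { clear; induction L; simpl; [easy|rewrite IHL]. apply C_eq; simpl; reflexivity. }
  rewrite E. simpl. unfold Rminus in Q1, Q2. lra.
Qed.

Lemma asum_le F (g : T -> R) M : (forall t, Cmod (F t) <= g t) ->
  (forall L, NoDup L -> rsum g L <= M) -> asum F.
Proof.
  intros H K. exists M; intros L HL. eapply Rle_trans; [|apply K, HL].
  apply rsum_le; auto.
Qed.

Lemma asum_dom F G : (forall t, Cmod (F t) <= Cmod (G t)) -> asum G -> asum F.
Proof. intros H (M & HM). eapply asum_le; [exact H|exact HM]. Qed.

Lemma asum_ext F G : (forall t, F t = G t) -> asum F -> asum G.
Proof. intros H; apply asum_dom; intros t; rewrite H; lra. Qed.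

Lemma asum_scal c F : asum F -> asum (fun t => c * F t)%C.
Proof.
  intros (M & HM). exists (Cmod c * M); intros L HL.
  replace (rsum _ L) with (Cmod c * rsum (fun t => Cmod (F t)) L).
  - apply Rmult_le_compat_l; [apply Cmod_ge_0|auto].
  - rewrite <- rsum_scal. clear; induction L; simpl; rewrite ?Cmod_mult; congruence.
Qed.

Lemma asum_plus F G : asum F -> asum G -> asum (fun t => F t + G t)%C.
Proof.
  intros (M & HM) (N & HN). exists (M + N); intros L HL.
  specialize (HM L HL); specialize (HN L HL).
  apply Rle_trans with (rsum (fun t => Cmod (F t) + Cmod (G t)) L).
  - apply rsum_le; intros; apply Cmod_triangle.
  - replace (rsum _ L) with (rsum (fun t => Cmod (F t)) L + rsum (fun t => Cmod (G t)) L);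
      [lra|clear; induction L; simpl; lra].
Qed.

Lemma tsum_ext F G : (forall t, F t = G t) -> tsum F = tsum G.
Proof.
  intros H. replace G with F; [easy|].
  apply FunctionalExtensionality.functional_extensionality; auto.
Qed.

Lemma tsum_plus F G : asum F -> asum G ->
  tsum (fun t => F t + G t)%C = (tsum F + tsum G)%C.
Proof. intros; apply hs_tsum, hs_plus; apply asum_hs; auto. Qed.

Lemma tsum_scal c F : asum F -> tsum (fun t => c * F t)%C = (c * tsum F)%C.
Proof. intros; apply hs_tsum, hs_scal; apply asum_hs; auto. Qed.

Lemma Cmod_hs_le F S M :
  hs F S -> (forall L, NoDup L -> rsum (fun t => Cmod (F t)) L <= M) -> Cmod S <= M.
Proof.
  intros H HM. apply Rnot_lt_le; intros X.
  destruct (H (Cmod S - M)) as (L0 & K); [lra|].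
  set (L := nodup T_dec L0).
  assert (HN : NoDup L) by apply NoDup_nodup.
  assert (I : incl L0 L) by (intros x Hx; apply nodup_In; auto).
  specialize (K L HN I). specialize (HM L HN).
  assert (Y := Cmod_lsum F L).
  assert (Z : Cmod S <= Cmod (lsum F L) + Cmod (lsum F L - S)).
  { rewrite <- (Cmod_opp (lsum F L - S)).
    eapply Rle_trans; [|apply Cmod_triangle]. right; f_equal; ring. }
  lra.
Qed.

Lemma Cmod_tsum_le F M :
  (forall L, NoDup L -> rsum (fun t => Cmod (F t)) L <= M) -> Cmod (tsum F) <= M.
Proof.
  intros H; apply (Cmod_hs_le F); auto. apply asum_hs. exists M; auto.
Qed.

Definition climit (u : nat -> C) (l : C) : Prop :=
  forall eps, 0 < eps -> exists N, forall n, (N <= n)%nat -> Cmod (u n - l) < eps.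

Lemma hs_lists F S (Ls : nat -> list T) : hs F S ->
  (forall N, NoDup (Ls N)) ->
  (forall t, exists N, forall n, (N <= n)%nat -> In t (Ls n)) ->
  climit (fun n => lsum F (Ls n)) S.
Proof.
  intros H HN HI eps He. destruct (H eps He) as (L0 & K).
  assert (X : exists N, forall n, (N <= n)%nat -> incl L0 (Ls n)).
  { clear K. induction L0 as [|t L0 (N & IH)].
    - exists 0%nat; intros n _ x Hx; destruct Hx.
    - destruct (HI t) as (N' & K'). exists (Nat.max N N'); intros n Hn x [<-|Hx].
      + apply K'; lia.
      + apply (IH n); auto; lia. }
  destruct X as (N & X). exists N; intros n Hn; auto.
Qed.

(** Dominated convergence. Beyond a finite list [L0] the terms contribute at most eps / 4, uniformly
    in n, and on [L0] finitely many termwise limits suffice. It serves for the limit of the finite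
    triple product and for theta series with growing exponents. *)
Lemma tannery (F : nat -> T -> C) (F0 : T -> C) (g : T -> R) M :
  (forall L, NoDup L -> rsum g L <= M) ->
  (forall n t, Cmod (F n t) <= g t) ->
  (forall t, climit (fun n => F n t) (F0 t)) ->
  climit (fun n => tsum (F n)) (tsum F0).
Proof.
  intros HM Hd Hl eps He.
  assert (Hg : forall t, 0 <= g t)
    by (intros t; eapply Rle_trans; [apply Cmod_ge_0|apply (Hd 0%nat)]).
  assert (H0 : forall t, Cmod (F0 t) <= g t).
  { intros t; apply Rnot_lt_le; intros X.
    destruct (Hl t (Cmod (F0 t) - g t)) as (N & K); [lra|].
    specialize (K N (le_n _)). specialize (Hd N t).
    assert (Z : Cmod (F0 t) <= Cmod (F N t) + Cmod (F N t - F0 t)).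
    { rewrite <- (Cmod_opp (F N t - F0 t)).
      eapply Rle_trans; [|apply Cmod_triangle]. right; f_equal; ring. }
    lra. }
  destruct (nonneg_hs g Hg (ex_intro _ M HM)) as (s & Ks).
  destruct (Ks (eps / 8)) as (L1 & K1); [lra|].
  set (L0 := nodup T_dec L1).
  assert (N0 : NoDup L0) by apply NoDup_nodup.
  assert (I0 : incl L1 L0) by (intros x Hx; apply nodup_In; auto).
  assert (Tail : forall G : T -> C, (forall t, Cmod (G t) <= g t) ->
            Cmod (tsum G - lsum G L0) <= eps / 4).
  { intros G HG. assert (AG : asum G) by (eapply asum_le; eauto).
    apply Rnot_lt_le; intros X.
    destruct (asum_hs G AG (Cmod (tsum G - lsum G L0) - eps / 4)) as (L2 & K2); [lra|].
    set (L := nodup T_dec (L0 ++ L2)).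
    assert (HN : NoDup L) by apply NoDup_nodup.
    assert (I1 : incl L0 L) by (intros x Hx; apply nodup_In, in_or_app; auto).
    assert (I2 : incl L2 L) by (intros x Hx; apply nodup_In, in_or_app; auto).
    specialize (K2 L HN I2).
    destruct (incl_split L0 L N0 HN I1) as (L3 & HP & N3).
    rewrite (lsum_perm _ _ _ HP), lsum_app in K2.
    assert (B0 := K1 L0 N0 I0).
    assert (B1 := K1 L HN (incl_tran I0 I1)).
    rewrite (rsum_perm _ _ _ HP), rsum_app in B1.
    apply Rabs_def2 in B0; apply Rabs_def2 in B1.
    assert (Y := Cmod_lsum G L3).
    assert (Y' : rsum (fun t => Cmod (G t)) L3 <= rsum g L3) by (apply rsum_le; auto).
    assert (Z : Cmod (tsum G - lsum G L0) <=
       Cmod (lsum G L3) + Cmod (lsum G L0 + lsum G L3 - tsum G)).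
    { rewrite <- (Cmod_opp (lsum G L0 + lsum G L3 - tsum G)).
      eapply Rle_trans; [|apply Cmod_triangle]. right; f_equal; ring. }
    lra. }
  assert (Fin : exists N, forall n, (N <= n)%nat -> Cmod (lsum (F n) L0 - lsum F0 L0) < eps / 4).
  { clear - Hl He. revert eps He. induction L0 as [|t L IH]; intros eps He.
    - exists 0%nat; intros n _; simpl.
      replace (RtoC 0 - RtoC 0)%C with (RtoC 0) by ring. rewrite Cmod_0; lra.
    - destruct (IH (eps / 2)) as (N1 & K1); [lra|].
      destruct (Hl t (eps / 8)) as (N2 & K2); [lra|].
      exists (Nat.max N1 N2); intros n Hn; simpl.
      specialize (K1 n ltac:(lia)); specialize (K2 n ltac:(lia)).
      replace (F n t + lsum (F n) L - (F0 t + lsum F0 L))%C with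
        ((F n t - F0 t) + (lsum (F n) L - lsum F0 L))%C by ring.
      eapply Rle_lt_trans; [apply Cmod_triangle|lra]. }
  destruct Fin as (N & Fin). exists N; intros n Hn. specialize (Fin n Hn).
  assert (T1 := Tail (F n) (Hd n)). assert (T2 := Tail F0 H0).
  rewrite <- (Cmod_opp (tsum F0 - lsum F0 L0)) in T2.
  replace (tsum (F n) - tsum F0)%C with
    ((tsum (F n) - lsum (F n) L0) + ((lsum (F n) L0 - lsum F0 L0)
      + - (tsum F0 - lsum F0 L0)))%C by ring.
  eapply Rle_lt_trans; [apply Cmod_triangle|].
  eapply Rle_lt_trans; [apply Rplus_le_compat_l, Cmod_triangle|]. lra.
Qed.

End Sums.

(** * Reindexing and products of sums *)

Lemma lsum_map {T U} (f : T -> U) (F : U -> C) L :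
  lsum F (map f L) = lsum (fun t => F (f t)) L.
Proof. induction L; simpl; congruence. Qed.

Lemma rsum_map {T U} (f : T -> U) (F : U -> R) L :
  rsum F (map f L) = rsum (fun t => F (f t)) L.
Proof. induction L; simpl; congruence. Qed.

Lemma asum_inj {T U} (f : T -> U) (F : U -> C) :
  (forall x y, f x = f y -> x = y) -> asum F -> asum (fun t => F (f t)).
Proof.
  intros Hf (M & HM). exists M; intros L HL.
  rewrite <- (rsum_map f (fun u => Cmod (F u))). apply HM.
  apply FinFun.Injective_map_NoDup; auto.
Qed.

Lemma tsum_inj {T U} (f : T -> U) (F : U -> C) :
  (forall x y, f x = f y -> x = y) ->
  (forall u, (forall t, f t <> u) -> F u = RtoC 0) ->
  asum F -> tsum (fun t => F (f t)) = tsum F.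
Proof.
  intros Hf H0 HA. apply hs_tsum. intros eps He.
  destruct (asum_hs F HA eps He) as (L0 & K).
  assert (P : exists L1, forall t, In (f t) L0 -> In t L1).
  { clear K; induction L0 as [|u L0 (L1 & IH)].
    - exists nil; intros t [].
    - destruct (classic (exists t, f t = u)) as [(t & Ht)|Ht].
      + exists (t :: L1); intros t' [E|Hi].
        * left; apply Hf; congruence.
        * right; auto.
      + exists L1; intros t' [E|Hi]; auto. exfalso; apply Ht; eauto. }
  destruct P as (L1 & P). exists L1; intros L HL Hi.
  (* [X] collects the points of [L0] outside [map f L]. As [L] contains every preimage of [L0], they
     lie outside the image of [f], where [F] vanishes; appending them completes the list without
     changing the sum. *)
  set (X := filter (fun u => if in_dec T_dec u (map f L) then false else true)
              (nodup T_dec L0)).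
  assert (E : lsum F (map f L ++ X) = lsum (fun t => F (f t)) L).
  { rewrite lsum_app, lsum_map, (lsum_0 F X); [ring|].
    intros u Hu. apply filter_In in Hu; destruct Hu as (Hu & Hv).
    apply nodup_In in Hu. destruct (in_dec T_dec u (map f L)) as [|Hn]; [easy|].
    apply H0; intros t Ht. apply Hn. subst u. apply in_map, Hi, P, Hu. }
  rewrite <- E. apply K.
  - apply NoDup_app.
    + apply FinFun.Injective_map_NoDup; auto.
    + apply NoDup_filter, NoDup_nodup.
    + intros u Hu Hv. apply filter_In in Hv; destruct Hv as (_ & Hv).
      destruct (in_dec T_dec u (map f L)); easy.
  - intros u Hu. apply in_or_app.
    destruct (in_dec T_dec u (map f L)) as [|Hn]; [left; auto|right].
    apply filter_In; split; [apply nodup_In; auto|].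
    destruct (in_dec T_dec u (map f L)); easy.
Qed.

Lemma tsum_bij {T U} (f : T -> U) (g : U -> T) (F : U -> C) :
  (forall x, g (f x) = x) -> (forall y, f (g y) = y) ->
  asum F -> tsum (fun t => F (f t)) = tsum F.
Proof.
  intros H1 H2. apply tsum_inj.
  - intros x y E. rewrite <- (H1 x), <- (H1 y); congruence.
  - intros u H. exfalso. apply (H (g u)); auto.
Qed.

Section Products.
Context {T U : Type}.
Implicit Types (F : T -> C) (G : U -> C).

Lemma lsum_prod F G (L : list T) (K : list U) :
  lsum (fun p => F (fst p) * G (snd p))%C (list_prod L K) = (lsum F L * lsum G K)%C.
Proof.
  induction L as [|t L IH]; simpl; [ring|].
  rewrite lsum_app, lsum_map, IH; simpl. rewrite lsum_scal; ring.
Qed.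

Lemma rsum_prod (F : T -> R) (G : U -> R) (L : list T) (K : list U) :
  rsum (fun p => F (fst p) * G (snd p)) (list_prod L K) = rsum F L * rsum G K.
Proof.
  induction L as [|t L IH]; simpl; [ring|].
  rewrite rsum_app, rsum_map, IH; simpl. rewrite rsum_scal; ring.
Qed.

Lemma lsum_list_prod (H : T * U -> C) (L : list T) (K : list U) :
  lsum H (list_prod L K) = lsum (fun t => lsum (fun u => H (t, u)) K) L.
Proof.
  induction L as [|t L IH]; simpl; [easy|].
  rewrite lsum_app, lsum_map, IH; easy.
Qed.

Lemma NoDup_list_prod (L : list T) (K : list U) :
  NoDup L -> NoDup K -> NoDup (list_prod L K).
Proof.
  intros HL HK; induction HL as [|t L Ht HL IH]; simpl; [constructor|].
  apply NoDup_app; auto.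
  - apply FinFun.Injective_map_NoDup; auto. intros x y; congruence.
  - intros (x, y) Hx Hy. apply in_map_iff in Hx; destruct Hx as (z & E & _).
    injection E as -> ->. apply in_prod_iff in Hy; tauto.
Qed.

(** A finite set of pairs lies in the rectangle spanned by its two projections, over which the sum
    factors. *)
Lemma asum_prod F G : asum F -> asum G -> asum (fun p => F (fst p) * G (snd p))%C.
Proof.
  intros (M & HM) (N & HN). exists (M * N); intros L HL.
  set (L1 := nodup T_dec (map fst L)). set (L2 := nodup T_dec (map snd L)).
  assert (N1 : NoDup L1) by apply NoDup_nodup.
  assert (N2 : NoDup L2) by apply NoDup_nodup.
  eapply Rle_trans.
  - apply (rsum_incl _ L (list_prod L1 L2)); auto.
    + intros; apply Cmod_ge_0.
    + apply NoDup_list_prod; auto.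
    + intros (x, y) Hxy. apply in_prod; apply nodup_In;
        [apply (in_map fst _ _ Hxy)|apply (in_map snd _ _ Hxy)].
  - replace (rsum _ _) with (rsum (fun t => Cmod (F t)) L1 * rsum (fun t => Cmod (G t)) L2).
    + apply Rmult_le_compat; auto; apply rsum_ge0; intros; apply Cmod_ge_0.
    + rewrite <- rsum_prod. induction (list_prod L1 L2); simpl; [easy|].
      rewrite Cmod_mult; congruence.
Qed.

Lemma tsum_prod F G : asum F -> asum G ->
  tsum (fun p => F (fst p) * G (snd p))%C = (tsum F * tsum G)%C.
Proof.
  intros HF HG.
  assert (HP := asum_hs _ (asum_prod F G HF HG)).
  apply asum_hs in HF; apply asum_hs in HG.
  set (SP := tsum (fun p => _)) in *. set (S := tsum F) in *. set (S' := tsum G) in *.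
  destruct (Req_dec (Cmod (SP - S * S')) 0) as [H|H].
  { apply Cmod_eq_0 in H. replace SP with (SP - S * S' + S * S')%C by ring.
    rewrite H; ring. }
  exfalso. assert (Hp : 0 < Cmod (SP - S * S')) by (assert (X := Cmod_ge_0 (SP - S * S')); lra).
  set (e := Cmod (SP - S * S')) in *.
  set (c := Cmod S + Cmod S' + 1).
  assert (C0 : 0 <= Cmod S) by apply Cmod_ge_0.
  assert (C1 : 0 <= Cmod S') by apply Cmod_ge_0.
  (* With d at most 1, the error d^2 + d |S| + d |S'| is at most d c, hence at most e / 4, which
     contradicts the lower bound e / 2 that the distance e would force. *)
  set (d := Rmin 1 (e / (4 * c))).
  assert (Hc : 1 <= c) by (unfold c; lra).
  assert (Hd : 0 < d) by (apply Rmin_glb_lt; [lra|apply Rdiv_lt_0_compat; lra]).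
  assert (Hd1 : d <= 1) by apply Rmin_l.
  assert (Hdc : d * c <= e / 4).
  { apply Rle_trans with (e / (4 * c) * c).
    - apply Rmult_le_compat_r; [lra|apply Rmin_r].
    - right; field; lra. }
  destruct (HP (e / 2)) as (L0 & K0); [lra|].
  destruct (HF d Hd) as (L1 & K1), (HG d Hd) as (L2 & K2).
  set (A := nodup T_dec (L1 ++ map fst L0)). set (B := nodup T_dec (L2 ++ map snd L0)).
  assert (NA : NoDup A) by apply NoDup_nodup.
  assert (NB : NoDup B) by apply NoDup_nodup.
  specialize (K1 A NA). specialize (K2 B NB). specialize (K0 (list_prod A B)).
  rewrite lsum_prod in K0.
  assert (Q1 : Cmod (lsum F A - S) < d)
    by (apply K1; intros x Hx; apply nodup_In, in_or_app; auto).
  assert (Q2 : Cmod (lsum G B - S') < d)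
    by (apply K2; intros x Hx; apply nodup_In, in_or_app; auto).
  assert (Q0 : Cmod (lsum F A * lsum G B - SP) < e / 2).
  { apply K0; [apply NoDup_list_prod; auto|].
    intros (x, y) Hxy. apply in_prod; apply nodup_In, in_or_app; right;
        [apply (in_map fst _ _ Hxy)|apply (in_map snd _ _ Hxy)]. }
  assert (E : (SP - S * S' = - (lsum F A * lsum G B - SP) +
     ((lsum F A - S) * (lsum G B - S') + (S * (lsum G B - S') + (lsum F A - S) * S')))%C) by ring.
  assert (X : e <= e / 2 + (d * d + (Cmod S * d + d * Cmod S'))).
  2: { unfold c in Hdc. nra. }
  unfold e at 1. rewrite E.
  eapply Rle_trans; [apply Cmod_triangle|]. apply Rplus_le_compat; [rewrite Cmod_opp; lra|].
  eapply Rle_trans; [apply Cmod_triangle|]. apply Rplus_le_compat.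
  { rewrite Cmod_mult. apply Rmult_le_compat; try apply Cmod_ge_0; lra. }
  eapply Rle_trans; [apply Cmod_triangle|].
  rewrite !Cmod_mult. apply Rplus_le_compat; [apply Rmult_le_compat_l|apply Rmult_le_compat_r]; lra.
Qed.

End Products.

(** * Comparison with symmetric partial sums *)

Definition box (N : nat) : list Z :=
  map (fun k => (Z.of_nat k - Z.of_nat N)%Z) (seq 0 (S (2 * N))).

Lemma NoDup_box N : NoDup (box N).
Proof. apply FinFun.Injective_map_NoDup; [intros x y; lia|apply seq_NoDup]. Qed.

Lemma In_box N z : In z (box N) <-> (- Z.of_nat N <= z <= Z.of_nat N)%Z.
Proof.
  unfold box; rewrite in_map_iff; split.
  - intros (k & <- & Hk). apply in_seq in Hk. lia.
  - intros H. exists (Z.to_nat (z + Z.of_nat N)); split; [lia|]. apply in_seq; lia.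
Qed.

Lemma sum_sym_box f N : sum_sym f N = lsum f (box N).
Proof.
  unfold sum_sym, box. rewrite lsum_map.
  set (g := fun k => _). generalize (2 * N)%nat; intros n.
  induction n as [|n IH].
  - rewrite sum_O; simpl; ring.
  - rewrite sum_Sn, IH, (seq_S (S n)), lsum_app; simpl.
    unfold plus; simpl. ring.
Qed.

Lemma Clim_seq_climit u l : climit u l -> Clim_seq u = l.
Proof.
  intros H. unfold Clim_seq. apply C_eq; simpl.
  - rewrite (is_lim_seq_unique _ (Re l)); [easy|].
    apply is_lim_seq_Reals; intros eps He. destruct (H eps He) as (N & K).
    exists N; intros n Hn. eapply Rle_lt_trans; [|apply (K n Hn)].
    unfold Rdist. apply (Re_le_Cmod (u n - l)).
  - rewrite (is_lim_seq_unique _ (Im l)); [easy|].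
    apply is_lim_seq_Reals; intros eps He. destruct (H eps He) as (N & K).
    exists N; intros n Hn. eapply Rle_lt_trans; [|apply (K n Hn)].
    unfold Rdist. apply (Im_le_Cmod (u n - l)).
Qed.

(** The boxes eventually contain every finite set, so symmetric partial sums are a cofinal sequence
    in the net of [hs]. *)
Lemma sumZ_tsum (f : Z -> C) : asum f -> sumZ f = tsum f.
Proof.
  intros H. apply Clim_seq_climit. apply asum_hs in H.
  intros eps He. destruct (hs_lists f _ box H NoDup_box) with (2 := He) as (N & K).
  - intros t. exists (Z.abs_nat t); intros n Hn. apply In_box; lia.
  - exists N; intros n Hn. rewrite sum_sym_box. exact (K n Hn).
Qed.

Lemma sumZ2_tsum (f : Z -> Z -> C) :
  asum (fun p => f (fst p) (snd p)) -> sumZ2 f = tsum (fun p => f (fst p) (snd p)).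
Proof.
  intros H. apply Clim_seq_climit. apply asum_hs in H.
  intros eps He.
  destruct (hs_lists _ _ (fun N => list_prod (box N) (box N)) H) with (3 := He) as (N & K).
  - intros N; apply NoDup_list_prod; apply NoDup_box.
  - intros (x, y). exists (Z.abs_nat x + Z.abs_nat y)%nat; intros n Hn.
    apply in_prod; apply In_box; lia.
  - exists N; intros n Hn. specialize (K n Hn).
    replace (sum_sym (fun m => sum_sym (fun k => f m k) n) n) with
      (lsum (fun p => f (fst p) (snd p)) (list_prod (box n) (box n))); [exact K|].
    rewrite sum_sym_box, lsum_list_prod. apply lsum_ext; intros m _.
    rewrite sum_sym_box; reflexivity.
Qed.

(** * Exponentials *)

Lemma Cexp_add a b : Cexp (a + b) = (Cexp a * Cexp b)%C.
Proof.
  unfold Cexp. apply C_eq; unfold Re, Im; simpl; rewrite exp_plus, ?cos_plus, ?sin_plus; ring.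
Qed.

Lemma Cmod_Cexp w : Cmod (Cexp w) = exp (Re w).
Proof.
  unfold Cexp, Cmod; cbn [fst snd].
  assert (X := sin2_cos2 (Im w)). unfold Rsqr in X.
  transitivity (sqrt (exp (Re w) ^ 2)).
  - f_equal. replace (exp (Re w) ^ 2) with
      (exp (Re w) ^ 2 * (sin (Im w) * sin (Im w) + cos (Im w) * cos (Im w)))
      by (rewrite X; ring). ring.
  - apply sqrt_pow2. left; apply exp_pos.
Qed.

Lemma Cexp_0 : Cexp (RtoC 0) = RtoC 1.
Proof. unfold Cexp; simpl. rewrite exp_0, cos_0, sin_0. apply C_eq; simpl; ring. Qed.

Lemma epow_add x y w : epow (x + y) w = (epow x w * epow y w)%C.
Proof. unfold epow. rewrite <- Cexp_add, RtoC_plus. f_equal; ring. Qed.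

Lemma epow_wadd x w w' : epow x (w + w')%C = (epow x w * epow x w')%C.
Proof. unfold epow. rewrite <- Cexp_add. f_equal; ring. Qed.

Lemma epow_0 w : epow 0 w = RtoC 1.
Proof. unfold epow. rewrite <- Cexp_0. f_equal; ring. Qed.

Lemma epow_w0 x : epow x (RtoC 0) = RtoC 1.
Proof. unfold epow. rewrite <- Cexp_0. f_equal; ring. Qed.

Lemma epow_scal x (y : R) w : epow x (RtoC y * w)%C = epow (x * y) w.
Proof. unfold epow. rewrite (RtoC_mult x y). f_equal; ring. Qed.

Lemma epow_scal1 x (y : R) : epow x (RtoC y) = epow (x * y) (RtoC 1).
Proof. rewrite <- epow_scal. f_equal; ring. Qed.

Lemma epow_half x w : epow x (w / RtoC 2)%C = epow (x / 2) w.
Proof.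
  replace (w / RtoC 2)%C with (RtoC (/ 2) * w)%C.
  - rewrite epow_scal; easy.
  - rewrite RtoC_inv. field. lra.
Qed.

Lemma Cmod_epow x w : Cmod (epow x w) = exp (- (2 * PI * x * Im w)).
Proof. unfold epow. rewrite Cmod_Cexp. f_equal. unfold Re, Im; simpl. ring. Qed.

Lemma Cmod_epow_R x (y : R) : Cmod (epow x (RtoC y)) = 1.
Proof. rewrite Cmod_epow, <- exp_0. f_equal. simpl; ring. Qed.

Lemma epow_nz x w : epow x w <> RtoC 0.
Proof.
  intros H. assert (X := Cmod_epow x w). rewrite H, Cmod_0 in X.
  assert (Y := exp_pos (- (2 * PI * x * Im w))); lra.
Qed.

Lemma epow_nat (n : nat) x w : epow (INR n * x) w = Cpow (epow x w) n.
Proof.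
  induction n as [|n IH].
  - simpl INR. rewrite Rmult_0_l. apply epow_0.
  - rewrite S_INR, Rmult_plus_distr_r, Rmult_1_l, epow_add, IH, Cpow_S; ring.
Qed.

(** * Summability against a Gaussian *)

(** Polynomial growth in the size [s]. The class contains the characters, phases of modulus 1 and
    linear forms in the indices, and it is closed under products, so summability against a Gaussian
    survives every application of D_z. *)
Definition pgrow {T} (s : T -> R) (c : T -> C) : Prop :=
  exists K k, 0 <= K /\ forall t, Cmod (c t) <= K * (1 + s t) ^ k.

Lemma pgrow_mult {T} (s : T -> R) (c d : T -> C) : (forall t, 0 <= s t) ->
  pgrow s c -> pgrow s d -> pgrow s (fun t => c t * d t)%C.
Proof.
  intros Hs (K & k & HK & H) (K' & k' & HK' & H').
  exists (K * K'), (k + k')%nat; split; [nra|]. intros t.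
  rewrite Cmod_mult, pow_add.
  replace (K * K' * ((1 + s t) ^ k * (1 + s t) ^ k'))
    with ((K * (1 + s t) ^ k) * (K' * (1 + s t) ^ k')) by ring.
  apply Rmult_le_compat; auto; apply Cmod_ge_0.
Qed.

Lemma pgrow_bound {T} (s : T -> R) (c : T -> C) M :
  (forall t, Cmod (c t) <= M) -> pgrow s c.
Proof.
  intros H. exists (Rmax 0 M), 0%nat; split; [apply Rmax_l|].
  intros t; simpl. rewrite Rmult_1_r. eapply Rle_trans; [apply H|apply Rmax_r].
Qed.

Lemma pgrow_lin {T} (s : T -> R) (c : T -> C) M : 0 <= M -> (forall t, 0 <= s t) ->
  (forall t, Cmod (c t) <= M * s t) -> pgrow s c.
Proof.
  intros HM Hs H. exists M, 1%nat; split; auto. intros t; simpl.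
  specialize (H t). specialize (Hs t). nra.
Qed.

Lemma pgrow_pow {T} (s : T -> R) (c : T -> C) k : (forall t, 0 <= s t) ->
  pgrow s c -> pgrow s (fun t => Cpow (c t) k).
Proof.
  intros Hs H. induction k as [|k IH].
  - apply (pgrow_bound _ _ 1). intros; simpl. rewrite Cmod_1; lra.
  - apply (pgrow_mult s c (fun t => Cpow (c t) k)); auto.
Qed.

Lemma pgrow_ext {T} (s : T -> R) (c d : T -> C) :
  (forall t, c t = d t) -> pgrow s c -> pgrow s d.
Proof.
  intros E (K & k & HK & H). exists K, k; split; auto. intros t; rewrite <- E; auto.
Qed.

Lemma geom_bound x (a n : nat) : 0 <= x < 1 ->
  rsum (fun k => x ^ k) (seq a n) <= x ^ a / (1 - x).
Proof.
  intros Hx. revert a; induction n as [|n IH]; intros a; simpl.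
  - apply Rle_mult_inv_pos; [apply pow_le; lra|lra].
  - eapply Rle_trans; [apply Rplus_le_compat_l, IH|].
    right; simpl; field; lra.
Qed.

Lemma rsum_nat_bound (g : nat -> R) M : (forall k, 0 <= g k) ->
  (forall n, rsum g (seq 0 n) <= M) -> forall L, NoDup L -> rsum g L <= M.
Proof.
  intros Hg H L HL. eapply Rle_trans; [|apply (H (S (list_max L)))].
  apply rsum_incl; auto; [apply seq_NoDup|].
  intros k Hk. apply in_seq. assert (X := list_max_le L (list_max L)).
  destruct X as (X & _). specialize (X (le_n _)). rewrite Forall_forall in X.
  specialize (X k Hk). lia.
Qed.

Lemma rsum_Z_abs (g : nat -> R) M : (forall k, 0 <= g k) ->
  (forall n, rsum g (seq 0 n) <= M) ->
  forall L, NoDup L -> rsum (fun z => g (Z.abs_nat z)) L <= 2 * M.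
Proof.
  intros Hg H L HL.
  assert (E : rsum (fun z => g (Z.abs_nat z)) L =
     rsum g (map Z.abs_nat (filter (Z.leb 0) L))
     + rsum g (map Z.abs_nat (filter (fun z => negb (Z.leb 0 z)) L))).
  { rewrite !rsum_map. clear. induction L as [|z L IH]; simpl; [ring|].
    destruct (Z.leb 0 z); simpl; lra. }
  rewrite E. replace (2 * M) with (M + M) by ring.
  assert (X : forall (P : Z -> bool), (forall x y, P x = true -> P y = true ->
      Z.abs_nat x = Z.abs_nat y -> x = y) ->
      rsum g (map Z.abs_nat (filter P L)) <= M).
  { intros P HP. apply rsum_nat_bound; auto. apply NoDup_map_NoDup_ForallPairs.
    - intros x y Hx Hy. apply filter_In in Hx; apply filter_In in Hy. apply HP; tauto.
    - apply NoDup_filter; auto. }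
  apply Rplus_le_compat; apply X; intros x y Hx Hy Hxy;
    rewrite ?Bool.negb_true_iff in *; lia.
Qed.

Lemma sum_exp_abs : exists M, forall L, NoDup L ->
  rsum (fun z => exp (- Rabs (IZR z))) L <= M.
Proof.
  set (x := exp (- (1))).
  assert (Hx : 0 <= x < 1).
  { split; [left; apply exp_pos|]. rewrite <- exp_0. apply exp_increasing; lra. }
  exists (2 * (x ^ 0 / (1 - x))); intros L HL.
  apply Rle_trans with (rsum (fun z => x ^ Z.abs_nat z) L);
    [|apply (rsum_Z_abs (fun k => x ^ k)); auto].
  - right. clear HL; induction L as [|z L IH]; simpl; [easy|]. rewrite IH. f_equal.
    rewrite <- abs_IZR, <- Zabs2Nat.id_abs, <- INR_IZR_INZ. unfold x.
    induction (Z.abs_nat z) as [|n IHn]; [simpl; rewrite <- exp_0; f_equal; lra|].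
    rewrite S_INR; simpl. rewrite <- IHn, <- exp_plus. f_equal; ring.
  - intros; apply pow_le; lra.
  - intros; apply geom_bound; auto.
Qed.

Definition zsize (n : Z) : R := Rabs (IZR n).
Definition zsize2 (p : Z * Z) : R := Rabs (IZR (fst p)) + Rabs (IZR (snd p)).

Lemma zsize_ge0 n : 0 <= zsize n. Proof. apply Rabs_pos. Qed.
Lemma zsize2_ge0 p : 0 <= zsize2 p.
Proof. apply Rplus_le_le_0_compat; apply Rabs_pos. Qed.

Lemma poly_gauss_le (k : nat) c : 0 < c -> exists K, 0 <= K /\ forall x, 0 <= x ->
  (1 + x) ^ k * exp (- (c * x ^ 2)) <= K * exp (- x).
Proof.
  (* From (1 + x)^k <= exp (k (1 + x)), completing the square in (k + 1) x - c x^2 leaves the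
     maximum (k + 1)^2 / (4 c). *)
  intros Hc. exists (exp (INR k + (INR k + 1) ^ 2 / (4 * c))); split; [left; apply exp_pos|].
  intros x Hx.
  assert (E : (1 + x) ^ k <= exp (INR k * (1 + x))).
  { clear -Hx. induction k as [|k IH]; [simpl; rewrite Rmult_0_l, exp_0; lra|].
    rewrite S_INR, Rmult_plus_distr_r, exp_plus, Rmult_1_l; simpl.
    rewrite (Rmult_comm (exp _)).
    apply Rmult_le_compat; auto; [lra|apply pow_le; lra|].
    left. apply Rle_lt_trans with (1 + (1 + x)); [lra|apply exp_ineq1; lra]. }
  apply Rle_trans with (exp (INR k * (1 + x)) * exp (- (c * x ^ 2))).
  { apply Rmult_le_compat_r; auto. left; apply exp_pos. }
  rewrite <- !exp_plus. 
  assert (X : INR k * (1 + x) + - (c * x ^ 2) <= INR k + (INR k + 1) ^ 2 / (4 * c) + - x).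
  2: { destruct X as [X|X]; [left; apply exp_increasing; auto|right; f_equal; auto]. }
  assert (Y : 0 <= c * (x - (INR k + 1) / (2 * c)) ^ 2)
    by (apply Rmult_le_pos; [lra|apply pow2_ge_0]).
  replace (c * (x - (INR k + 1) / (2 * c)) ^ 2) with
    (c * x ^ 2 - (INR k + 1) * x + (INR k + 1) ^ 2 / (4 * c)) in Y by (field; lra).
  lra.
Qed.

Lemma asum_gauss (c : Z -> C) (e : Z -> R) l tau : pgrow zsize c ->
  0 < l -> 0 < Im tau -> (forall n, e n = l * IZR n ^ 2) ->
  asum (fun n => c n * epow (e n) tau)%C.
Proof.
  intros (K & k & HK & H) Hl Ht He.
  destruct (poly_gauss_le k (2 * PI * l * Im tau)) as (K' & HK' & H').
  { assert (X := PI_RGT_0). apply Rmult_lt_0_compat; auto. apply Rmult_lt_0_compat; lra. }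
  destruct sum_exp_abs as (M & HM).
  apply (asum_le _ (fun z => K * K' * exp (- Rabs (IZR z))) (K * K' * M)).
  - intros n. rewrite Cmod_mult, Cmod_epow, He.
    apply Rle_trans with (K * (1 + zsize n) ^ k * exp (- (2 * PI * l * Im tau * Rabs (IZR n) ^ 2))).
    + apply Rmult_le_compat; auto; [apply Cmod_ge_0|left; apply exp_pos|].
      right; f_equal. rewrite <- (Rsqr_pow2 (Rabs _)), <- Rsqr_abs, Rsqr_pow2. ring.
    + rewrite !Rmult_assoc. apply Rmult_le_compat_l; auto.
      rewrite <- !Rmult_assoc. apply H', Rabs_pos.
  - intros L HL. rewrite rsum_scal. apply Rmult_le_compat_l; auto.
    apply Rmult_le_pos; auto.
Qed.

(** Since 1 + |m| + |n| <= (1 + |m|) (1 + |n|), the family is dominated by a product of two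
    one-dimensional Gaussian families. *)
Lemma asum_gauss2 (c : Z * Z -> C) (e : Z * Z -> R) l tau : pgrow zsize2 c ->
  0 < l -> 0 < Im tau ->
  (forall p, l * (IZR (fst p) ^ 2 + IZR (snd p) ^ 2) <= e p) ->
  asum (fun p => c p * epow (e p) tau)%C.
Proof.
  intros (K & k & HK & H) Hl Ht He.
  set (G := fun n : Z => (RtoC ((1 + zsize n) ^ k) * epow (l * IZR n ^ 2) tau)%C).
  assert (AG : asum G).
  { apply (asum_gauss _ _ l); auto. exists 1, k; split; [lra|]. intros n.
    rewrite Cmod_R, Rabs_pos_eq; [lra|]. apply pow_le.
    assert (X := zsize_ge0 n); lra. }
  apply asum_dom with (fun p => RtoC K * (G (fst p) * G (snd p)))%C;
    [|apply asum_scal, asum_prod; auto].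
  intros (m, n). unfold G; simpl fst; simpl snd.
  assert (Xm := zsize_ge0 m); assert (Xn := zsize_ge0 n).
  rewrite !Cmod_mult, !Cmod_epow, !Cmod_R, !Rabs_pos_eq by (auto; apply pow_le; lra).
  eapply Rle_trans.
  - apply Rmult_le_compat_r; [left; apply exp_pos|apply H].
  - rewrite Rmult_assoc. apply Rmult_le_compat_l; auto.
    replace ((1 + zsize m) ^ k * exp (- (2 * PI * (l * IZR m ^ 2) * Im tau))
       * ((1 + zsize n) ^ k * exp (- (2 * PI * (l * IZR n ^ 2) * Im tau)))) with
      (((1 + zsize m) * (1 + zsize n)) ^ k *
        (exp (- (2 * PI * (l * IZR m ^ 2) * Im tau)) * exp (- (2 * PI * (l * IZR n ^ 2) * Im tau))))
      by (rewrite Rpow_mult_distr; ring).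
    rewrite <- exp_plus. apply Rmult_le_compat; try (left; apply exp_pos).
    + apply pow_le. assert (X := zsize2_ge0 (m, n)); lra.
    + apply pow_incr. unfold zsize2, zsize in *; simpl in *. split; nra.
    + specialize (He (m, n)); simpl in He.
      assert (EL : forall a b, a <= b -> exp a <= exp b)
        by (intros a b [Q|Q]; [left; apply exp_increasing; auto|right; congruence]).
      apply EL.
      assert (X := PI_RGT_0).
      assert (Y : 0 < 2 * PI * Im tau) by (apply Rmult_lt_0_compat; auto; lra).
      assert (Z := Rmult_le_compat_l _ _ _ (Rlt_le _ _ Y) He). lra.
Qed.

(** * Derivatives of complex-valued functions of a real variable *)

Definition dC (f : R -> C) (x : R) (d : C) : Prop :=
  is_derive (fun t => Re (f t)) x (Re d) /\ is_derive (fun t => Im (f t)) x (Im d).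

Lemma dC_ext f g x d : (forall t, f t = g t) -> dC f x d -> dC g x d.
Proof.
  intros E (H1 & H2); split; [eapply is_derive_ext; [|exact H1]|eapply is_derive_ext; [|exact H2]];
    intros t; simpl; rewrite E; easy.
Qed.

Lemma dC_unique f x d d' : dC f x d -> dC f x d' -> d = d'.
Proof.
  intros (H1 & H2) (H1' & H2'). apply is_derive_unique in H1, H2, H1', H2'.
  apply C_eq; congruence.
Qed.

Lemma dC_const c x : dC (fun _ => c) x (RtoC 0).
Proof. split; simpl; [exact (is_derive_const (Re c) x)|exact (is_derive_const (Im c) x)]. Qed.

Lemma dC_plus f g x d e : dC f x d -> dC g x e -> dC (fun t => f t + g t)%C x (d + e)%C.
Proof.
  intros (H1 & H2) (H3 & H4); split; [apply (is_derive_plus _ _ _ _ _ H1 H3)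
    |apply (is_derive_plus _ _ _ _ _ H2 H4)].
Qed.

Lemma dC_mult f g x d e : dC f x d -> dC g x e ->
  dC (fun t => f t * g t)%C x (d * g x + f x * e)%C.
Proof.
  intros (H1 & H2) (H3 & H4); split; simpl.
  - assert (Y1 := is_derive_mult _ _ _ _ _ H1 H3 Rmult_comm).
    assert (Y2 := is_derive_mult _ _ _ _ _ H2 H4 Rmult_comm).
    assert (Y := is_derive_minus _ _ _ _ _ Y1 Y2).
    eapply is_derive_ext; [|replace (_ - _ + _) with (minus (plus (mult (Re d) (Re (g x))) (mult (Re (f x)) (Re e)))
         (plus (mult (Im d) (Im (g x))) (mult (Im (f x)) (Im e)))); [exact Y|]].
    + intros t; reflexivity.
    + unfold minus, plus, mult, opp; simpl. unfold mult; unfold Re, Im; simpl. ring.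
  - assert (Y1 := is_derive_mult _ _ _ _ _ H1 H4 Rmult_comm).
    assert (Y2 := is_derive_mult _ _ _ _ _ H2 H3 Rmult_comm).
    assert (Y := is_derive_plus _ _ _ _ _ Y1 Y2).
    eapply is_derive_ext; [|replace (_ + _) with (plus (plus (mult (Re d) (Im (g x))) (mult (Re (f x)) (Im e)))
         (plus (mult (Im d) (Re (g x))) (mult (Im (f x)) (Re e)))); [exact Y|]].
    + intros t; reflexivity.
    + unfold plus, mult; simpl. unfold mult; unfold Re, Im; simpl. ring.
Qed.

Lemma dC_inv f x d : dC f x d -> f x <> RtoC 0 ->
  dC (fun t => / f t)%C x (- (d / (f x * f x)))%C.
Proof.
  intros (H1 & H2) H0.
  set (a := fun t => Re (f t)) in *. set (b := fun t => Im (f t)) in *.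
  assert (N : a x * a x + b x * b x <> 0).
  { intros X. apply H0. apply C_eq; unfold a, b in X; simpl; nra. }
  assert (E1 : is_derive (fun t => a t / (a t * a t + b t * b t)) x
     ((Re d * (b x * b x - a x * a x) - 2 * a x * b x * Im d) / (a x * a x + b x * b x) ^ 2)).
  { assert (A1 : ex_derive a x) by (eexists; exact H1).
    assert (B1 : ex_derive b x) by (eexists; exact H2).
    auto_derive; [repeat split; auto|].
    change (Derive (fun x0 => a x0) x) with (Derive a x).
    change (Derive (fun x0 => b x0) x) with (Derive b x).
    rewrite (is_derive_unique a x (Re d) H1), (is_derive_unique b x (Im d) H2). field; auto. }
  assert (E2 : is_derive (fun t => - b t / (a t * a t + b t * b t)) x
     ((Im d * (b x * b x - a x * a x) + 2 * a x * b x * Re d) / (a x * a x + b x * b x) ^ 2)).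
  { assert (A1 : ex_derive a x) by (eexists; exact H1).
    assert (B1 : ex_derive b x) by (eexists; exact H2).
    auto_derive; [repeat split; auto|].
    change (Derive (fun x0 => a x0) x) with (Derive a x).
    change (Derive (fun x0 => b x0) x) with (Derive b x).
    rewrite (is_derive_unique a x (Re d) H1), (is_derive_unique b x (Im d) H2). field; auto. }
  set (r := (Re d * (b x * b x - a x * a x) - 2 * a x * b x * Im d) / (a x * a x + b x * b x) ^ 2) in *.
  set (i := (Im d * (b x * b x - a x * a x) + 2 * a x * b x * Re d) / (a x * a x + b x * b x) ^ 2) in *.
  assert (Q : (- (d / (f x * f x)))%C = (r, i)).
  { assert (P : d = (- (r, i) * (f x * f x))%C).
    { apply C_eq; unfold r, i, a, b, Re, Im in *; simpl; field; auto. }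
    rewrite P. field; auto. }
  rewrite Q. split; simpl.
  - eapply is_derive_ext; [|exact E1]. intros t; unfold a, b, Re, Im; simpl. f_equal. ring.
  - eapply is_derive_ext; [|exact E2]. intros t; unfold a, b, Re, Im; simpl. f_equal. ring.
Qed.

(** A remainder bound valid for every h, not only near 0, is one that can be summed over the terms
    of a series. *)
Lemma is_derive_quadratic (f : R -> R) x d M :
  (forall h, Rabs (f (x + h) - f x - h * d) <= M * h ^ 2) -> is_derive f x d.
Proof.
  intros H. apply is_derive_Reals. intros eps He.
  assert (HM : 0 <= M).
  { specialize (H 1). assert (X := Rabs_pos (f (x + 1) - f x - 1 * d)). simpl in H. lra. }
  assert (Hd : 0 < eps / (M + 1)) by (apply Rdiv_lt_0_compat; lra).
  exists (mkposreal _ Hd); intros h Hh Hh'; simpl in Hh'.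
  replace ((f (x + h) - f x) / h - d) with ((f (x + h) - f x - h * d) / h) by (field; auto).
  assert (Ah := Rabs_pos_lt h Hh).
  unfold Rdiv; rewrite Rabs_mult, Rabs_inv.
  apply Rle_lt_trans with (M * h ^ 2 * / Rabs h).
  { apply Rmult_le_compat_r; auto. left; apply Rinv_0_lt_compat; auto. }
  rewrite <- (Rsqr_pow2 h), Rsqr_abs, Rsqr_pow2.
  replace (M * Rabs h ^ 2 * / Rabs h) with (M * Rabs h) by (field; lra).
  apply (Rmult_lt_compat_r (M + 1)) in Hh'; [|lra].
  replace (eps / (M + 1) * (M + 1)) with eps in Hh' by (field; lra). nra.
Qed.

Lemma dC_quadratic (f : R -> C) x d M :
  (forall h, Cmod (f (x + h) - f x - RtoC h * d) <= M * h ^ 2) -> dC f x d.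
Proof.
  intros H; split; apply (is_derive_quadratic _ _ _ M); intros h;
    (eapply Rle_trans; [|apply (H h)]).
  - eapply Rle_trans; [|apply Re_le_Cmod]. right; f_equal; unfold Re, Im; simpl; ring.
  - eapply Rle_trans; [|apply Im_le_Cmod]. right; f_equal; unfold Re, Im; simpl; ring.
Qed.

Lemma Rabs_sin_le x : Rabs (sin x) <= Rabs x.
Proof.
  destruct (MVT_abs sin cos 0 x) as (c & Hc & _).
  - intros; apply derivable_pt_lim_sin.
  - rewrite sin_0, !Rminus_0_r in Hc. rewrite Hc.
    assert (Rabs (cos c) <= 1) by (apply Rabs_le, COS_bound).
    assert (X := Rabs_pos x). nra.
Qed.

Lemma one_minus_cos x : 1 - cos x = 2 * sin (x / 2) ^ 2.
Proof.
  replace x with (2 * (x / 2)) at 1 by field. rewrite cos_2a_sin. ring.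
Qed.

Lemma Rabs_cos1_le2 x : Rabs (cos x - 1) <= x ^ 2 / 2.
Proof.
  rewrite <- Rabs_Ropp. replace (- (cos x - 1)) with (1 - cos x) by ring.
  rewrite one_minus_cos. assert (X := Rabs_sin_le (x / 2)).
  apply Rsqr_le_abs_1 in X. unfold Rsqr in X.
  rewrite Rabs_pos_eq by nra. nra.
Qed.

Lemma Rabs_cos1_le x : Rabs (cos x - 1) <= Rabs x.
Proof.
  rewrite <- Rabs_Ropp. replace (- (cos x - 1)) with (1 - cos x) by ring.
  rewrite one_minus_cos. assert (X := Rabs_sin_le (x / 2)).
  assert (Y : Rabs (sin (x / 2)) <= 1) by (apply Rabs_le, SIN_bound).
  rewrite Rabs_mult, <- RPow_abs, (Rabs_pos_eq 2) by lra.
  replace (Rabs (x / 2)) with (Rabs x / 2) in X.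
  - assert (Z := Rabs_pos (sin (x / 2))). nra.
  - unfold Rdiv. rewrite Rabs_mult, (Rabs_pos_eq (/ 2)) by lra. easy.
Qed.

Lemma Rabs_sin_minus_le x : Rabs (sin x - x) <= x ^ 2.
Proof.
  destruct (MVT_abs (fun x => sin x - x) (fun x => cos x - 1) 0 x) as (c & Hc & Hb).
  - intros c _. apply is_derive_Reals. auto_derive; auto. ring.
  - rewrite sin_0, !Rminus_0_r in Hc. rewrite Hc.
    assert (X := Rabs_cos1_le c).
    assert (Y : Rabs c <= Rabs x).
    { revert Hb. unfold Rmin, Rmax. destruct (Rle_dec 0 x); intros Hb.
      - rewrite !Rabs_pos_eq; lra.
      - rewrite !Rabs_left1; lra. }
    rewrite <- (Rsqr_pow2 x), (Rsqr_abs x). unfold Rsqr.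
    apply Rmult_le_compat_r; [apply Rabs_pos|lra].
Qed.

(** The constant is uniform in x because [epow l] has modulus 1 at real arguments. It combines the
    bounds th^2 / 2 for cos th - 1 and th^2 for sin th - th. *)
Lemma epow_increment l x h :
  Cmod (epow l (RtoC (x + h)) - epow l (RtoC x)
        - RtoC h * (RtoC (2 * PI) * Ci * RtoC l * epow l (RtoC x)))
    <= 2 * (2 * PI * l * h) ^ 2.
Proof.
  rewrite RtoC_plus, epow_wadd.
  set (th := 2 * PI * l * h).
  replace (epow l (RtoC x) * epow l (RtoC h) - epow l (RtoC x) -
    RtoC h * (RtoC (2 * PI) * Ci * RtoC l * epow l (RtoC x)))%C with
    (epow l (RtoC x) * (epow l (RtoC h) - RtoC 1 - RtoC th * Ci))%C
    by (unfold th; rewrite !RtoC_mult; ring).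
  rewrite Cmod_mult, Cmod_epow_R, Rmult_1_l.
  replace (epow l (RtoC h)) with (cos th, sin th).
  2: { unfold epow, Cexp, th; apply C_eq; simpl;
       match goal with |- context [exp ?e] => replace e with 0 by ring end;
       rewrite exp_0, Rmult_1_l; f_equal; ring. }
  eapply Rle_trans; [apply Cmod_le_Re_Im|]. simpl.
  assert (X := Rabs_cos1_le2 th). assert (Y := Rabs_sin_minus_le th).
  replace (cos th + - (1) + - (th * 0 - 0 * 1)) with (cos th - 1) by ring.
  replace (sin th + - 0 + - (th * 1 + 0 * 0)) with (sin th - th) by ring.
  simpl in X, Y. nra.
Qed.

Lemma rsum_plus {T} (f g : T -> R) L : rsum (fun t => f t + g t) L = rsum f L + rsum g L.
Proof. induction L; simpl; lra. Qed.

(** Interpolation between orders 0 and 2 through |l| <= 1 + l^2. *)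
Lemma asum_mid {T} (c : T -> C) (l : T -> R) : asum c ->
  asum (fun t => RtoC (l t ^ 2) * c t)%C -> asum (fun t => RtoC (l t) * c t)%C.
Proof.
  intros H1 H2. apply asum_plus with (1 := H1) in H2 as H3.
  destruct H1 as (M1 & H1), H2 as (M2 & H2).
  apply (asum_le _ (fun t => Cmod (c t) + Cmod (RtoC (l t ^ 2) * c t)) (M1 + M2)).
  - intros t. rewrite !Cmod_mult, !Cmod_R. rewrite (Rabs_pos_eq (l t ^ 2)) by apply pow2_ge_0.
    assert (X := Cmod_ge_0 (c t)).
    assert (Y : Rabs (l t) <= 1 + l t ^ 2).
    { apply Rabs_le. split; nra. }
    nra.
  - intros L HL. specialize (H1 L HL); specialize (H2 L HL).
    rewrite rsum_plus; lra.
Qed.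

(** Termwise differentiation: the second-order remainder of each term is at most 8 pi^2 h^2 l^2 |c|,
    which is summable, so the remainder of the whole series is quadratic in h. *)
Lemma dC_series {T} (c : T -> C) (l : T -> R) x : asum c ->
  asum (fun t => RtoC (l t ^ 2) * c t)%C ->
  dC (fun s => tsum (fun t => c t * epow (l t) (RtoC s))%C) x
     (RtoC (2 * PI) * Ci * tsum (fun t => RtoC (l t) * c t * epow (l t) (RtoC x))%C)%C.
Proof.
  intros H1 H2. assert (H3 := asum_mid c l H1 H2).
  destruct H2 as (M & HM).
  assert (U : forall (a : T -> C) s, asum a -> asum (fun t => a t * epow (l t) (RtoC s))%C).
  { intros a s; apply asum_dom; intros t. rewrite Cmod_mult, Cmod_epow_R; lra. }
  apply (dC_quadratic _ _ _ (8 * PI ^ 2 * M)). intros h.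
  set (a1 := fun t => (c t * epow (l t) (RtoC (x + h)))%C).
  set (a2 := fun t => (c t * epow (l t) (RtoC x))%C).
  set (a3 := fun t => (RtoC h * (RtoC (2 * PI) * Ci * (RtoC (l t) * c t * epow (l t) (RtoC x))))%C).
  assert (A3 : asum a3) by (apply asum_scal, asum_scal; auto).
  replace (RtoC h * _)%C with (tsum a3) by (unfold a3; rewrite !tsum_scal; auto using asum_scal).
  replace (tsum a1 - tsum a2 - tsum a3)%C with
    (tsum (fun t => a1 t + (RtoC (-1) * a2 t + RtoC (-1) * a3 t)))%C.
  2: { rewrite tsum_plus, tsum_plus, !tsum_scal;
       try (unfold a1, a2; auto using asum_scal, asum_plus; fail).
       ring. }
  apply Cmod_tsum_le. intros L HL. specialize (HM L HL).
  apply Rle_trans with (rsum (fun t => 8 * PI ^ 2 * h ^ 2 * Cmod (RtoC (l t ^ 2) * c t)) L).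
  - apply rsum_le; intros t _. unfold a1, a2, a3.
    replace (_ + _)%C with (c t * (epow (l t) (RtoC (x + h)) - epow (l t) (RtoC x)
        - RtoC h * (RtoC (2 * PI) * Ci * RtoC (l t) * epow (l t) (RtoC x))))%C by ring.
    rewrite !Cmod_mult, Cmod_R, (Rabs_pos_eq (l t ^ 2)) by apply pow2_ge_0.
    assert (X := epow_increment (l t) x h). assert (Y := Cmod_ge_0 (c t)).
    eapply Rle_trans; [apply Rmult_le_compat_l; [auto|apply X]|]. right; ring.
  - rewrite rsum_scal. assert (0 <= PI ^ 2 * h ^ 2) by (rewrite <- Rpow_mult_distr; apply pow2_ge_0).
    nra.
Qed.

(** * The characters n -> (a/n) for a = 4, -4, 12, -12 *)

Open Scope Z_scope.

Definition chi4 (n : Z) : Z := if Z.even n then 0 else 1.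
Definition chim4 (n : Z) : Z :=
  if n mod 4 =? 1 then 1 else if n mod 4 =? 3 then -1 else 0.
Definition chi3 (n : Z) : Z :=
  if n mod 3 =? 1 then 1 else if n mod 3 =? 2 then -1 else 0.
(** The factorisations 12 = (-4) (-3) and -12 = 4 (-3), combined with the reciprocity (-3/n) = (n/3)
    for odd n, give this product and the next one. *)
Definition chi12 (n : Z) : Z := chim4 n * chi3 n.
Definition chim12 (n : Z) : Z := chi4 n * chi3 n.

Lemma chi4_mul a b : chi4 (a * b) = chi4 a * chi4 b.
Proof. unfold chi4; rewrite Z.even_mul. destruct (Z.even a), (Z.even b); reflexivity. Qed.

Lemma chim4_mul a b : chim4 (a * b) = chim4 a * chim4 b.
Proof.
  unfold chim4; rewrite Z.mul_mod by lia.
  assert (Ha := Z.mod_pos_bound a 4 ltac:(lia)). assert (Hb := Z.mod_pos_bound b 4 ltac:(lia)).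
  assert (Ca : a mod 4 = 0 \/ a mod 4 = 1 \/ a mod 4 = 2 \/ a mod 4 = 3) by lia.
  assert (Cb : b mod 4 = 0 \/ b mod 4 = 1 \/ b mod 4 = 2 \/ b mod 4 = 3) by lia.
  destruct Ca as [->|[->|[->| ->]]], Cb as [->|[->|[->| ->]]]; reflexivity.
Qed.

Lemma chi3_mul a b : chi3 (a * b) = chi3 a * chi3 b.
Proof.
  unfold chi3; rewrite Z.mul_mod by lia.
  assert (Ha := Z.mod_pos_bound a 3 ltac:(lia)). assert (Hb := Z.mod_pos_bound b 3 ltac:(lia)).
  assert (Ca : a mod 3 = 0 \/ a mod 3 = 1 \/ a mod 3 = 2) by lia.
  assert (Cb : b mod 3 = 0 \/ b mod 3 = 1 \/ b mod 3 = 2) by lia.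
  destruct Ca as [->|[->| ->]], Cb as [->|[->| ->]]; reflexivity.
Qed.

Lemma chi12_mul a b : chi12 (a * b) = chi12 a * chi12 b.
Proof. unfold chi12; rewrite chim4_mul, chi3_mul; ring. Qed.

Lemma chim12_mul a b : chim12 (a * b) = chim12 a * chim12 b.
Proof. unfold chim12; rewrite chi4_mul, chi3_mul; ring. Qed.

Lemma chi4_per n k : chi4 (n + 12 * k) = chi4 n.
Proof. unfold chi4. rewrite Z.even_add, Z.even_mul. destruct (Z.even n); reflexivity. Qed.

Lemma chim4_per n k : chim4 (n + 12 * k) = chim4 n.
Proof.
  unfold chim4. replace (n + 12 * k) with (n + (3 * k) * 4) by ring.
  rewrite Z_mod_plus_full; reflexivity.
Qed.

Lemma chi3_per n k : chi3 (n + 12 * k) = chi3 n.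
Proof.
  unfold chi3. replace (n + 12 * k) with (n + (4 * k) * 3) by ring.
  rewrite Z_mod_plus_full; reflexivity.
Qed.

Lemma chi_opp n : chi4 (- n) = chi4 n /\ chim4 (- n) = - chim4 n /\
  chi12 (- n) = chi12 n /\ chim12 (- n) = - chim12 n.
Proof.
  replace (- n) with (-1 * n) by ring.
  rewrite chi4_mul, chim4_mul, chi12_mul, chim12_mul.
  repeat split; cbn -[chi4 chim4 chi12 chim12 Z.mul];
  change (chi4 (-1)) with 1; change (chim4 (-1)) with (-1);
  change (chi12 (-1)) with 1; change (chim12 (-1)) with (-1); ring.
Qed.

Close Scope Z_scope.

(** * Quadratic residues modulo p and evaluation of the Kronecker symbols *)

Module QuadraticResidues.
Import all_boot all_algebra cyclic finfield zify ring.
Set Implicit Arguments. Unset Strict Implicit. Unset Printing Implicit Defensive.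
Import GRing.Theory.
Local Open Scope ring_scope.

Definition issq (p : nat) (a : 'F_p) : bool := [exists x : 'F_p, x ^+ 2 == a].

Section Identities.
Variables (F : fieldType) (w : F).

(** If x^2 = -3 then (x - 1) / 2 is a root of w^2 + w + 1; conversely such a w gives the square root
    2 w + 1 of -3, by [cyclotomic3_sqr]. *)
Lemma cyclotomic3_half : 2%:R != 0 :> F ->
  2%:R * 2%:R * (((w - 1) / 2%:R) ^+ 2 + (w - 1) / 2%:R + 1) = w ^+ 2 + 3%:R.
Proof. move=> h; field; exact: h. Qed.

Lemma cyclotomic3_cube : (w - 1) * (w ^+ 2 + w + 1) = w ^+ 3 - 1.
Proof. ring. Qed.

Lemma cyclotomic3_sqr : (2%:R * w + 1) ^+ 2 = 4%:R * (w ^+ 2 + w + 1) - 3%:R.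
Proof. ring. Qed.

End Identities.

Section Odd.
Variables (p : nat).
Hypotheses (pp : prime p) (op : odd p).

(** The p - 1 nonzero elements are all roots of X^(p-1) - 1, and a field with that many roots of
    unity contains a primitive one. *)
Lemma Fp_prim_root : exists g : 'F_p, (p.-1).-primitive_root g.
Proof.
have h0 : (0 < p.-1)%N by have := prime_gt1 pp; lia.
pose rs := [seq x <- enum 'F_p | x != 0].
have /hasP [g _ hg] : has (p.-1).-primitive_root rs.
  apply: has_prim_root => //.
  - apply/allP => x; rewrite mem_filter => /andP [x0 _].
    apply/unity_rootP.
    have e := expf_card x. rewrite card_Fp // in e.
    apply: (mulfI x0). rewrite -exprS mulr1 prednK ?prime_gt0 //.
  - by rewrite filter_uniq ?enum_uniq.
  - rewrite size_filter.
    have := count_predC (fun x : 'F_p => x != 0) (enum 'F_p).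
    have -> : count (predC (fun x : 'F_p => x != 0)) (enum 'F_p) = 1%N.
      rewrite (eq_count (a2 := pred1 0)); last by move=> x /=; rewrite negbK.
      by rewrite count_uniq_mem ?enum_uniq // mem_enum.
    rewrite -cardE card_Fp // => e.
    have -> // : p.-1 = count (fun x : 'F_p => x != 0) (enum 'F_p).
    by rewrite -[in LHS]e addn1.
by exists g.
Qed.

Let g := xchoose Fp_prim_root.
Let gP : (p.-1).-primitive_root g := xchooseP Fp_prim_root.

Let nz_exp (a : 'F_p) : a != 0 -> exists i, a = g ^+ i.
Proof.
move=> a0; have e := expf_card a; rewrite card_Fp // in e.
have /(prim_rootP gP) [i ->] : a ^+ p.-1 = 1.
  by apply: (mulfI a0); rewrite -exprS mulr1 prednK ?prime_gt0.
by exists i.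
Qed.

Let g0 i : g ^+ i != 0.
Proof.
apply/expf_neq0/eqP => g0; have := prim_expr_order gP.
have h0 : (0 < p.-1)%N by have := prime_gt1 pp; lia.
by rewrite g0 expr0n; case: (p.-1) h0 => // n _ /eqP; rewrite eq_sym oner_eq0.
Qed.

(** As p - 1 is even, the parity of an exponent of the primitive root is well defined. *)
Let issq_exp i : issq (g ^+ i) = ~~ odd i.
Proof.
apply/existsP/idP => [[x /eqP hx]|hi].
- have x0 : x != 0.
    by apply/eqP => x0; move: (g0 i); rewrite -hx x0 expr0n eqxx.
  have [j ej] := nz_exp x0.
  move: hx; rewrite ej -exprM => /eqP; rewrite (eq_prim_root_expr gP).
  move=> /eqP h; have h2 : (2 %| p.-1)%N by move: op (prime_gt1 pp); lia.
  have := congr1 (modn^~ 2) h; rewrite /= !modn_dvdm // modnMl modn2.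
  by case: (odd i).
- exists (g ^+ i./2); rewrite -exprM muln2 even_halfK //.
Qed.

Lemma issqM (a b : 'F_p) : a != 0 -> b != 0 -> issq (a * b) = (issq a == issq b).
Proof.
move=> /nz_exp [i ->] /nz_exp [j ->]; rewrite -exprD !issq_exp oddD.
by case: (odd i); case: (odd j).
Qed.

Let natF0 n : (0 < n < p)%N -> (n%:R : 'F_p) != 0.
Proof.
move=> /andP [n0 np]; rewrite -(dvdn_pcharf (pchar_Fp pp)).
by apply/negP => /dvdn_leq; rewrite n0 => /(_ isT); rewrite leqNgt np.
Qed.

(** -1 is the power of the primitive root with exponent (p - 1) / 2, hence a square exactly when
    that exponent is even. *)
Lemma issq_N1 : issq (-1 : 'F_p) = (4 %| p.-1)%N.
Proof.
have p1 := prime_gt1 pp.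
have p2 : (2 < p)%N by move: op p1; case: p => [|[|[|]]].
have [k ek] : exists k, p.-1 = k.*2 by exists (p.-1)./2; lia.
have k0 : (0 < k)%N by lia.
have e : (-1 : 'F_p) = g ^+ k.
  have : (g ^+ k - 1) * (g ^+ k + 1) = 0.
    by rewrite -subr_sqr_1 -exprM muln2 -ek (prim_expr_order gP) subrr.
  move/eqP; rewrite mulf_eq0 => /orP [|].
  - rewrite subr_eq0 -[1](expr0 g) (eq_prim_root_expr gP) mod0n modn_small ?ek; lia.
  - by rewrite addr_eq0 => /eqP ->.
rewrite e issq_exp ek. lia.
Qed.

(** A square root of -3 amounts to a primitive cube root of unity, and the cyclic group of order p -
    1 contains one exactly when 3 divides p - 1. *)
Lemma issq_N3 : p != 3%N -> issq (- 3%:R : 'F_p) = (3 %| p.-1)%N.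
Proof.
move=> p3; have p1 := prime_gt1 pp.
have p4 : (4 < p)%N by move: op p1 pp p3; case: p => [|[|[|[|[|]]]]].
have two0 : (2%:R : 'F_p) != 0 by apply: natF0; lia.
have three0 : (3%:R : 'F_p) != 0 by apply: natF0; lia.
apply/existsP/idP => [[x /eqP hx]|/dvdnP [k ek]].
- pose w := (x - 1) / 2%:R.
  have ew : w ^+ 2 + w + 1 = 0.
    apply: (mulfI (mulf_neq0 two0 two0)); rewrite mulr0.
    by rewrite /w cyclotomic3_half // hx addNr.
  have w3 : w ^+ 3 = 1.
    by apply/eqP; rewrite -subr_eq0 -cyclotomic3_cube ew mulr0.
  have w0 : w != 0.
    by apply/eqP => w0; move: w3; rewrite w0 expr0n /= => /eqP; rewrite eq_sym oner_eq0.
  have w1 : w != 1.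
    apply/eqP => w1; move: ew; rewrite w1 expr1n => h.
    have h3 : (3%:R : 'F_p) = 0 by rewrite -h -[3%N]/(1 + 1 + 1)%N !natrD.
    by rewrite h3 eqxx in three0.
  have [i ei] := nz_exp w0.
  move: w1 w3; rewrite ei -exprM -[1](expr0 g) !(eq_prim_root_expr gP) !mod0n.
  rewrite -!/(dvdn _ _) => h1 /eqP h2. apply/negPn/negP => h3.
  move/negP: h1; apply. 
  have : coprime p.-1 3 by rewrite coprime_sym prime_coprime.
  move=> c; rewrite -(Gauss_dvdl i c). by move: h2; rewrite (eq_prim_root_expr gP) mod0n.
- pose w := g ^+ k.
  have k0 : (0 < k)%N by lia.
  have w3 : w ^+ 3 = 1 by rewrite /w -exprM -ek (prim_expr_order gP).
  have w1 : w - 1 != 0.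
    rewrite subr_eq0 -[1](expr0 g) (eq_prim_root_expr gP) mod0n modn_small ?ek; lia.
  have ew : w ^+ 2 + w + 1 = 0.
    apply: (mulfI w1); rewrite mulr0.
    by rewrite cyclotomic3_cube w3 subrr.
  exists (2%:R * w + 1); apply/eqP.
  by rewrite cyclotomic3_sqr ew mulr0 sub0r.
Qed.

(** From 3 = (-1) (-3): the conditions p = 1 modulo 4 and p = 1 modulo 3 hold together for p = 1 and
    fail together for p = 11 modulo 12. *)
Lemma issq_3 : p != 3%N -> issq (3%:R : 'F_p) = ((p %% 12 == 1) || (p %% 12 == 11))%N.
Proof.
move=> p3; have p1 := prime_gt1 pp.
have p4 : (4 < p)%N by move: op p1 pp p3; case: p => [|[|[|[|[|]]]]].
have three0 : (3%:R : 'F_p) != 0 by apply: natF0; lia.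
have n3 : ~~ (3 %| p)%N.
  by apply/negP; rewrite dvdn_prime2 // => /eqP e; rewrite -e in p3.
rewrite -[3%:R]mulr1 -mulrNN issqM ?oppr_eq0 ?oner_eq0 //.
rewrite issq_N1 issq_N3 //.
move: op n3; lia.
Qed.

Lemma issq_square_mul (a c : 'F_p) : c != 0 -> issq (c ^+ 2 * a) = issq a.
Proof.
move=> c0; apply/existsP/existsP => [[x /eqP hx]|[x /eqP hx]].
- exists (x / c); rewrite expr_div_n hx mulrC mulKf ?eqxx ?expf_neq0 //.
- by exists (c * x); rewrite exprMn hx.
Qed.

Lemma Z_of_modn m : Z.of_nat (m %% p)%N = Z.modulo (Z.of_nat m) (Z.of_nat p).
Proof.
have p0 := prime_gt0 pp.
have e := divn_eq m p. have l := ltn_pmod m p0.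
apply: (Z.mod_unique_pos _ _ (Z.of_nat (m %/ p)%N)); lia.
Qed.

(** The search in [legendre] runs over 1, ..., p - 1; omitting 0 is harmless because r is nonzero
    modulo p. *)
Lemma legendre_issq (a : Z) (r : nat) : (0 < r < p)%N ->
  Z.modulo a (Z.of_nat p) = Z.of_nat r ->
  legendre a p = if issq (r%:R : 'F_p) then Zpos 1 else Zneg 1.
Proof.
move=> /andP [r0 rp] er; rewrite /legendre er.
case: (Z.eqb_spec (Z.of_nat r) Z0) => [h|_]; first by lia.
congr (if _ then _ else _).
apply/idP/existsP => [/existsb_exists [x [hx /Z.eqb_spec h]]|[x /eqP hx]].
- exists (x%:R); apply/eqP; rewrite -natrX.
  have e : (x ^ 2 = r %[mod p])%N.
    rewrite -mulnn (modn_small rp). apply: Nat2Z.inj. by rewrite -h Z_of_modn -Nat2Z.inj_mul.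
  by rewrite -[LHS]Fp_nat_mod // e Fp_nat_mod.
- apply/existsb_exists; exists (nat_of_ord x).
  have xp : (x < p)%N by rewrite -[X in (_ < X)%N](Fp_cast pp); exact: ltn_ord.
  have e : (x ^ 2 = r %[mod p])%N.
    have := congr1 (@nat_of_ord _) hx.
    rewrite -[x in (x ^+ 2)]natr_Zp -natrX !val_Fp_nat //.
  have x0 : (0 < x)%N.
    case: (posnP x) => // x0; move: e; rewrite x0 mod0n modn_small //; lia.
  split; first by apply/in_seq; lia.
  apply/Z.eqb_spec. move: e; rewrite (modn_small rp) -mulnn => <-.
  by rewrite Z_of_modn -Nat2Z.inj_mul.
Qed.

End Odd.

Lemma fold_kronecker_prime (a : Z) (chi : nat -> Z) (n : nat) :
  chi 1%N = Zpos 1 ->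
  (forall m k, chi (m * k)%N = Z.mul (chi m) (chi k)) ->
  (forall p, prime p -> kronecker_prime a p = chi p) ->
  (0 < n)%N ->
  List.fold_right (fun pe acc =>
                   Z.mul (Z.pow (kronecker_prime a (fst pe)) (Z.of_nat (snd pe))) acc)
                (Zpos 1) (prime_decomp n) = chi n.
Proof.
move=> h1 hM hp n0.
have chiX p e : chi (p ^ e)%N = Z.pow (chi p) (Z.of_nat e).
  elim: e => [|e IH]; first by rewrite expn0 h1.
  rewrite expnS hM IH Nat2Z.inj_succ Z.pow_succ_r //. lia.
rewrite [in RHS](prod_prime_decomp n0).
have : all (fun f => prime f.1) (prime_decomp n).
  by apply/allP => [[p e]] /mem_prime_decomp [].
elim: (prime_decomp n) => [|[p e] l IH] /=; first by rewrite big_nil h1.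
by move=> /andP [pp hl]; rewrite big_cons hM /= chiX hp // IH.
Qed.

Lemma kronecker_pos (a : Z) (chi : nat -> Z) :
  chi 1%N = Zpos 1 ->
  (forall m k, chi (m * k)%N = Z.mul (chi m) (chi k)) ->
  (forall p, prime p -> kronecker_prime a p = chi p) ->
  forall n : Z, n <> Z0 ->
  kronecker a n = Z.mul (if (Z.ltb n Z0 && Z.ltb a Z0)%bool then Zneg 1 else Zpos 1)
    (chi (Z.abs_nat n)).
Proof.
move=> h1 hM hp n n0; rewrite /kronecker.
case: (Z.eqb_spec n Z0) => // _; congr Z.mul.
apply: fold_kronecker_prime => //. lia.
Qed.

Lemma prime_cases p : prime p -> p = 2%N \/ p = 3%N \/ (odd p /\ p != 3%N /\ (4 < p)%N).
Proof.
move=> pp; case: (even_prime pp) => [->|o]; first by left.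
case: (eqVneq p 3%N) => [->|h]; [by right; left|right; right; split=> //; split=> //].
by move: o h pp; case: p => [|[|[|[|[|]]]]].
Qed.

Definition Zn (n : nat) : Z := Z.of_nat n.

Lemma mod12_cases p : odd p -> ~~ (3 %| p)%N -> exists k,
  p = (1 + 12 * k)%N \/ p = (5 + 12 * k)%N \/ p = (7 + 12 * k)%N \/ p = (11 + 12 * k)%N.
Proof. move=> o h; exists (p %/ 12)%N; lia. Qed.

Lemma chi_per_nat (r k : nat) :
  chi4 (Zn (r + 12 * k)) = chi4 (Zn r) /\ chim4 (Zn (r + 12 * k)) = chim4 (Zn r) /\
  chi3 (Zn (r + 12 * k)) = chi3 (Zn r).
Proof.
have -> : Zn (r + 12 * k) = Z.add (Zn r) (Z.mul (Zpos 12) (Zn k)) by rewrite /Zn; lia.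
by rewrite chi4_per chim4_per chi3_per.
Qed.

Section KroneckerPrime.
Variable p : nat.
Hypotheses (pp : prime p) (op : odd p) (p3 : p != 3%N) (p4 : (4 < p)%N).

Lemma kronecker_prime_odd a : kronecker_prime a p = legendre a p.
Proof. rewrite /kronecker_prime; case: (Nat.eqb_spec p 2) => // h; lia. Qed.

Lemma natr_p_sub r : (r <= p)%N -> ((p - r)%:R : 'F_p) = - r%:R.
Proof. by move=> h; rewrite natrB // pchar_Fp_0 // sub0r. Qed.

Lemma two_neq0 : (2%:R : 'F_p) != 0.
Proof.
by rewrite -(dvdn_pcharf (pchar_Fp pp)); apply/negP => /dvdn_leq /= h; have := h isT; lia.
Qed.

Lemma legendre_pos n : ~~ (p %| n)%N ->
  legendre (Zn n) p = if issq (n%:R : 'F_p) then Zpos 1 else Zneg 1.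
Proof.
move=> h; rewrite -(Fp_nat_mod pp); apply: legendre_issq => //.
- by apply/andP; split; [rewrite lt0n|rewrite ltn_pmod ?prime_gt0].
- by rewrite Z_of_modn.
Qed.

Lemma legendre_neg n : ~~ (p %| n)%N ->
  legendre (Z.opp (Zn n)) p = if issq (- n%:R : 'F_p) then Zpos 1 else Zneg 1.
Proof.
move=> h; have l := ltn_pmod n (prime_gt0 pp).
have r0 : (0 < n %% p)%N by rewrite lt0n.
rewrite -(Fp_nat_mod pp) -natr_p_sub; last by rewrite ltnW.
apply: legendre_issq => //; first by lia.
have e := divn_eq n p.
symmetry; apply: (Z.mod_unique_pos _ _ (Z.opp (Z.of_nat (n %/ p).+1))).
  by lia.
rewrite /Zn; lia.
Qed.

Lemma ndvd12 : ~~ (p %| 12)%N /\ ~~ (p %| 4)%N.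
Proof.
split; apply/negP.
- rewrite (_ : 12%N = (2 * (2 * 3))%N) // !Euclid_dvdM // !dvdn_prime2 //; lia.
- rewrite (_ : 4%N = (2 * 2)%N) // !Euclid_dvdM // !dvdn_prime2 //; lia.
Qed.

Lemma ndvd3 : ~~ (3 %| p)%N.
Proof. by apply/negP; rewrite dvdn_prime2 // => /eqP e; move: p3; rewrite -e. Qed.

Lemma kp4 : kronecker_prime (Zpos 4) p = chi4 (Zn p).
Proof.
rewrite kronecker_prime_odd (legendre_pos (n := 4)); last by case: ndvd12.
have -> : issq (4%:R : 'F_p).
  by apply/existsP; exists 2%:R; rewrite -natrX eqxx.
have [k] := mod12_cases op ndvd3.
by case=> [->|[->|[->| ->]]]; rewrite (proj1 (chi_per_nat _ k)).
Qed.

Lemma kpm4 : kronecker_prime (Zneg 4) p = chim4 (Zn p).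
Proof.
rewrite kronecker_prime_odd (legendre_neg (n := 4)); last by case: ndvd12.
have -> : (- 4%:R : 'F_p) = 2%:R ^+ 2 * -1 by rewrite mulrN1 -natrX.
rewrite issq_square_mul ?two_neq0 // issq_N1 //.
have [k] := mod12_cases op ndvd3.
case=> [h|[h|[h|h]]]; rewrite {2}h (proj1 (proj2 (chi_per_nat _ k)));
  (case: ifP => // hh; exfalso; move: hh; clear -h; lia).
Qed.

Lemma kp12 : kronecker_prime (Zpos 12) p = chi12 (Zn p).
Proof.
rewrite kronecker_prime_odd (legendre_pos (n := 12)); last by case: ndvd12.
have -> : (12%:R : 'F_p) = 2%:R ^+ 2 * 3%:R by rewrite -natrX -natrM.
rewrite issq_square_mul ?two_neq0 // issq_3 // /chi12.
have [k] := mod12_cases op ndvd3.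
case=> [h|[h|[h|h]]]; rewrite {3 4}h (proj1 (proj2 (chi_per_nat _ k))) (proj2 (proj2 (chi_per_nat _ k)));
  (case: ifP => // hh; exfalso; move: hh; clear -h; lia).
Qed.

Lemma kpm12 : kronecker_prime (Zneg 12) p = chim12 (Zn p).
Proof.
rewrite kronecker_prime_odd (legendre_neg (n := 12)); last by case: ndvd12.
have -> : (- 12%:R : 'F_p) = 2%:R ^+ 2 * - 3%:R by rewrite mulrN -natrX -natrM.
rewrite issq_square_mul ?two_neq0 // issq_N3 // /chim12.
have [k] := mod12_cases op ndvd3.
case=> [h|[h|[h|h]]]; rewrite {2 3}h (proj1 (chi_per_nat _ k)) (proj2 (proj2 (chi_per_nat _ k)));
  (case: ifP => // hh; exfalso; move: hh; clear -h; lia).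
Qed.

End KroneckerPrime.

(** A completely multiplicative function is determined by its values at the primes together with the
    sign rule. The primes 2 and 3 are checked directly; all others are governed by their residue
    modulo 12. *)
Lemma kronecker_char (a : Z) (chi : Z -> Z) :
  chi (Zpos 1) = Zpos 1 -> chi Z0 = Z0 -> Z.eqb (Z.abs a) 1 = false ->
  (forall m k, chi (Z.mul m k) = Z.mul (chi m) (chi k)) ->
  kronecker_prime a 2 = chi (Zpos 2) -> kronecker_prime a 3 = chi (Zpos 3) ->
  (forall p, prime p -> odd p -> p != 3%N -> (4 < p)%N ->
     kronecker_prime a p = chi (Zn p)) ->
  (forall n, chi (Z.opp n) = if Z.ltb a Z0 then Z.opp (chi n) else chi n) ->
  forall n, kronecker a n = chi n.
Proof.
move=> h1 h0 ha hM h2 h3 hp hs n.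
case: (Z.eq_dec n Z0) => [->|n0]; first by rewrite /kronecker /= ha h0.
rewrite (@kronecker_pos a (fun n => chi (Zn n))) //; last first.
- by move=> q qp; case: (prime_cases qp) => [->|[->|[? [? ?]]]] //; apply: hp.
- by move=> m k; rewrite /Zn Nat2Z.inj_mul hM.
rewrite /Zn Nat2Z.inj_abs_nat.
case: (Z.ltb_spec n Z0) => hn /=.
- rewrite (Z.abs_neq n); last by lia.
  rewrite hs; case: (Z.ltb a Z0); lia.
- by rewrite (Z.abs_eq n) //; case: (chi n).
Qed.

Lemma kronecker_4 n : kronecker (Zpos 4) n = chi4 n.
Proof.
apply: kronecker_char => //; [exact: chi4_mul|exact: kp4|].
by move=> m; case: (chi_opp m).
Qed.

Lemma kronecker_m4 n : kronecker (Zneg 4) n = chim4 n.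
Proof.
apply: kronecker_char => //; [exact: chim4_mul|exact: kpm4|].
by move=> m; case: (chi_opp m) => [? []].
Qed.

Lemma kronecker_12 n : kronecker (Zpos 12) n = chi12 n.
Proof.
apply: kronecker_char => //; [exact: chi12_mul|exact: kp12|].
by move=> m; case: (chi_opp m) => [? [? []]].
Qed.

Lemma kronecker_m12 n : kronecker (Zneg 12) n = chim12 n.
Proof.
apply: kronecker_char => //; [exact: chim12_mul|exact: kpm12|].
by move=> m; case: (chi_opp m) => [? [? []]].
Qed.

Lemma kronecker_bot3 n : kronecker n (Zpos 3) = chi3 n.
Proof.
rewrite /kronecker /= /prime_decomp /= /kronecker_prime /= Z.mul_1_r.
have -> : Z.pow_pos (legendre n 3) 1 = legendre n 3 by rewrite /Z.pow_pos /= Z.mul_1_r.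
rewrite /legendre /chi3.
have := Z.mod_pos_bound n (Zpos 3) (erefl _).
change (Z.of_nat 3) with (Zpos 3).
case: (Z.modulo n (Zpos 3)) => [|q|q] //; last by move=> [? ?]; exfalso; lia.
case: q => [[q|q|]|[q|q|]|] // [? ?]; exfalso; lia.
Qed.

End QuadraticResidues.

(** * The lattice sums in phi26 *)

Definition zC (n : Z) : C := RtoC (IZR n).

Lemma zC_mult m n : zC (m * n) = (zC m * zC n)%C.
Proof. unfold zC. rewrite mult_IZR, RtoC_mult; easy. Qed.

Lemma zC_plus m n : zC (m + n) = (zC m + zC n)%C.
Proof. unfold zC. rewrite plus_IZR, RtoC_plus; easy. Qed.

Lemma zC_opp m : zC (- m) = (- zC m)%C.
Proof. unfold zC. rewrite opp_IZR, RtoC_opp; easy. Qed.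

Lemma Cmod_zC n : Cmod (zC n) = IZR (Z.abs n).
Proof. unfold zC. rewrite Cmod_R, abs_IZR; easy. Qed.

(* [chie n] is (-1)^(n/2) for even n and 0 for odd n. *)
Definition chie (n : Z) : Z := (- chim4 (n - 1))%Z.
Definition pm (n : Z) : Z := if Z.even n then 1%Z else (-1)%Z.

Definition bounded1 (c : Z -> Z) : Prop := forall n, (Z.abs (c n) <= 1)%Z.

Lemma chi4_b : bounded1 chi4.
Proof. intros n; unfold chi4; destruct (Z.even n); lia. Qed.
Lemma chim4_b : bounded1 chim4.
Proof. intros n; unfold chim4; repeat destruct (Z.eqb _ _); lia. Qed.
Lemma chi3_b : bounded1 chi3.
Proof. intros n; unfold chi3; repeat destruct (Z.eqb _ _); lia. Qed.
Lemma chie_b : bounded1 chie.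
Proof. intros n; unfold chie; assert (X := chim4_b (n - 1)%Z); lia. Qed.
Lemma abs_mult_le1 a b : (Z.abs a <= 1 -> Z.abs b <= 1 -> Z.abs (a * b) <= 1)%Z.
Proof. rewrite Z.abs_mul. nia. Qed.
Lemma bounded1_mult c d : bounded1 c -> bounded1 d -> bounded1 (fun n => c n * d n)%Z.
Proof. intros H1 H2 n; specialize (H1 n); specialize (H2 n); simpl. rewrite Z.abs_mul. nia. Qed.
Lemma chi12_b : bounded1 chi12.
Proof. apply (bounded1_mult chim4 chi3 chim4_b chi3_b). Qed.
Lemma chim12_b : bounded1 chim12.
Proof. apply (bounded1_mult chi4 chi3 chi4_b chi3_b). Qed.
#[local] Hint Resolve chi4_b chim4_b chie_b chi12_b chim12_b : chars.

Lemma pgrow_bounded1 {T} (s : T -> R) (c : T -> Z) :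
  (forall t, (Z.abs (c t) <= 1)%Z) -> pgrow s (fun t => zC (c t)).
Proof.
  intros H. apply (pgrow_bound _ _ 1). intros t. rewrite Cmod_zC. apply IZR_le, H.
Qed.

Lemma KS_4 n : KS 4 n = zC (chi4 n).
Proof. unfold KS. rewrite QuadraticResidues.kronecker_4; easy. Qed.
Lemma KS_m4 n : KS (-4) n = zC (chim4 n).
Proof. unfold KS. rewrite QuadraticResidues.kronecker_m4; easy. Qed.
Lemma KS_12 n : KS 12 n = zC (chi12 n).
Proof. unfold KS. rewrite QuadraticResidues.kronecker_12; easy. Qed.
Lemma KS_m12 n : KS (-12) n = zC (chim12 n).
Proof. unfold KS. rewrite QuadraticResidues.kronecker_m12; easy. Qed.
Lemma KS_bot3 n : KS n 3 = zC (chi3 n).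
Proof. unfold KS. rewrite QuadraticResidues.kronecker_bot3; easy. Qed.

(** Common form of the four theta functions; the passages to 2 tau and tau / 2 are absorbed into
    [l], so that all products below live at the same tau. *)
Definition th (c : Z -> Z) (l : R) (w : R) (tau : C) : C :=
  tsum (fun n => zC (c n) * epow (IZR n / 2) (RtoC w) * epow (l * IZR n ^ 2) tau)%C.

Lemma asum_th c l w tau : bounded1 c -> 0 < l -> 0 < Im tau ->
  asum (fun n => zC (c n) * epow (IZR n / 2) (RtoC w) * epow (l * IZR n ^ 2) tau)%C.
Proof.
  intros Hc Hl Ht. apply (asum_gauss _ _ l); auto.
  apply pgrow_mult; [apply zsize_ge0|apply pgrow_bounded1, Hc|].
  apply (pgrow_bound _ _ 1); intros n. rewrite Cmod_epow_R; lra.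
Qed.

Lemma th_sumZ (a : Z) c (f : Z -> R) l w tau : (forall n, KS a n = zC (c n)) ->
  (forall n, f n = l * IZR n ^ 2) -> bounded1 c -> 0 < l -> 0 < Im tau ->
  sumZ (fun n => KS a n * epow (IZR n / 2) (RtoC w) * epow (f n) tau)%C = th c l w tau.
Proof.
  intros HK Hf Hc Hl Ht.
  assert (E : forall n, (KS a n * epow (IZR n / 2) (RtoC w) * epow (f n) tau)%C =
    (zC (c n) * epow (IZR n / 2) (RtoC w) * epow (l * IZR n ^ 2) tau)%C).
  { intros n. rewrite HK, Hf; easy. }
  rewrite sumZ_tsum; [apply tsum_ext, E|].
  eapply asum_ext; [intros n; symmetry; apply E|]. apply asum_th; auto.
Qed.

Lemma theta_th w tau : 0 < Im tau -> theta (RtoC w) tau = th chim4 (/ 8) w tau.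
Proof. intros H. apply th_sumZ; auto using KS_m4 with chars; [intros; field|lra]. Qed.
Lemma theta2_th w tau : 0 < Im tau -> theta2 (RtoC w) tau = th chi4 (/ 8) w tau.
Proof. intros H. apply th_sumZ; auto using KS_4 with chars; [intros; field|lra]. Qed.
Lemma theta_star_th w tau : 0 < Im tau -> theta_star (RtoC w) tau = th chi12 (/ 24) w tau.
Proof. intros H. apply th_sumZ; auto using KS_12 with chars; [intros; field|lra]. Qed.
Lemma theta2_star_th w tau : 0 < Im tau -> theta2_star (RtoC w) tau = th chim12 (/ 24) w tau.
Proof. intros H. apply th_sumZ; auto using KS_m12 with chars; [intros; field|lra]. Qed.

Lemma theta4_th w tau : 0 < Im tau -> theta4 (RtoC w) tau = th chie (/ 8) w tau.
Proof.
  intros H. unfold theta4.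
  set (G := fun n => (zC (chie n) * epow (IZR n / 2) (RtoC w) * epow (/ 8 * IZR n ^ 2) tau)%C).
  assert (AG : asum G) by (apply asum_th; auto with chars; lra).
  assert (AS : asum (fun n => G (n + 1)%Z)) by (apply (asum_inj (fun n => (n + 1)%Z)); auto; lia).
  assert (E : forall n, (KS (-4) n * epow (IZR (n + 1) / 2) (RtoC w)
     * epow (IZR (n + 1) ^ 2 / 8) tau)%C = (RtoC (-1) * G (n + 1)%Z)%C).
  { intros n. unfold G, chie. rewrite KS_m4, zC_opp.
    replace (n + 1 - 1)%Z with n by ring.
    replace (IZR (n + 1) ^ 2 / 8) with (/ 8 * IZR (n + 1) ^ 2) by field. ring. }
  rewrite sumZ_tsum.
  2: { eapply asum_ext; [intros n; symmetry; apply E|]. apply asum_scal, AS. }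
  rewrite (tsum_ext _ _ E), tsum_scal by auto.
  rewrite (tsum_bij (fun n => (n + 1)%Z) (fun n => (n - 1)%Z) G); auto; try (intros; lia).
  unfold th; fold G. ring.
Qed.

(** Common form of the sums in [phi26] and of all their derivatives under D_z, which change only the
    coefficient [c]. *)
Definition lat (c : Z * Z -> C) (a b l1 l2 : R) (tau z : C) : C :=
  tsum (fun p => c p * (epow (a * IZR (fst p)) (RtoC (Re z)) * epow (b * IZR (snd p)) (RtoC (Im z)))
          * epow (l1 * IZR (fst p) ^ 2 + l2 * IZR (snd p) ^ 2) tau)%C.

Lemma asum_lat c a b l1 l2 tau z : pgrow zsize2 c -> 0 < l1 -> 0 < l2 -> 0 < Im tau ->
  asum (fun p => c p * (epow (a * IZR (fst p)) (RtoC (Re z)) * epow (b * IZR (snd p)) (RtoC (Im z)))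
          * epow (l1 * IZR (fst p) ^ 2 + l2 * IZR (snd p) ^ 2) tau)%C.
Proof.
  intros Hc H1 H2 Ht. apply (asum_gauss2 _ _ (Rmin l1 l2)); auto.
  - apply (pgrow_mult zsize2 c); [apply zsize2_ge0|auto|].
    apply (pgrow_bound _ _ 1); intros n. rewrite Cmod_mult, !Cmod_epow_R; lra.
  - apply Rmin_glb_lt; auto.
  - intros p. assert (X := pow2_ge_0 (IZR (fst p))). assert (Y := pow2_ge_0 (IZR (snd p))).
    assert (X1 := Rmin_l l1 l2). assert (X2 := Rmin_r l1 l2). nra.
Qed.

Lemma sumZ2_lat (f : Z -> Z -> C) c a b l1 l2 tau z :
  pgrow zsize2 c -> 0 < l1 -> 0 < l2 -> 0 < Im tau ->
  (forall m n, f m n = c (m, n) * (epow (a * IZR m) (RtoC (Re z)) * epow (b * IZR n) (RtoC (Im z)))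
          * epow (l1 * IZR m ^ 2 + l2 * IZR n ^ 2) tau)%C ->
  sumZ2 f = lat c a b l1 l2 tau z.
Proof.
  intros Hc H1 H2 Ht E.
  rewrite sumZ2_tsum.
  - apply tsum_ext; intros (m, n); apply E.
  - eapply asum_ext; [|apply (asum_lat c a b l1 l2 tau z); auto].
    intros (m, n); symmetry; apply E.
Qed.

Lemma powerRZ_pm k : RtoC (powerRZ (-1) k) = zC (pm k).
Proof.
  unfold zC, pm. f_equal.
  assert (E : forall n, powerRZ (-1) (2 * n) = 1).
  { intros n. replace (2 * n)%Z with (n + n)%Z by ring.
    rewrite powerRZ_add, <- powerRZ_mult by lra.
    replace (-1 * -1) with 1 by ring.
    destruct n as [|p|p]; simpl; rewrite ?pow1; try rewrite Rinv_1; easy. }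
  destruct (Z.even k) eqn:H.
  - apply Z.even_spec in H; destruct H as (j & ->). apply E.
  - assert (O : Z.odd k = true) by (rewrite <- Z.negb_even, H; easy).
    apply Z.odd_spec in O; destruct O as (j & ->).
    rewrite powerRZ_add by lra. rewrite E. simpl; lra.
Qed.

(** * Identities between periodic functions *)

(** 48 is a common period of all characters and congruence conditions in use, including signs such
    as (-1)^((n^2 - 1) / 24) on the support of [chi12]. Identities between them thereby become
    finite checks. *)
Definition res48 : list Z := map Z.of_nat (seq 0 48).

Lemma res48_mod m : In (m mod 48)%Z res48.
Proof.
  assert (X := Z.mod_pos_bound m 48 ltac:(lia)).
  apply in_map_iff. exists (Z.to_nat (m mod 48)); split; [lia|]. apply in_seq; lia.
Qed.

Lemma periodic_mod {T} (f : Z -> T) : (forall n k, f (n + 48 * k)%Z = f n) ->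
  forall n, f n = f (n mod 48)%Z.
Proof.
  intros H n. rewrite (Z.div_mod n 48) at 1 by lia. rewrite (Z.add_comm _ (n mod 48)). apply H.
Qed.

Lemma periodic_check (F : Z -> Z -> Z) :
  (forall m n a b, F (m + 48 * a) (n + 48 * b) = F m n)%Z ->
  forallb (fun m => forallb (fun n => (F m n =? 0)%Z) res48) res48 = true ->
  forall m n, F m n = 0%Z.
Proof.
  intros HP HF m n.
  rewrite (periodic_mod (F m)), (periodic_mod (fun m => F m (n mod 48)%Z)).
  - rewrite forallb_forall in HF. specialize (HF _ (res48_mod m)).
    rewrite forallb_forall in HF. specialize (HF _ (res48_mod n)). lia.
  - intros k a. rewrite <- (HP k (n mod 48)%Z a 0%Z). f_equal; ring.
  - intros k b. rewrite <- (HP m k 0%Z b). f_equal; ring.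
Qed.

Lemma chi4_48 n k : chi4 (n + 48 * k) = chi4 n.
Proof. replace (n + 48 * k)%Z with (n + 12 * (4 * k))%Z by ring. apply chi4_per. Qed.
Lemma chim4_48 n k : chim4 (n + 48 * k) = chim4 n.
Proof. replace (n + 48 * k)%Z with (n + 12 * (4 * k))%Z by ring. apply chim4_per. Qed.
Lemma chi3_48 n k : chi3 (n + 48 * k) = chi3 n.
Proof. replace (n + 48 * k)%Z with (n + 12 * (4 * k))%Z by ring. apply chi3_per. Qed.
Lemma chi12_48 n k : chi12 (n + 48 * k) = chi12 n.
Proof. unfold chi12; rewrite chim4_48, chi3_48; easy. Qed.
Lemma chie_48 n k : chie (n + 48 * k) = chie n.
Proof. unfold chie. replace (n + 48 * k - 1)%Z with (n - 1 + 48 * k)%Z by ring.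
  rewrite chim4_48; easy. Qed.
Lemma pm_48 n k : pm (n + 48 * k) = pm n.
Proof. unfold pm. rewrite Z.even_add, Z.even_mul. destruct (Z.even n); easy. Qed.
Lemma pm_half m n a b :
  pm ((m + 48 * a + (n + 48 * b) - 1) / 2) = pm ((m + n - 1) / 2).
Proof.
  replace (m + 48 * a + (n + 48 * b) - 1)%Z with (m + n - 1 + (24 * (a + b)) * 2)%Z by ring.
  rewrite Z.div_add by lia. unfold pm. rewrite Z.even_add, Z.even_mul.
  destruct (Z.even _); easy.
Qed.
Lemma congZ_48 d e m n a b : (d * e = 48)%Z -> congZ d (m + 48 * a) (n + 48 * b) = congZ d m n.
Proof.
  intros H. unfold congZ.
  replace (m + 48 * a - (n + 48 * b))%Z with (m - n + (e * (a - b)) * d)%Z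
    by (rewrite <- H; ring).
  rewrite Z_mod_plus_full; easy.
Qed.
Lemma congZ_48l d e m n a : (d * e = 48)%Z -> congZ d (m + 48 * a) n = congZ d m n.
Proof.
  intros H. rewrite <- (congZ_48 d e m n a 0 H). f_equal; lia.
Qed.

Definition b2Z (b : bool) : Z := if b then 1%Z else 0%Z.

Lemma phi26_coef1 m n :
  (pm ((m + n - 1) / 2) * chi4 (m * (n + 1)) * chi3 m = chi12 m * chie n)%Z.
Proof.
  rewrite chi4_mul. apply Zminus_eq. revert m n. apply periodic_check.
  - intros m n a b. rewrite pm_half, chi4_48, chi3_48, chi12_48, chie_48.
    replace (n + 48 * b + 1)%Z with (n + 1 + 48 * b)%Z by ring. rewrite chi4_48; easy.
  - vm_compute; easy.
Qed.

Definition cong8 (m n : Z) : Z := b2Z (congZ 8 m n || congZ 8 m (- n)).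

Lemma cong8_48 m n a b : cong8 (m + 48 * a) (n + 48 * b) = cong8 m n.
Proof.
  unfold cong8. replace (- (n + 48 * b))%Z with (- n + 48 * (- b))%Z by ring.
  rewrite !(congZ_48 8 6); easy.
Qed.

Definition chir (m n : Z) : Z := (chi12 (m + n) * chi12 (m - n))%Z.

Lemma phi26_coef3 n1 n2 :
  (pm n2 * chi4 (n1 + n2) *
    (b2Z ((congZ 3 n1 1 || congZ 3 n1 (-1)) && congZ 3 n2 0)
     - b2Z (congZ 3 n1 0 && (congZ 3 n2 1 || congZ 3 n2 (-1)))) = chir n1 n2)%Z.
Proof.
  unfold chir. apply Zminus_eq. revert n1 n2. apply periodic_check.
  - intros m n a b. rewrite pm_48, !(congZ_48l 3 16) by easy.
    replace (m + 48 * a + (n + 48 * b))%Z with (m + n + 48 * (a + b))%Z by ring.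
    replace (m + 48 * a - (n + 48 * b))%Z with (m - n + 48 * (a - b))%Z by ring.
    rewrite chi4_48, !chi12_48; easy.
  - vm_compute; easy.
Qed.

Definition c1 (p : Z * Z) : Z := (chi12 (fst p) * chie (snd p))%Z.
Definition c2 (p : Z * Z) : Z := (cong8 (fst p) (snd p) * chi12 (fst p))%Z.
Definition c3 (p : Z * Z) : Z := chir (fst p) (snd p).

Lemma b2Z_b b : (Z.abs (b2Z b) <= 1)%Z.
Proof. destruct b; simpl; lia. Qed.

Lemma c1_b p : (Z.abs (c1 p) <= 1)%Z.
Proof. unfold c1. rewrite Z.abs_mul. assert (X := chi12_b (fst p)). assert (Y := chie_b (snd p)). nia. Qed.
Lemma c2_b p : (Z.abs (c2 p) <= 1)%Z.
Proof. unfold c2, cong8. rewrite Z.abs_mul. assert (X := chi12_b (fst p)).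
  assert (Y := b2Z_b (congZ 8 (fst p) (snd p) || congZ 8 (fst p) (- snd p))). nia. Qed.
Lemma c3_b p : (Z.abs (c3 p) <= 1)%Z.
Proof. unfold c3, chir. rewrite Z.abs_mul. assert (X := chi12_b (fst p + snd p)%Z).
  assert (Y := chi12_b (fst p - snd p)%Z). nia. Qed.

Lemma sqrt3_nz : sqrt 3 <> 0.
Proof. assert (X := sqrt_lt_R0 3 ltac:(lra)); lra. Qed.

Lemma phi26_lat z tau : 0 < Im tau ->
  phi26 z tau =
   (RtoC (1 / 2) * lat (fun p => zC (c1 p)) (1 / 6) (1 / (2 * sqrt 3)) (1 / 12) (3 / 12) tau z
    + RtoC (1 / 4) * lat (fun p => zC (c2 p)) (1 / 12) (1 / (4 * sqrt 3)) (1 / 48) (3 / 48) tau z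
    - RtoC (1 / 2) * lat (fun p => zC (c3 p)) (1 / 6) (1 / 6) (1 / 12) (1 / 12) tau z)%C.
Proof.
  intros Ht. unfold phi26. assert (S3 := sqrt3_nz).
  assert (Q : forall x y x' y' : R, x * y = x' * y' -> epow x (RtoC y) = epow x' (RtoC y')).
  { intros x y x' y' H. rewrite (epow_scal1 x), (epow_scal1 x'), H; easy. }
  rewrite (sumZ2_lat _ (fun p => zC (c1 p)) (1 / 6) (1 / (2 * sqrt 3)) (1 / 12) (3 / 12) tau z);
    auto; try lra; try (apply pgrow_bounded1, c1_b).
  2: { intros m n. rewrite powerRZ_pm, KS_4, KS_bot3, <- !zC_mult, phi26_coef1. unfold c1; cbn [fst snd].
       rewrite (Q (IZR m / 12) (2 * Re z) (1 / 6 * IZR m) (Re z)) by field.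
       rewrite (Q (IZR n / 4) (2 / sqrt 3 * Im z) (1 / (2 * sqrt 3) * IZR n) (Im z)) by (field; auto).
       replace ((IZR m ^ 2 + 3 * IZR n ^ 2) / 12) with (1 / 12 * IZR m ^ 2 + 3 / 12 * IZR n ^ 2) by field.
       ring. }
  unfold sumZ2_in at 1.
  rewrite (sumZ2_lat _ (fun p => zC (c2 p)) (1 / 12) (1 / (4 * sqrt 3)) (1 / 48) (3 / 48) tau z);
    auto; try lra; try (apply pgrow_bounded1, c2_b).
  2: { intros m n. rewrite KS_12. unfold c2, cong8, b2Z; cbn [fst snd].
       rewrite (Q (IZR m / 24) (2 * Re z) (1 / 12 * IZR m) (Re z)) by field.
       rewrite (Q (IZR n / 8) (2 / sqrt 3 * Im z) (1 / (4 * sqrt 3) * IZR n) (Im z)) by (field; auto).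
       replace ((IZR m ^ 2 + 3 * IZR n ^ 2) / 48) with (1 / 48 * IZR m ^ 2 + 3 / 48 * IZR n ^ 2) by field.
       rewrite zC_mult. destruct (_ || _)%bool; unfold zC; ring. }
  set (c31 := fun p : Z * Z => (pm (snd p) * chi4 (fst p + snd p) *
    b2Z ((congZ 3 (fst p) 1 || congZ 3 (fst p) (-1)) && congZ 3 (snd p) 0))%Z).
  set (c32 := fun p : Z * Z => (pm (snd p) * chi4 (fst p + snd p) *
    b2Z (congZ 3 (fst p) 0 && (congZ 3 (snd p) 1 || congZ 3 (snd p) (-1))))%Z).
  assert (B1 : forall p, (Z.abs (c31 p) <= 1)%Z).
  { intros p; unfold c31. apply abs_mult_le1; [apply abs_mult_le1|apply b2Z_b].
    - unfold pm; destruct (Z.even _); simpl; lia.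
    - apply chi4_b. }
  assert (B2 : forall p, (Z.abs (c32 p) <= 1)%Z).
  { intros p; unfold c32. apply abs_mult_le1; [apply abs_mult_le1|apply b2Z_b].
    - unfold pm; destruct (Z.even _); simpl; lia.
    - apply chi4_b. }
  unfold sumZ2_in.
  rewrite (sumZ2_lat _ (fun p => zC (c31 p)) (1 / 6) (1 / 6) (1 / 12) (1 / 12) tau z);
    auto; try lra; try (apply pgrow_bounded1, B1).
  2: { intros m n. rewrite powerRZ_pm, KS_4. unfold c31, b2Z; cbn [fst snd].
       replace (IZR m / 6) with (1 / 6 * IZR m) by field.
       replace (IZR n / 6) with (1 / 6 * IZR n) by field.
       replace ((IZR m ^ 2 + IZR n ^ 2) / 12) with (1 / 12 * IZR m ^ 2 + 1 / 12 * IZR n ^ 2) by field.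
       rewrite !zC_mult. destruct (_ && _)%bool; unfold zC; ring. }
  rewrite (sumZ2_lat _ (fun p => zC (c32 p)) (1 / 6) (1 / 6) (1 / 12) (1 / 12) tau z);
    auto; try lra; try (apply pgrow_bounded1, B2).
  2: { intros m n. rewrite powerRZ_pm, KS_4. unfold c32, b2Z; cbn [fst snd].
       replace (IZR m / 6) with (1 / 6 * IZR m) by field.
       replace (IZR n / 6) with (1 / 6 * IZR n) by field.
       replace ((IZR m ^ 2 + IZR n ^ 2) / 12) with (1 / 12 * IZR m ^ 2 + 1 / 12 * IZR n ^ 2) by field.
       rewrite !zC_mult. destruct (_ && _)%bool; unfold zC; ring. }
  replace (lat (fun p => zC (c3 p)) (1 / 6) (1 / 6) (1 / 12) (1 / 12) tau z) with
    (lat (fun p => zC (c31 p)) (1 / 6) (1 / 6) (1 / 12) (1 / 12) tau z +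
      RtoC (-1) * lat (fun p => zC (c32 p)) (1 / 6) (1 / 6) (1 / 12) (1 / 12) tau z)%C.
  - ring.
  - unfold lat. rewrite <- tsum_scal, <- tsum_plus;
      try (repeat apply asum_scal; apply asum_lat; auto; try lra; apply pgrow_bounded1; auto).
    apply tsum_ext; intros (n1, n2). unfold c3, c31, c32; cbn [fst snd].
    rewrite <- phi26_coef3, Z.mul_sub_distr_l. unfold Z.sub. rewrite zC_plus, zC_opp. ring.
Qed.

Lemma epow_R x y : epow x (RtoC y) = (cos (2 * PI * x * y), sin (2 * PI * x * y)).
Proof.
  unfold epow, Cexp.
  replace (RtoC (2 * PI) * Ci * RtoC x * RtoC y)%C with (0, 2 * PI * x * y)
    by (apply C_eq; unfold Re, Im; simpl; ring).
  cbn [Re Im fst snd]. rewrite exp_0, !Rmult_1_l; easy.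
Qed.

Lemma epow_Z k : epow (IZR k) (RtoC 1) = RtoC 1.
Proof.
  assert (EN : forall n, epow (INR n) (RtoC 1) = RtoC 1).
  { intros n. rewrite <- (Rmult_1_r (INR n)), epow_nat, epow_R, !Rmult_1_r, cos_2PI, sin_2PI.
    apply Cpow_1_l. }
  destruct (Z_le_gt_dec 0 k) as [H|H].
  - rewrite <- (Z2Nat.id k) by lia. rewrite <- INR_IZR_INZ; apply EN.
  - replace k with (- Z.of_nat (Z.to_nat (- k)))%Z by lia.
    set (n := Z.to_nat (- k)). rewrite opp_IZR, <- INR_IZR_INZ.
    assert (X := epow_add (INR n) (- INR n) (RtoC 1)).
    rewrite Rplus_opp_r, epow_0, EN, Cmult_1_l in X. auto.
Qed.

Lemma epow_half_Z k : epow (IZR k / 2) (RtoC 1) = zC (pm k).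
Proof.
  unfold pm, zC. destruct (Z.even k) eqn:H.
  - apply Z.even_spec in H; destruct H as (j & ->).
    rewrite mult_IZR. replace (2 * IZR j / 2) with (IZR j) by field. apply epow_Z.
  - assert (O : Z.odd k = true) by (rewrite <- Z.negb_even, H; easy).
    apply Z.odd_spec in O; destruct O as (j & ->).
    rewrite plus_IZR, mult_IZR.
    replace ((2 * IZR j + 1) / 2) with (IZR j + / 2) by field.
    rewrite epow_add, epow_Z, epow_R.
    replace (2 * PI * / 2 * 1) with PI by field. rewrite cos_PI, sin_PI.
    apply C_eq; simpl; ring.
Qed.

Lemma tau_half_im tau : Im (tau / RtoC 2)%C = Im tau / 2.
Proof.
  replace (tau / RtoC 2)%C with (RtoC (/ 2) * tau)%C.
  - unfold Im; simpl; field.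
  - rewrite RtoC_inv. field. lra.
Qed.

Lemma th_half c l w tau : th c l w (tau / RtoC 2) = th c (l / 2) w tau.
Proof.
  unfold th. apply tsum_ext; intros n. rewrite epow_half.
  replace (l * IZR n ^ 2 / 2) with (l / 2 * IZR n ^ 2) by field; easy.
Qed.

Lemma th_double c l w tau : th c l w (RtoC 2 * tau) = th c (2 * l) w tau.
Proof.
  unfold th. apply tsum_ext; intros n. rewrite epow_scal.
  replace (l * IZR n ^ 2 * 2) with (2 * l * IZR n ^ 2) by ring; easy.
Qed.

Lemma th_mult c d l1 l2 w1 w2 tau : bounded1 c -> bounded1 d -> 0 < l1 -> 0 < l2 -> 0 < Im tau ->
  (th c l1 w1 tau * th d l2 w2 tau)%C =
  tsum (fun p => zC (c (fst p) * d (snd p)) *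
     (epow (IZR (fst p) / 2) (RtoC w1) * epow (IZR (snd p) / 2) (RtoC w2)) *
     epow (l1 * IZR (fst p) ^ 2 + l2 * IZR (snd p) ^ 2) tau)%C.
Proof.
  intros. unfold th. rewrite <- tsum_prod by (apply asum_th; auto).
  apply tsum_ext; intros p. rewrite zC_mult, epow_add. ring.
Qed.

Lemma epow_RR x y x' y' : x * y = x' * y' -> epow x (RtoC y) = epow x' (RtoC y').
Proof. intros H. rewrite (epow_scal1 x), (epow_scal1 x'), H; easy. Qed.

Lemma th_mult_lat c d l1 l2 w1 w2 a b tau z :
  bounded1 c -> bounded1 d -> 0 < l1 -> 0 < l2 -> 0 < Im tau ->
  w1 = 2 * a * Re z -> w2 = 2 * b * Im z ->
  (th c l1 w1 tau * th d l2 w2 tau)%C =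
  lat (fun p => zC (c (fst p) * d (snd p))) a b l1 l2 tau z.
Proof.
  intros Hc Hd H1 H2 Ht -> ->. rewrite th_mult by auto.
  apply tsum_ext; intros p. f_equal. f_equal. f_equal; apply epow_RR; field.
Qed.

(** For odd m and n exactly one of m = n and m = -n holds modulo 4. The two halved combinations are
    [chi12 m] times the indicators of these cases, and the sign [pm] then decides the congruence
    modulo 8. *)
Lemma chi12_pm m n :
  (2 * cong8 m n * chi12 m = chi12 m * chi4 n +
     pm ((m - n) / 4) * ((chi12 m * chi4 n + chim12 m * chim4 n) / 2) +
     pm ((m + n) / 4) * ((chi12 m * chi4 n - chim12 m * chim4 n) / 2))%Z.
Proof.
  apply Zminus_eq. revert m n. apply periodic_check.
  - intros m n a b. rewrite cong8_48, chi12_48, !chi4_48, !chim4_48.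
    unfold chim12; rewrite chi4_48, chi3_48.
    replace (m + 48 * a - (n + 48 * b))%Z with (m - n + (12 * (a - b)) * 4)%Z by ring.
    replace (m + 48 * a + (n + 48 * b))%Z with (m + n + (12 * (a + b)) * 4)%Z by ring.
    rewrite !Z.div_add by lia. unfold pm. rewrite !Z.even_add, !Z.even_mul.
    change (Z.even 12) with true. cbn [orb].
    destruct (Z.even ((m - n) / 4)), (Z.even ((m + n) / 4)); easy.
  - vm_compute; easy.
Qed.

(* If the coefficient does not vanish, k is divisible by 4. *)
Lemma quarter_shift (x k : Z) : (x mod 2 = 0)%Z -> (x <> 0 -> k mod 4 = 0)%Z ->
  (zC x * epow (IZR k / 8) (RtoC 1))%C = (RtoC 2 * zC (pm (k / 4) * (x / 2)))%C.
Proof.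
  intros H2 H4. destruct (Z.eq_dec x 0) as [->|H].
  - unfold Z.div; simpl. rewrite Z.mul_0_r. unfold zC; ring.
  - specialize (H4 H).
    assert (E : (k = 4 * (k / 4))%Z) by (assert (X := Z.div_mod k 4); lia).
    assert (E2 : (x = 2 * (x / 2))%Z) by (assert (X := Z.div_mod x 2); lia).
    rewrite E at 1. rewrite mult_IZR.
    replace (4 * IZR (k / 4) / 8) with (IZR (k / 4) / 2) by field.
    rewrite epow_half_Z, E2 at 1. rewrite !zC_mult. unfold zC at 1. ring.
Qed.

(** For odd m and n the number x equals [chi3 m] times the sum of [chim4 m] and [chim4 (s * n)]: it
    is even, and it vanishes unless m = s n modulo 4. *)
Lemma quarter_cond m n s : s = 1%Z \/ s = (-1)%Z ->
  let x := (chi12 m * chi4 n + s * (chim12 m * chim4 n))%Z in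
  (x mod 2 = 0)%Z /\ (x <> 0 -> (m - s * n) mod 4 = 0)%Z.
Proof.
  intros Hs x.
  assert (K : (b2Z (negb (x mod 2 =? 0)) + b2Z (negb (x =? 0)) * b2Z (negb ((m - s * n) mod 4 =? 0)) = 0)%Z).
  { unfold x. clear x. revert m n. apply periodic_check.
    - intros m n a b. rewrite chi12_48, !chi4_48, !chim4_48.
      unfold chim12; rewrite chi4_48, chi3_48.
      replace (m + 48 * a - s * (n + 48 * b))%Z with (m - s * n + (12 * (a - s * b)) * 4)%Z by ring.
      rewrite Z_mod_plus_full; easy.
    - destruct Hs as [-> | ->]; vm_compute; easy. }
  destruct (Z.eqb_spec (x mod 2) 0), (Z.eqb_spec x 0), (Z.eqb_spec ((m - s * n) mod 4) 0);
    simpl in K; try lia; split; auto; lia.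
Qed.

(** The rotation is injective with image the pairs of equal parity, and F vanishes off that
    image. *)
Lemma tsum_rotate (F : Z * Z -> C) : asum F ->
  (forall m n, ((m - n) mod 2 <> 0)%Z -> F (m, n) = RtoC 0) ->
  tsum F = tsum (fun p => F (fst p + snd p, fst p - snd p)%Z).
Proof.
  intros A H0. symmetry. apply (tsum_inj (fun p => (fst p + snd p, fst p - snd p)%Z) F); auto.
  - intros (a, b) (c, d) H; injection H as H1 H2; f_equal; lia.
  - intros (m, n) H. apply H0. intros Q.
    apply (H ((m - (m - n) / 2), (m - n) / 2)%Z). cbn [fst snd].
    assert (X := Z.div_mod (m - n) 2). f_equal; lia.
Qed.

Lemma chi12_parity m n : ((m - n) mod 2 <> 0)%Z -> (chi12 m * chi12 n = 0)%Z.
Proof.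
  assert (K : (chi12 m * chi12 n * ((m - n) mod 2) = 0)%Z); [|nia].
  revert m n. apply periodic_check; [|vm_compute; easy].
  intros. rewrite !chi12_48.
  replace (m + 48 * a - (n + 48 * b))%Z with (m - n + (24 * (a - b)) * 2)%Z by ring.
  rewrite Z_mod_plus_full; easy.
Qed.

Theorem phi26_theta (tau z : C) (z1 z2 z3 z4 : R) : 0 < Im tau ->
     z = (RtoC z1 + Ci * RtoC z2)%C ->
     z = ((RtoC z3 + Ci * RtoC (sqrt 3) * RtoC z4) / RtoC 2)%C ->
     phi26 z tau =
       (RtoC (1 / 2) * (theta_star (RtoC (z3 / 6)) (RtoC 2 * tau)
                        * theta4 (RtoC (z4 / 2)) (RtoC 2 * tau))
        + RtoC (1 / 8) * (theta_star (RtoC (z3 / 12)) (tau / RtoC 2)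
                          * theta2 (RtoC (z4 / 4)) (tau / RtoC 2))
        + RtoC (1 / 16) *
            (theta_star (RtoC (z3 / 12 + 1 / 4)) (tau / RtoC 2)
             * theta2 (RtoC (z4 / 4 - 1 / 4)) (tau / RtoC 2)
             + theta2_star (RtoC (z3 / 12 + 1 / 4)) (tau / RtoC 2)
               * theta (RtoC (z4 / 4 - 1 / 4)) (tau / RtoC 2))
        + RtoC (1 / 16) *
            (theta_star (RtoC (z3 / 12 + 1 / 4)) (tau / RtoC 2)
             * theta2 (RtoC (z4 / 4 + 1 / 4)) (tau / RtoC 2)
             - theta2_star (RtoC (z3 / 12 + 1 / 4)) (tau / RtoC 2)
               * theta (RtoC (z4 / 4 + 1 / 4)) (tau / RtoC 2))
        - RtoC (1 / 2) * (theta_star (RtoC ((z1 + z2) / 6)) tau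
                          * theta_star (RtoC ((z1 - z2) / 6)) tau))%C.
Proof.
  intros Ht Hz Hz'.
  assert (S3 := sqrt3_nz).
  assert (Z1 : Re z = z1) by (rewrite Hz; unfold Re; simpl; ring).
  assert (Z2 : Im z = z2) by (rewrite Hz; unfold Im; simpl; ring).
  assert (Z34 : z = (z3 / 2, sqrt 3 * z4 / 2)).
  { rewrite Hz'. apply C_eq; unfold Re, Im; simpl; field. }
  assert (Z3 : z3 = 2 * Re z) by (rewrite Z34; unfold Re; simpl; field).
  assert (Z4 : z4 = 2 / sqrt 3 * Im z) by (rewrite Z34; unfold Im; simpl; field; auto).
  clear Hz Hz' Z34.
  assert (Ht2 : 0 < Im (RtoC 2 * tau)%C) by (unfold Im in *; simpl; lra).
  assert (Hth : 0 < Im (tau / RtoC 2)%C) by (rewrite tau_half_im; lra).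
  rewrite !theta_th, !theta2_th, !theta_star_th, !theta2_star_th, !theta4_th by auto.
  rewrite !th_half, !th_double.
  rewrite phi26_lat by auto.
  assert (E1 : (th chi12 (2 * / 24) (z3 / 6) tau * th chie (2 * / 8) (z4 / 2) tau)%C =
    lat (fun p => zC (c1 p)) (1 / 6) (1 / (2 * sqrt 3)) (1 / 12) (3 / 12) tau z).
  { replace (2 * / 24) with (1 / 12) by field. replace (2 * / 8) with (3 / 12) by field.
    apply th_mult_lat; auto with chars; try lra; rewrite ?Z3, ?Z4; field; auto. }
  assert (E3 : (th chi12 (/ 24) ((z1 + z2) / 6) tau * th chi12 (/ 24) ((z1 - z2) / 6) tau)%C =
    lat (fun p => zC (c3 p)) (1 / 6) (1 / 6) (1 / 12) (1 / 12) tau z).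
  { rewrite th_mult by (auto with chars; lra).
    set (F := fun p : Z * Z => (zC (chi12 (fst p) * chi12 (snd p)) * _ * _)%C).
    rewrite (tsum_rotate F).
    - apply tsum_ext; intros (m, n). unfold F, c3, chir; cbn [fst snd].
      rewrite plus_IZR, minus_IZR, <- Z1, <- Z2. f_equal; [f_equal|f_equal; field].
      rewrite (epow_scal1 ((IZR m + IZR n) / 2)), (epow_scal1 ((IZR m - IZR n) / 2)),
        (epow_scal1 (1 / 6 * IZR m)), (epow_scal1 (1 / 6 * IZR n)).
      rewrite <- !epow_add. f_equal. field.
    - unfold F. apply (asum_ext (fun p => (zC (chi12 (fst p)) * epow (IZR (fst p) / 2) (RtoC ((z1 + z2) / 6))
            * epow (/ 24 * IZR (fst p) ^ 2) tau) * (zC (chi12 (snd p)) * epow (IZR (snd p) / 2) (RtoC ((z1 - z2) / 6))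
            * epow (/ 24 * IZR (snd p) ^ 2) tau))%C).
      + intros p. rewrite zC_mult, epow_add. ring.
      + apply (asum_prod (fun n => zC (chi12 n) * epow (IZR n / 2) (RtoC ((z1 + z2) / 6))
            * epow (/ 24 * IZR n ^ 2) tau)%C
           (fun n => zC (chi12 n) * epow (IZR n / 2) (RtoC ((z1 - z2) / 6))
            * epow (/ 24 * IZR n ^ 2) tau)%C); apply asum_th; auto with chars; lra.
    - intros m n H. unfold F; cbn [fst snd]. rewrite chi12_parity by auto. unfold zC; ring. }
  assert (E2 : (RtoC (1 / 4) * lat (fun p => zC (c2 p)) (1 / 12) (1 / (4 * sqrt 3)) (1 / 48) (3 / 48) tau z)%C =
    (RtoC (1 / 8) * (th chi12 (/ 24 / 2) (z3 / 12) tau * th chi4 (/ 8 / 2) (z4 / 4) tau) +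
     (RtoC (1 / 16) * (th chi12 (/ 24 / 2) (z3 / 12 + 1 / 4) tau * th chi4 (/ 8 / 2) (z4 / 4 - 1 / 4) tau
        + th chim12 (/ 24 / 2) (z3 / 12 + 1 / 4) tau * th chim4 (/ 8 / 2) (z4 / 4 - 1 / 4) tau) +
      RtoC (1 / 16) * (th chi12 (/ 24 / 2) (z3 / 12 + 1 / 4) tau * th chi4 (/ 8 / 2) (z4 / 4 + 1 / 4) tau
        + RtoC (-1) * (th chim12 (/ 24 / 2) (z3 / 12 + 1 / 4) tau * th chim4 (/ 8 / 2) (z4 / 4 + 1 / 4) tau))))%C).
  { assert (AS : forall c d w1 w2, bounded1 c -> bounded1 d ->
      asum (fun p => zC (c (fst p) * d (snd p)) *
       (epow (IZR (fst p) / 2) (RtoC w1) * epow (IZR (snd p) / 2) (RtoC w2)) *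
       epow (/ 24 / 2 * IZR (fst p) ^ 2 + / 8 / 2 * IZR (snd p) ^ 2) tau)%C).
    { intros c d w1 w2 Hc Hd.
      apply (asum_ext (fun p => (zC (c (fst p)) * epow (IZR (fst p) / 2) (RtoC w1)
            * epow (/ 24 / 2 * IZR (fst p) ^ 2) tau) * (zC (d (snd p)) * epow (IZR (snd p) / 2) (RtoC w2)
            * epow (/ 8 / 2 * IZR (snd p) ^ 2) tau))%C).
      + intros p. rewrite zC_mult, epow_add. ring.
      + apply (asum_prod (fun n => zC (c n) * epow (IZR n / 2) (RtoC w1)
            * epow (/ 24 / 2 * IZR n ^ 2) tau)%C
           (fun n => zC (d n) * epow (IZR n / 2) (RtoC w2)
            * epow (/ 8 / 2 * IZR n ^ 2) tau)%C); apply asum_th; auto with chars; lra. }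
    rewrite !th_mult by (auto with chars; lra).
    unfold lat. rewrite <- !tsum_scal, <- !tsum_plus, <- !tsum_scal, <- !tsum_plus;
      auto 10 using asum_scal, asum_plus with chars.
    2: { apply asum_lat; auto; try lra. apply pgrow_bounded1, c2_b. }
    apply tsum_ext; intros (m, n). cbn [fst snd]. unfold c2; cbn [fst snd].
    replace (/ 24 / 2 * IZR m ^ 2 + / 8 / 2 * IZR n ^ 2)
      with (1 / 48 * IZR m ^ 2 + 3 / 48 * IZR n ^ 2) by field.
    assert (W : forall k (x y : R), epow (IZR k / 2) (RtoC (x + y)) =
       (epow (IZR k / 2) (RtoC x) * epow (IZR k * y / 2) (RtoC 1))%C).
    { intros k x y. rewrite RtoC_plus, epow_wadd. f_equal. apply epow_RR; field. }
    unfold Rminus. rewrite !W.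
    rewrite (epow_RR (1 / 12 * IZR m) (Re z) (IZR m / 2) (z3 / 12)) by (rewrite Z3; field).
    rewrite (epow_RR (1 / (4 * sqrt 3) * IZR n) (Im z) (IZR n / 2) (z4 / 4)) by (rewrite Z4; field; auto).
    set (q := epow (1 / 48 * _ + _) tau). set (e3 := epow (IZR m / 2) (RtoC (z3 / 12))).
    set (e4 := epow (IZR n / 2) (RtoC (z4 / 4))).
    (* The shifts by 1/4 in the two arguments multiply a term by the eighth root of unity exp (2 pi
       i (m -+ n) / 8), which [quarter_shift] converts into the signs of [chi12_pm]. *)
    assert (P1 : (epow (IZR m * (1 / 4) / 2) (RtoC 1) * epow (IZR n * - (1 / 4) / 2) (RtoC 1))%C =
      epow (IZR (m - 1 * n) / 8) (RtoC 1)).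
    { rewrite <- epow_add. f_equal. rewrite minus_IZR, mult_IZR; field. }
    assert (P2 : (epow (IZR m * (1 / 4) / 2) (RtoC 1) * epow (IZR n * (1 / 4) / 2) (RtoC 1))%C =
      epow (IZR (m - -1 * n) / 8) (RtoC 1)).
    { rewrite <- epow_add. f_equal. rewrite minus_IZR, mult_IZR; field. }
    set (a := epow (IZR m * (1 / 4) / 2) (RtoC 1)) in *.
    set (b := epow (IZR n * - (1 / 4) / 2) (RtoC 1)) in *.
    set (b' := epow (IZR n * (1 / 4) / 2) (RtoC 1)) in *.
    destruct (quarter_cond m n 1 (or_introl eq_refl)) as (U1 & U2).
    destruct (quarter_cond m n (-1) (or_intror eq_refl)) as (V1 & V2).
    assert (R1 := quarter_shift _ _ U1 U2). assert (R2 := quarter_shift _ _ V1 V2).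
    rewrite <- P1 in R1. rewrite <- P2 in R2.
    assert (X := chi12_pm m n).
    replace (chi12 m * chi4 n + 1 * (chim12 m * chim4 n))%Z with
      (chi12 m * chi4 n + chim12 m * chim4 n)%Z in R1 by ring.
    replace (chi12 m * chi4 n + -1 * (chim12 m * chim4 n))%Z with
      (chi12 m * chi4 n - chim12 m * chim4 n)%Z in R2 by ring.
    replace (m - 1 * n)%Z with (m - n)%Z in R1 by ring.
    replace (m - -1 * n)%Z with (m + n)%Z in R2 by ring.
    set (y1 := (pm ((m - n) / 4) * _)%Z) in R1, X.
    set (y2 := (pm ((m + n) / 4) * _)%Z) in R2, X.
    apply (f_equal zC) in X. rewrite !zC_plus, <- Z.mul_assoc in X.
    rewrite (zC_mult 2) in X.
    unfold Z.sub in R2. rewrite zC_plus, zC_opp in R2. rewrite zC_plus in R1.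
    transitivity (RtoC (1 / 8) * ((zC 2 * zC (cong8 m n * chi12 m)) * (e3 * e4 * q)))%C.
    { unfold zC at 2. replace (1 / 4) with (1 / 8 * 2) by field. rewrite RtoC_mult. ring. }
    rewrite X.
    transitivity (RtoC (1 / 8) * (zC (chi12 m * chi4 n) * (e3 * e4 * q)) +
       RtoC (1 / 16) * ((RtoC 2 * zC y1) + (RtoC 2 * zC y2)) * (e3 * e4 * q))%C.
    { replace (1 / 8) with (1 / 16 * 2) by field. rewrite RtoC_mult. ring. }
    rewrite <- R1, <- R2.
    ring. }
  rewrite E1, E2, E3. ring.
Qed.

(** * The twelfth derivative at the origin *)

(** Carries the existence of both partial derivatives along with the value of D_z. Since [Derive] is
    total, an equation for [Dz] alone would not pass to sums and multiples. *)
Definition DD2 (f g : C -> C) : Prop := forall z, exists dx dy,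
  dC (fun t => f (t, Im z)) (Re z) dx /\ dC (fun t => f (Re z, t)) (Im z) dy /\
  g z = (/ (RtoC (2 * PI) * Ci) * (RtoC (1 / 2) * (dx - Ci * dy)))%C.

Lemma DD2_Dz f g : DD2 f g -> Dz f = g.
Proof.
  intros H. apply functional_extensionality; intros z.
  destruct (H z) as (dx & dy & (H1 & H2) & (H3 & H4) & ->).
  unfold Dz, wirtinger, partial_x, partial_y.
  match goal with |- context [(?x - Ci * ?y)%C] => assert (Ex : x = dx); [|assert (Ey : y = dy)] end.
  - apply C_eq; [exact (is_derive_unique _ _ _ H1)|exact (is_derive_unique _ _ _ H2)].
  - apply C_eq; [exact (is_derive_unique _ _ _ H3)|exact (is_derive_unique _ _ _ H4)].
  - rewrite Ex, Ey; easy.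
Qed.

Lemma DD2_plus f g f' g' : DD2 f f' -> DD2 g g' ->
  DD2 (fun z => f z + g z)%C (fun z => f' z + g' z)%C.
Proof.
  intros H1 H2 z. destruct (H1 z) as (a & b & A & B & E), (H2 z) as (a' & b' & A' & B' & E').
  exists (a + a')%C, (b + b')%C; split; [apply (dC_plus _ _ _ _ _ A A')|split].
  - apply (dC_plus _ _ _ _ _ B B').
  - rewrite E, E'; ring.
Qed.

Lemma DD2_scal k f f' : DD2 f f' -> DD2 (fun z => k * f z)%C (fun z => k * f' z)%C.
Proof.
  intros H z. destruct (H z) as (a & b & A & B & E).
  exists (k * a)%C, (k * b)%C; split; [|split].
  - replace (k * a)%C with (RtoC 0 * f (Re z, Im z) + k * a)%C by ring.
    apply (dC_mult (fun _ => k) (fun t => f (t, Im z)) _ (RtoC 0) a (dC_const _ _) A).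
  - replace (k * b)%C with (RtoC 0 * f (Re z, Im z) + k * b)%C by ring.
    apply (dC_mult (fun _ => k) (fun t => f (Re z, t)) _ (RtoC 0) b (dC_const _ _) B).
  - rewrite E; ring.
Qed.

Lemma TwoPiI_nz : (RtoC (2 * PI) * Ci)%C <> RtoC 0.
Proof.
  intros H. apply (f_equal Im) in H. unfold Im in H; simpl in H.
  assert (X := PI_RGT_0). lra.
Qed.

Lemma pgrow_fst a : pgrow zsize2 (fun p => RtoC (a * IZR (fst p))).
Proof.
  apply (pgrow_lin _ _ (Rabs a)); [apply Rabs_pos|apply zsize2_ge0|].
  intros p; rewrite Cmod_R, Rabs_mult. apply Rmult_le_compat_l; [apply Rabs_pos|].
  unfold zsize2. assert (X := Rabs_pos (IZR (snd p))); lra.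
Qed.

Lemma pgrow_snd a : pgrow zsize2 (fun p => RtoC (a * IZR (snd p))).
Proof.
  apply (pgrow_lin _ _ (Rabs a)); [apply Rabs_pos|apply zsize2_ge0|].
  intros p; rewrite Cmod_R, Rabs_mult. apply Rmult_le_compat_l; [apply Rabs_pos|].
  unfold zsize2. assert (X := Rabs_pos (IZR (fst p))); lra.
Qed.

(** The eigenvalue of D_z on the term with index p; the 2 pi i of the exponents cancels against the
    one in D_z. *)
Definition lam (a b : R) (p : Z * Z) : C :=
  (RtoC (1 / 2) * (RtoC (a * IZR (fst p)) - Ci * RtoC (b * IZR (snd p))))%C.

Lemma pgrow_plus {T} (s : T -> R) (c d : T -> C) : (forall t, 0 <= s t) ->
  pgrow s c -> pgrow s d -> pgrow s (fun t => c t + d t)%C.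
Proof.
  intros Hs (K & k & HK & H) (K' & k' & HK' & H').
  exists (K + K'), (k + k')%nat; split; [lra|]. intros t.
  eapply Rle_trans; [apply Cmod_triangle|]. specialize (H t); specialize (H' t).
  specialize (Hs t).
  assert (P1 : (1 + s t) ^ k <= (1 + s t) ^ (k + k')) by (apply Rle_pow; [lra|lia]).
  assert (P2 : (1 + s t) ^ k' <= (1 + s t) ^ (k + k')) by (apply Rle_pow; [lra|lia]).
  rewrite Rmult_plus_distr_r. apply Rplus_le_compat.
  - eapply Rle_trans; [apply H|]. apply Rmult_le_compat_l; auto.
  - eapply Rle_trans; [apply H'|]. apply Rmult_le_compat_l; auto.
Qed.

Lemma pgrow_lam a b : pgrow zsize2 (lam a b).
Proof.
  unfold lam. apply (pgrow_mult zsize2 (fun _ => RtoC (1 / 2))); [apply zsize2_ge0| |].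
  - apply (pgrow_bound _ _ (Cmod (RtoC (1 / 2)))); intros; lra.
  - apply (pgrow_plus zsize2 (fun p => RtoC (a * IZR (fst p)))); [apply zsize2_ge0|apply pgrow_fst|].
    apply (pgrow_ext _ (fun p => - Ci * RtoC (b * IZR (snd p)))%C); [intros; ring|].
    apply (pgrow_mult zsize2 (fun _ => - Ci)%C); [apply zsize2_ge0| |apply pgrow_snd].
    apply (pgrow_bound _ _ (Cmod (- Ci))); intros; lra.
Qed.

Lemma lat_DD2 c a b l1 l2 tau : pgrow zsize2 c -> 0 < l1 -> 0 < l2 -> 0 < Im tau ->
  DD2 (lat c a b l1 l2 tau) (lat (fun p => c p * lam a b p)%C a b l1 l2 tau).
Proof.
  intros Hc H1 H2 Ht z.
  set (q := fun p : Z * Z => epow (l1 * IZR (fst p) ^ 2 + l2 * IZR (snd p) ^ 2) tau).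
  set (ex := fun p : Z * Z => epow (a * IZR (fst p)) (RtoC (Re z))).
  set (ey := fun p : Z * Z => epow (b * IZR (snd p)) (RtoC (Im z))).
  assert (AS : forall d, pgrow zsize2 d -> asum (fun p => d p * q p)%C).
  { intros d Hd. apply (asum_ext (fun p => d p * (epow (0 * IZR (fst p)) (RtoC (Re (RtoC 0)))
        * epow (0 * IZR (snd p)) (RtoC (Im (RtoC 0)))) * q p)%C).
    - intros p. rewrite !Rmult_0_l, !epow_0. ring.
    - apply asum_lat; auto. }
  assert (G : forall e : Z * Z -> C, (forall p, Cmod (e p) = 1) ->
      forall d, pgrow zsize2 d -> pgrow zsize2 (fun p => d p * e p)%C).
  { intros e He d Hd. apply pgrow_mult; auto; [apply zsize2_ge0|].
    apply (pgrow_bound _ _ 1); intros p; rewrite He; lra. }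
  assert (X1 : forall p, Cmod (ex p) = 1) by (intros; apply Cmod_epow_R).
  assert (X2 : forall p, Cmod (ey p) = 1) by (intros; apply Cmod_epow_R).
  set (cx := fun p => (c p * ey p * q p)%C). set (cy := fun p => (c p * ex p * q p)%C).
  exists (RtoC (2 * PI) * Ci * tsum (fun p => RtoC (a * IZR (fst p)) * cx p * ex p))%C,
    (RtoC (2 * PI) * Ci * tsum (fun p => RtoC (b * IZR (snd p)) * cy p * ey p))%C.
  assert (Sq : forall l : Z * Z -> R, pgrow zsize2 (fun p => RtoC (l p)) ->
     pgrow zsize2 (fun p => RtoC (l p ^ 2))).
  { intros l Hl. apply (pgrow_ext _ (fun p => RtoC (l p) * RtoC (l p))%C).
    - intros p. rewrite <- RtoC_mult. f_equal; ring.
    - apply pgrow_mult; auto. apply zsize2_ge0. }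
  split; [|split].
  - eapply dC_ext; [|apply (dC_series cx (fun p => a * IZR (fst p)))].
    + intros t. apply tsum_ext; intros p. unfold cx, ey, q, Re, Im; cbn [fst snd]. ring.
    + apply AS, G; auto.
    + apply (asum_ext (fun p => (RtoC ((a * IZR (fst p)) ^ 2) * (c p * ey p)) * q p)%C);
        [intros; unfold cx; ring|].
      apply AS, pgrow_mult; auto using zsize2_ge0. apply Sq, pgrow_fst.
  - eapply dC_ext; [|apply (dC_series cy (fun p => b * IZR (snd p)))].
    + intros t. apply tsum_ext; intros p. unfold cy, ex, q, Re, Im; cbn [fst snd]. ring.
    + apply AS, G; auto.
    + apply (asum_ext (fun p => (RtoC ((b * IZR (snd p)) ^ 2) * (c p * ex p)) * q p)%C);
        [intros; unfold cy; ring|].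
      apply AS, pgrow_mult; auto using zsize2_ge0. apply Sq, pgrow_snd.
  - set (sx := tsum _). set (sy := tsum (fun p => RtoC (b * _) * _ * _)%C).
    assert (H : (/ (RtoC (2 * PI) * Ci) * (RtoC (2 * PI) * Ci))%C = RtoC 1)
      by apply Cinv_l, TwoPiI_nz.
    transitivity ((/ (RtoC (2 * PI) * Ci) * (RtoC (2 * PI) * Ci))
      * (RtoC (1 / 2) * (sx + - Ci * sy)))%C; [|ring].
    rewrite H, Cmult_1_l.
    assert (Ax : asum (fun p => RtoC (a * IZR (fst p)) * cx p * ex p)%C).
    { apply (asum_ext (fun p => (RtoC (a * IZR (fst p)) * (c p * ey p * ex p)) * q p)%C);
        [intros; unfold cx; ring|].
      apply AS, pgrow_mult; auto using zsize2_ge0, pgrow_fst. }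
    assert (Ay : asum (fun p => RtoC (b * IZR (snd p)) * cy p * ey p)%C).
    { apply (asum_ext (fun p => (RtoC (b * IZR (snd p)) * (c p * ex p * ey p)) * q p)%C);
        [intros; unfold cy; ring|].
      apply AS, pgrow_mult; auto using zsize2_ge0, pgrow_snd. }
    unfold sx, sy. rewrite <- (tsum_scal (- Ci)%C), <- tsum_plus, <- tsum_scal;
      auto using asum_scal, asum_plus.
    apply tsum_ext; intros p. unfold cx, cy, ex, ey, q, lam. ring.
Qed.

Lemma Dz_n_lat3 k1 k2 k3 c d e a b l1 l2 a' b' l1' l2' a'' b'' l1'' l2'' tau n :
  pgrow zsize2 c -> pgrow zsize2 d -> pgrow zsize2 e ->
  0 < l1 -> 0 < l2 -> 0 < l1' -> 0 < l2' -> 0 < l1'' -> 0 < l2'' -> 0 < Im tau ->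
  Dz_n n (fun z => k1 * lat c a b l1 l2 tau z + k2 * lat d a' b' l1' l2' tau z
     + k3 * lat e a'' b'' l1'' l2'' tau z)%C =
  (fun z => k1 * lat (fun p => c p * Cpow (lam a b p) n) a b l1 l2 tau z
     + k2 * lat (fun p => d p * Cpow (lam a' b' p) n) a' b' l1' l2' tau z
     + k3 * lat (fun p => e p * Cpow (lam a'' b'' p) n) a'' b'' l1'' l2'' tau z)%C.
Proof.
  intros Hc Hd He P1 P2 P3 P4 P5 P6 Ht. unfold Dz_n. induction n as [|n IH].
  - simpl. apply functional_extensionality; intros z.
    f_equal; [f_equal|]; f_equal; apply tsum_ext; intros p; ring.
  - cbn [Nat.iter nat_rect]. change (nat_rect _ _ _ n) with (Nat.iter n Dz
      (fun z => k1 * lat c a b l1 l2 tau z + k2 * lat d a' b' l1' l2' tau z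
     + k3 * lat e a'' b'' l1'' l2'' tau z)%C).
    rewrite IH. apply DD2_Dz.
    assert (K : forall c a b l1 l2, pgrow zsize2 c -> 0 < l1 -> 0 < l2 ->
      DD2 (lat (fun p => c p * Cpow (lam a b p) n)%C a b l1 l2 tau)
          (lat (fun p => c p * Cpow (lam a b p) (S n))%C a b l1 l2 tau)).
    { clear -Ht. intros c a b l1 l2 Hc P1 P2.
      replace (lat (fun p => c p * Cpow (lam a b p) (S n))%C a b l1 l2 tau) with
        (lat (fun p => (c p * Cpow (lam a b p) n) * lam a b p)%C a b l1 l2 tau).
      - apply lat_DD2; auto. apply pgrow_mult; auto using zsize2_ge0.
        apply pgrow_pow; auto using zsize2_ge0, pgrow_lam.
      - apply functional_extensionality; intros z. apply tsum_ext; intros p.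
        rewrite Cpow_S; ring. }
    apply DD2_plus; [apply DD2_plus|]; apply DD2_scal, K; auto.
Qed.

(** * Moments of theta series and the binomial expansion *)

Definition Mom (c : Z -> Z) (l : R) (j : nat) (tau : C) : C :=
  tsum (fun n => zC (c n) * RtoC ((l * IZR n ^ 2) ^ j) * epow (l * IZR n ^ 2) tau)%C.

Lemma pgrow_zpow k : pgrow zsize (fun n => Cpow (zC n) k).
Proof.
  apply pgrow_pow; [apply zsize_ge0|]. apply (pgrow_lin _ _ 1); [lra|apply zsize_ge0|].
  intros n. rewrite Cmod_zC. unfold zsize. rewrite abs_IZR; lra.
Qed.

Lemma asum_pow c k l tau : bounded1 c -> 0 < l -> 0 < Im tau ->
  asum (fun n => zC (c n) * Cpow (zC n) k * epow (l * IZR n ^ 2) tau)%C.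
Proof.
  intros Hc Hl Ht. apply (asum_gauss _ _ l); auto.
  apply pgrow_mult; [apply zsize_ge0|apply pgrow_bounded1, Hc|apply pgrow_zpow].
Qed.

Lemma asum_Mom c l j tau : bounded1 c -> 0 < l -> 0 < Im tau ->
  asum (fun n => zC (c n) * RtoC ((l * IZR n ^ 2) ^ j) * epow (l * IZR n ^ 2) tau)%C.
Proof.
  intros Hc Hl Ht.
  apply (asum_ext (fun n => RtoC (l ^ j) * (zC (c n) * Cpow (zC n) (2 * j) * epow (l * IZR n ^ 2) tau))%C).
  - intros n. rewrite Rpow_mult_distr, RtoC_mult. unfold zC at 2.
    rewrite <- RtoC_pow, pow_mult. ring.
  - apply asum_scal, asum_pow; auto.
Qed.

Lemma Mom_even c l j tau : bounded1 c -> 0 < l -> 0 < Im tau ->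
  tsum (fun n => zC (c n) * Cpow (zC n) (2 * j) * epow (l * IZR n ^ 2) tau)%C =
  (RtoC (/ l ^ j) * Mom c l j tau)%C.
Proof.
  intros Hc Hl Ht. unfold Mom. rewrite <- tsum_scal by (apply asum_Mom; auto).
  apply tsum_ext; intros n. rewrite Rpow_mult_distr, RtoC_mult. unfold zC at 2.
  rewrite <- RtoC_pow, pow_mult.
  rewrite (RtoC_inv (l ^ j)).
  - field. intros Q; apply RtoC_inj in Q; revert Q; apply pow_nonzero; lra.
  - apply pow_nonzero; lra.
Qed.

Lemma tsum_odd (F : Z -> C) : asum F -> (forall n, F (- n)%Z = (- F n)%C) -> tsum F = RtoC 0.
Proof.
  intros A Ho.
  assert (E := tsum_bij Z.opp Z.opp F Z.opp_involutive Z.opp_involutive A).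
  rewrite (tsum_ext _ (fun n => RtoC (-1) * F n)%C), tsum_scal in E
    by (auto || (intros; rewrite Ho; ring)).
  replace (tsum F) with (RtoC (/ 2) * (tsum F - RtoC (-1) * tsum F))%C.
  - rewrite E. ring.
  - rewrite RtoC_inv by lra. field.
Qed.

Lemma Mom_odd c l j tau : bounded1 c -> (forall n, c (- n)%Z = c n) -> 0 < l -> 0 < Im tau ->
  tsum (fun n => zC (c n) * Cpow (zC n) (2 * j + 1) * epow (l * IZR n ^ 2) tau)%C = RtoC 0.
Proof.
  intros Hc He Hl Ht. apply tsum_odd; [apply asum_pow; auto|].
  intros n. rewrite He, zC_opp, opp_IZR.
  replace (l * (- IZR n) ^ 2) with (l * IZR n ^ 2) by ring.
  rewrite !(Cpow_add_r _ (2 * j)), !Cpow_mult_r.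
  replace (Cpow (- zC n) 2) with (Cpow (zC n) 2) by ring. ring.
Qed.

Lemma asum_0 {T} : asum (fun _ : T => RtoC 0).
Proof.
  exists 0; intros L _. right. induction L; simpl; [easy|]. rewrite IHL, Cmod_0; ring.
Qed.

Lemma tsum_lsum {T K} (F : K -> T -> C) (L : list K) : (forall k, asum (F k)) ->
  tsum (fun t => lsum (fun k => F k t) L) = lsum (fun k => tsum (F k)) L.
Proof.
  intros H. induction L as [|k L IH]; simpl.
  - apply hs_tsum. intros eps He. exists nil; intros L _ _. rewrite lsum_0 by auto.
    replace (RtoC 0 - RtoC 0)%C with (RtoC 0) by ring. rewrite Cmod_0; auto.
  - rewrite tsum_plus, IH; auto.
    clear IH. induction L as [|k' L IH]; simpl; [apply asum_0|].
    apply asum_plus; auto.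
Qed.

Definition binom12 (k : nat) : Z :=
  nth k (1 :: 12 :: 66 :: 220 :: 495 :: 792 :: 924 :: 792 :: 495 :: 220 :: 66 :: 12 :: 1 :: nil)%Z 0%Z.

Lemma binomial12 (x y : C) :
  Cpow (x + y) 12 = lsum (fun k => zC (binom12 k) * (Cpow x k * Cpow y (12 - k)))%C (seq 0 13).
Proof. cbn [seq lsum fold_right Nat.sub binom12 nth]. unfold zC. ring. Qed.

(** The coefficients (-1)^j binom(12, 2j) are those of the even part of (x + i y)^12. With the j-th
    derivatives in the arguments this is, up to a constant, the sixth Rankin-Cohen bracket in
    weights 1/2 and 1/2. *)
Definition Phi (f g : nat -> C) : C :=
  (f 0%nat * g 6%nat - RtoC 66 * (f 1%nat * g 5%nat) + RtoC 495 * (f 2%nat * g 4%nat)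
   - RtoC 924 * (f 3%nat * g 3%nat) + RtoC 495 * (f 4%nat * g 2%nat)
   - RtoC 66 * (f 5%nat * g 1%nat) + f 6%nat * g 0%nat)%C.

(** Odd powers of an index sum to 0 because c and d are even. In the even powers, al^2 and be^2 are
    opposite multiples of l1 and l2, so every term carries k^6 and a sign, and the powers of l1, l2
    are absorbed by the moments. *)
Lemma tsum_pow12 c d l1 l2 (al be k : C) tau : bounded1 c -> bounded1 d ->
  (forall n, c (- n)%Z = c n) -> (forall n, d (- n)%Z = d n) ->
  0 < l1 -> 0 < l2 -> 0 < Im tau ->
  (al * al = k * RtoC l1)%C -> (be * be = - k * RtoC l2)%C ->
  tsum (fun p => zC (c (fst p) * d (snd p)) * Cpow (al * zC (fst p) + be * zC (snd p)) 12 *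
     epow (l1 * IZR (fst p) ^ 2 + l2 * IZR (snd p) ^ 2) tau)%C =
  (Cpow k 6 * Phi (fun j => Mom c l1 j tau) (fun j => Mom d l2 j tau))%C.
Proof.
  intros Hc Hd Ec Ed H1 H2 Ht Ha Hb.
  set (A := fun k n => (zC (c n) * Cpow (zC n) k * epow (l1 * IZR n ^ 2) tau)%C).
  set (B := fun k n => (zC (d n) * Cpow (zC n) k * epow (l2 * IZR n ^ 2) tau)%C).
  assert (AA : forall k, asum (A k)) by (intros; apply asum_pow; auto).
  assert (AB : forall k, asum (B k)) by (intros; apply asum_pow; auto).
  transitivity (tsum (fun p => lsum (fun k => zC (binom12 k) * (Cpow al k * Cpow be (12 - k)) *
      (A k (fst p) * B (12 - k)%nat (snd p)))%C (seq 0 13))).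
  { apply tsum_ext; intros p. rewrite binomial12.
    rewrite (Cmult_comm _ (epow _ _)), Cmult_assoc, <- lsum_scal.
    apply lsum_ext; intros j _. unfold A, B. rewrite zC_mult, epow_add, !Cpow_mult_l. ring. }
  rewrite (tsum_lsum (fun k p => zC (binom12 k) * (Cpow al k * Cpow be (12 - k)) *
      (A k (fst p) * B (12 - k)%nat (snd p)))%C).
  2: { intros j. apply asum_scal, asum_prod; auto. }
  rewrite (lsum_ext _ (fun k => zC (binom12 k) * (Cpow al k * Cpow be (12 - k)) *
      (tsum (A k) * tsum (B (12 - k)%nat)))%C).
  2: { intros j _. rewrite tsum_scal, tsum_prod; auto. apply asum_prod; auto. }
  assert (Ev : forall j, tsum (A (2 * j)%nat) = (RtoC (/ l1 ^ j) * Mom c l1 j tau)%C)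
    by (intros; apply Mom_even; auto).
  assert (Od : forall j, tsum (A (2 * j + 1)%nat) = RtoC 0) by (intros; apply Mom_odd; auto).
  assert (Ev' : forall j, tsum (B (2 * j)%nat) = (RtoC (/ l2 ^ j) * Mom d l2 j tau)%C)
    by (intros; apply Mom_even; auto).
  cbn [seq lsum fold_right Nat.sub].
  rewrite (Ev 0%nat : tsum (A 0%nat) = _), (Ev 1%nat : tsum (A 2%nat) = _),
    (Ev 2%nat : tsum (A 4%nat) = _), (Ev 3%nat : tsum (A 6%nat) = _),
    (Ev 4%nat : tsum (A 8%nat) = _), (Ev 5%nat : tsum (A 10%nat) = _),
    (Ev 6%nat : tsum (A 12%nat) = _),
    (Od 0%nat : tsum (A 1%nat) = _), (Od 1%nat : tsum (A 3%nat) = _),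
    (Od 2%nat : tsum (A 5%nat) = _), (Od 3%nat : tsum (A 7%nat) = _),
    (Od 4%nat : tsum (A 9%nat) = _), (Od 5%nat : tsum (A 11%nat) = _),
    (Ev' 0%nat : tsum (B 0%nat) = _), (Ev' 1%nat : tsum (B 2%nat) = _),
    (Ev' 2%nat : tsum (B 4%nat) = _), (Ev' 3%nat : tsum (B 6%nat) = _),
    (Ev' 4%nat : tsum (B 8%nat) = _), (Ev' 5%nat : tsum (B 10%nat) = _),
    (Ev' 6%nat : tsum (B 12%nat) = _).
  assert (Pa : forall j, (Cpow al (2 * j) * RtoC (/ l1 ^ j))%C = Cpow k j).
  { intros j. rewrite Cpow_mult_r. replace (Cpow al 2) with (al * al)%C by ring.
    rewrite Ha, Cpow_mult_l, <- Cmult_assoc, RtoC_inv, RtoC_pow, Cinv_r, Cmult_1_r; auto.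
    - apply Cpow_nz. intros X; apply RtoC_inj in X; lra.
    - apply pow_nonzero; lra. }
  assert (Pb : forall j, (Cpow be (2 * j) * RtoC (/ l2 ^ j))%C = Cpow (- k) j).
  { intros j. rewrite Cpow_mult_r. replace (Cpow be 2) with (be * be)%C by ring.
    rewrite Hb, Cpow_mult_l, <- Cmult_assoc, RtoC_inv, RtoC_pow, Cinv_r, Cmult_1_r; auto.
    - apply Cpow_nz. intros X; apply RtoC_inj in X; lra.
    - apply pow_nonzero; lra. }
  assert (T : forall z i j (x y : C), (2 * i + 2 * j = 12)%nat ->
     (zC z * (Cpow al (2 * i) * Cpow be (2 * j)) * (RtoC (/ l1 ^ i) * x * (RtoC (/ l2 ^ j) * y)))%C
       = (zC z * (Cpow k i * Cpow (- k) j) * (x * y))%C).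
  { intros z i j x y _. rewrite <- Pa, <- Pb. ring. }
  assert (T0 := fun z => T z 0%nat 6%nat). assert (T1 := fun z => T z 1%nat 5%nat).
  assert (T2 := fun z => T z 2%nat 4%nat). assert (T3 := fun z => T z 3%nat 3%nat).
  assert (T4 := fun z => T z 4%nat 2%nat). assert (T5 := fun z => T z 5%nat 1%nat).
  assert (T6 := fun z => T z 6%nat 0%nat). cbn [Nat.mul Nat.add] in T0, T1, T2, T3, T4, T5, T6.
  rewrite T0, T1, T2, T3, T4, T5, T6 by easy. clear.
  unfold Phi, zC, binom12. cbn [nth]. ring.
Qed.

(** The symbol (2/n). It also arises from tau -> tau + 1: this turns [chi4] at exponent 3/48 into
    [chi8], and [chi12] at exponent 1/48 into [chi12_8], up to a constant phase. *)
Definition chi8 (n : Z) : Z :=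
  if Z.even n then 0%Z else if ((n mod 8 =? 1) || (n mod 8 =? 7))%Z%bool then 1%Z else (-1)%Z.
Definition chi12_8 (n : Z) : Z := (chi12 n * chi8 n)%Z.

Lemma chi8_48 n k : chi8 (n + 48 * k) = chi8 n.
Proof.
  unfold chi8. rewrite Z.even_add, Z.even_mul.
  replace (n + 48 * k)%Z with (n + (6 * k) * 8)%Z by ring. rewrite Z_mod_plus_full.
  change (Z.even 48) with true. cbn [orb]. destruct (Z.even n); easy.
Qed.

Lemma chi8_b : bounded1 chi8.
Proof. intros n; unfold chi8; destruct (Z.even n); [|destruct (_ || _)%bool]; simpl; lia. Qed.
Lemma chi12_8_b : bounded1 chi12_8.
Proof. apply (bounded1_mult chi12 chi8 chi12_b chi8_b). Qed.

Lemma periodic_eq (f g : Z -> Z) : (forall n k, f (n + 48 * k) = f n)%Z ->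
  (forall n k, g (n + 48 * k) = g n)%Z ->
  forallb (fun n => f n =? g n)%Z res48 = true -> forall n, f n = g n.
Proof.
  intros Hf Hg H n. rewrite (periodic_mod f Hf), (periodic_mod g Hg).
  rewrite forallb_forall in H. apply Z.eqb_eq, H, res48_mod.
Qed.

Lemma even_char (f : Z -> Z) : (forall n k, f (n + 48 * k) = f n)%Z ->
  forallb (fun n => f (- n) =? f n)%Z res48 = true -> forall n, f (- n)%Z = f n.
Proof.
  intros H. apply (periodic_eq (fun n => f (- n)%Z)); auto.
  intros n k. replace (- (n + 48 * k))%Z with (- n + 48 * (- k))%Z by ring. apply H.
Qed.

#[local] Hint Resolve chi8_b chi12_8_b : chars.

Lemma chi12_8_48 n k : chi12_8 (n + 48 * k) = chi12_8 n.
Proof. unfold chi12_8. rewrite chi12_48, chi8_48; easy. Qed.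

Lemma chi12_even n : chi12 (- n) = chi12 n.
Proof. apply even_char; [exact chi12_48|vm_compute; easy]. Qed.
Lemma chi4_even n : chi4 (- n) = chi4 n.
Proof. apply even_char; [exact chi4_48|vm_compute; easy]. Qed.
Lemma chie_even n : chie (- n) = chie n.
Proof. apply even_char; [exact chie_48|vm_compute; easy]. Qed.
Lemma chi8_even n : chi8 (- n) = chi8 n.
Proof. apply even_char; [exact chi8_48|vm_compute; easy]. Qed.
Lemma chi12_8_even n : chi12_8 (- n) = chi12_8 n.
Proof. apply even_char; [exact chi12_8_48|vm_compute; easy]. Qed.

(* For odd m, n one has m = +-n mod 8 iff (2/m)(2/n) = 1. *)
Lemma cong8_chi8 m n :
  (2 * (cong8 m n * chi12 m) = chi12 m * chi4 n + chi12_8 m * chi8 n)%Z.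
Proof.
  apply Zminus_eq. revert m n. apply periodic_check.
  - intros m n a b. rewrite cong8_48, chi12_48, chi4_48, chi12_8_48, chi8_48; easy.
  - vm_compute; easy.
Qed.

Theorem Dz12_phi26 tau : 0 < Im tau ->
  Dz_n 12 (fun z => phi26 z tau) (RtoC 0) =
  (RtoC (/ 12 ^ 6) *
    (RtoC (1 / 2) * Phi (fun j => Mom chi12 (1 / 12) j tau) (fun j => Mom chie (3 / 12) j tau)
     + RtoC (1 / 8) * (Phi (fun j => Mom chi12 (1 / 48) j tau) (fun j => Mom chi4 (3 / 48) j tau)
          + Phi (fun j => Mom chi12_8 (1 / 48) j tau) (fun j => Mom chi8 (3 / 48) j tau))
     + RtoC (1 / 2) * Phi (fun j => Mom chi12 (/ 24) j tau) (fun j => Mom chi12 (/ 24) j tau)))%C.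
Proof.
  intros Ht. assert (S3 := sqrt3_nz).
  assert (S33 : sqrt 3 * sqrt 3 = 3) by (apply sqrt_sqrt; lra).
  replace (fun z => phi26 z tau) with (fun z =>
   (RtoC (1 / 2) * lat (fun p => zC (c1 p)) (1 / 6) (1 / (2 * sqrt 3)) (1 / 12) (3 / 12) tau z
    + RtoC (1 / 4) * lat (fun p => zC (c2 p)) (1 / 12) (1 / (4 * sqrt 3)) (1 / 48) (3 / 48) tau z
    + RtoC (- (1 / 2)) * lat (fun p => zC (c3 p)) (1 / 6) (1 / 6) (1 / 12) (1 / 12) tau z)%C).
  2: { apply functional_extensionality; intros z. rewrite phi26_lat, RtoC_opp by auto. ring. }
  rewrite Dz_n_lat3; try lra; try (apply pgrow_bounded1; auto using c1_b, c2_b, c3_b).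
  assert (L0 : forall c a b l1 l2, lat c a b l1 l2 tau (RtoC 0) =
     tsum (fun p => c p * epow (l1 * IZR (fst p) ^ 2 + l2 * IZR (snd p) ^ 2) tau)%C).
  { intros. apply tsum_ext; intros p. cbn [Re Im RtoC fst snd]. rewrite !epow_w0. ring. }
  rewrite !L0.
  assert (Al : forall a b p, lam a b p = (RtoC (a / 2) * zC (fst p) + (- Ci * RtoC (b / 2)) * zC (snd p))%C).
  { intros a b p. unfold lam, zC. rewrite !RtoC_mult. unfold Rdiv. rewrite !RtoC_mult. ring. }
  assert (RR : forall x y z : R, x = y * z -> RtoC x = (RtoC y * RtoC z)%C).
  { intros x y z ->. apply RtoC_mult. }
  assert (I1 : (Ci * Ci)%C = RtoC (-1)) by (apply C_eq; simpl; ring).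
  assert (Sq : forall x y z : R, x * x = y * z -> (RtoC x * RtoC x)%C = (RtoC y * RtoC z)%C).
  { intros x y z H. rewrite <- !RtoC_mult, H; easy. }
  assert (Sqi : forall x y z : R, x * x = y * z -> (- Ci * RtoC x * (- Ci * RtoC x))%C = (- RtoC y * RtoC z)%C).
  { intros x y z H. transitivity ((Ci * Ci) * (RtoC x * RtoC x))%C; [ring|].
    rewrite I1, (Sq x y z H). ring. }
  assert (E1 : tsum (fun p => zC (c1 p) * Cpow (lam (1 / 6) (1 / (2 * sqrt 3)) p) 12 *
      epow (1 / 12 * IZR (fst p) ^ 2 + 3 / 12 * IZR (snd p) ^ 2) tau)%C =
      (Cpow (RtoC (1 / 12)) 6 * Phi (fun j => Mom chi12 (1 / 12) j tau) (fun j => Mom chie (3 / 12) j tau))%C).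
  { rewrite <- (tsum_pow12 chi12 chie (1 / 12) (3 / 12) (RtoC (1 / 6 / 2)) (- Ci * RtoC (1 / (2 * sqrt 3) / 2))%C);
      auto using chi12_even, chie_even with chars; try lra.
    - apply tsum_ext; intros p. rewrite Al. easy.
    - apply Sq; field.
    - apply Sqi. apply (Rmult_eq_reg_r (sqrt 3 * sqrt 3)); [|nra]. rewrite S33 at 2. field; auto. }
  assert (E2 : (tsum (fun p => zC (c2 p) * Cpow (lam (1 / 12) (1 / (4 * sqrt 3)) p) 12 *
      epow (1 / 48 * IZR (fst p) ^ 2 + 3 / 48 * IZR (snd p) ^ 2) tau)%C =
      RtoC (1 / 2) * (Cpow (RtoC (1 / 12)) 6 * Phi (fun j => Mom chi12 (1 / 48) j tau) (fun j => Mom chi4 (3 / 48) j tau)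
       + Cpow (RtoC (1 / 12)) 6 * Phi (fun j => Mom chi12_8 (1 / 48) j tau) (fun j => Mom chi8 (3 / 48) j tau)))%C).
  { assert (K1 : 1 / 12 / 2 * (1 / 12 / 2) = 1 / 12 * (1 / 48)) by field.
    assert (K2 : 1 / (4 * sqrt 3) / 2 * (1 / (4 * sqrt 3) / 2) = 1 / 12 * (3 / 48)).
    { apply (Rmult_eq_reg_r (sqrt 3 * sqrt 3)); [|nra]. rewrite S33 at 2. field; auto. }
    rewrite <- (tsum_pow12 chi12 chi4 (1 / 48) (3 / 48) (RtoC (1 / 12 / 2)) (- Ci * RtoC (1 / (4 * sqrt 3) / 2))%C),
     <- (tsum_pow12 chi12_8 chi8 (1 / 48) (3 / 48) (RtoC (1 / 12 / 2)) (- Ci * RtoC (1 / (4 * sqrt 3) / 2))%C);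
      auto using chi12_even, chi4_even, chi8_even, chi12_8_even, chi12_8_b, chi8_b with chars; try lra.
    assert (AS : forall c d, bounded1 c -> bounded1 d -> asum (fun p =>
      zC (c (fst p) * d (snd p)) * Cpow (RtoC (1 / 12 / 2) * zC (fst p) + - Ci * RtoC (1 / (4 * sqrt 3) / 2) * zC (snd p)) 12 *
      epow (1 / 48 * IZR (fst p) ^ 2 + 3 / 48 * IZR (snd p) ^ 2) tau)%C).
    { intros c d Hc Hd. apply (asum_gauss2 _ _ (1 / 48)); auto; try lra.
      - apply (pgrow_mult zsize2 (fun p => zC (c (fst p) * d (snd p)))); [apply zsize2_ge0| |].
        + apply pgrow_bounded1; intros p; apply abs_mult_le1; auto.
        + apply (pgrow_ext _ (fun p => Cpow (lam (1 / 12) (1 / (4 * sqrt 3)) p) 12)).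
          * intros p; rewrite Al; easy.
          * apply pgrow_pow; auto using zsize2_ge0, pgrow_lam.
      - intros p. assert (X := pow2_ge_0 (IZR (snd p))). lra. }
    rewrite <- tsum_plus, <- tsum_scal by (try apply asum_plus; apply AS; auto using chi12_8_b, chi8_b with chars).
    apply tsum_ext; intros p. rewrite Al.
    (* The congruence modulo 8 is detected here by [chi8] so that all coefficients are even
       functions of their index, as [tsum_pow12] requires; the characters [chim12] and [chim4] of
       the theta identity are odd. *)
    assert (X := cong8_chi8 (fst p) (snd p)). apply (f_equal zC) in X.
    fold (c2 p) in X. rewrite zC_plus, (zC_mult 2) in X.
    set (w := Cpow _ 12). set (q := epow _ _).
    transitivity (RtoC (1 / 2) * (zC 2 * zC (c2 p)) * w * q)%C.
    - assert (H : (RtoC (1 / 2) * zC 2)%C = RtoC 1) by (unfold zC; rewrite <- RtoC_mult; f_equal; field).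
      rewrite Cmult_assoc, H. ring.
    - rewrite X. ring. }
  assert (E3 : tsum (fun p => zC (c3 p) * Cpow (lam (1 / 6) (1 / 6) p) 12 *
      epow (1 / 12 * IZR (fst p) ^ 2 + 1 / 12 * IZR (snd p) ^ 2) tau)%C =
      (- (Cpow (RtoC (1 / 12)) 6 * Phi (fun j => Mom chi12 (/ 24) j tau) (fun j => Mom chi12 (/ 24) j tau)))%C).
  (* In the rotated indices M = m + n, N = m - n the linear form (m - i n) / 12 becomes al M + be N.
     Its squares correspond to k = -i / 12, and k^6 = -12^-6 reverses the sign of the third sum. *)
  { set (al := (RtoC (1 / 24) * (RtoC 1 - Ci))%C). set (be := (RtoC (1 / 24) * (RtoC 1 + Ci))%C).
    assert (Ha : (al * al)%C = (- Ci * RtoC (1 / 12) * RtoC (/ 24))%C).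
    { unfold al; apply C_eq; simpl; field. }
    assert (Hb : (be * be)%C = (- (- Ci * RtoC (1 / 12)) * RtoC (/ 24))%C).
    { unfold be; apply C_eq; simpl; field. }
    replace (- (Cpow (RtoC (1 / 12)) 6 * Phi (fun j => Mom chi12 (/ 24) j tau) (fun j => Mom chi12 (/ 24) j tau)))%C
      with (Cpow (- Ci * RtoC (1 / 12)) 6 * Phi (fun j => Mom chi12 (/ 24) j tau) (fun j => Mom chi12 (/ 24) j tau))%C.
    2: { rewrite Cpow_mult_l. replace (Cpow (- Ci) 6) with ((Ci * Ci) * (Ci * Ci) * (Ci * Ci))%C by ring.
         rewrite I1. ring. }
    rewrite <- (tsum_pow12 chi12 chi12 (/ 24) (/ 24) al be); auto using chi12_even with chars; try lra.
    set (F := fun p : Z * Z => (zC (chi12 (fst p) * chi12 (snd p)) * _ * _)%C).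
    rewrite (tsum_rotate F).
    - apply tsum_ext; intros (m, n). unfold F, c3, chir; cbn [fst snd]. rewrite Al.
      unfold al, be. unfold zC at 2 3 5 6. cbn [fst snd]. rewrite plus_IZR, minus_IZR.
      f_equal; [f_equal; f_equal|f_equal; field].
      apply C_eq; simpl; field.
    - unfold F. apply (asum_gauss2 _ _ (/ 24)); auto; try lra.
      + apply (pgrow_mult zsize2 (fun p => zC (chi12 (fst p) * chi12 (snd p)))); [apply zsize2_ge0| |].
        * apply pgrow_bounded1; intros p; apply abs_mult_le1; apply chi12_b.
        * apply pgrow_pow; [apply zsize2_ge0|].
          assert (Kc : forall (z : C), pgrow zsize2 (fun _ => z))
            by (intros z; apply (pgrow_bound _ _ (Cmod z)); intros; lra).
          apply (pgrow_plus zsize2 (fun p => al * zC (fst p))%C); auto using zsize2_ge0.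
          -- apply (pgrow_ext _ (fun p => al * RtoC (1 * IZR (fst p)))%C);
               [intros; rewrite Rmult_1_l; easy|].
             apply (pgrow_mult zsize2 (fun _ => al)); auto using zsize2_ge0, pgrow_fst.
          -- apply (pgrow_ext _ (fun p => be * RtoC (1 * IZR (snd p)))%C);
               [intros; rewrite Rmult_1_l; easy|].
             apply (pgrow_mult zsize2 (fun _ => be)); auto using zsize2_ge0, pgrow_snd.
      + intros p. lra.
    - intros m n H. unfold F; cbn [fst snd]. rewrite chi12_parity by auto. unfold zC at 1; ring. }
  rewrite E1, E2, E3.
  rewrite (RtoC_opp (1 / 2)).
  replace (RtoC (/ 12 ^ 6)) with (Cpow (RtoC (1 / 12)) 6) by (rewrite <- RtoC_pow; f_equal; field).
  replace (RtoC (1 / 8)) with (RtoC (1 / 4) * RtoC (1 / 2))%C by (rewrite <- RtoC_mult; f_equal; field).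
  ring.
Qed.

(** * Infinite products *)

Fixpoint cprod (f : nat -> C) (n : nat) : C :=
  match n with O => RtoC 1 | S m => (cprod f m * f m)%C end.

Lemma cprod_ext f g n : (forall k, (k < n)%nat -> f k = g k) -> cprod f n = cprod g n.
Proof. induction n; intros H; simpl; [easy|]. rewrite IHn, H; auto. Qed.

Lemma cprod_mult f g n : cprod (fun k => f k * g k)%C n = (cprod f n * cprod g n)%C.
Proof. induction n; simpl; [ring|]. rewrite IHn; ring. Qed.

Lemma cprod_shift f n : (cprod f n * f n)%C = (f 0%nat * cprod (fun k => f (S k)) n)%C.
Proof. induction n; simpl; [ring|]. rewrite IHn; ring. Qed.

Lemma cprod_nz f n : (forall k, f k <> RtoC 0) -> cprod f n <> RtoC 0.
Proof.
  intros H; induction n; simpl; [intros X; apply RtoC_inj in X; lra|].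
  apply Cmult_neq_0; auto.
Qed.

Lemma climit_unique u l l' : climit u l -> climit u l' -> l = l'.
Proof.
  intros H H'. rewrite <- (Clim_seq_climit _ _ H). apply Clim_seq_climit; auto.
Qed.

Lemma climit_ext u v l : (forall n, u n = v n) -> climit u l -> climit v l.
Proof.
  intros E H eps He. destruct (H eps He) as (N & K). exists N; intros n Hn.
  rewrite <- E; auto.
Qed.

Lemma climit_const c : climit (fun _ => c) c.
Proof.
  intros eps He. exists 0%nat; intros n _. replace (c - c)%C with (RtoC 0) by ring.
  rewrite Cmod_0; auto.
Qed.

Lemma climit_sub u l (s : nat -> nat) : (forall n, (n <= s n)%nat) ->
  climit u l -> climit (fun n => u (s n)) l.
Proof.
  intros Hs H eps He. destruct (H eps He) as (N & K). exists N; intros n Hn.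
  apply K. specialize (Hs n); lia.
Qed.

Lemma climit_bounded u l : climit u l -> exists M, 0 < M /\ forall n, Cmod (u n) <= M.
Proof.
  intros H. destruct (H 1 Rlt_0_1) as (N & K).
  assert (F : exists M, 0 < M /\ forall n, (n < N)%nat -> Cmod (u n) <= M).
  { clear K. induction N as [|N (M & HM & IH)].
    - exists 1; split; [lra|]; intros; lia.
    - exists (M + Cmod (u N)); split; [assert (X := Cmod_ge_0 (u N)); lra|].
      intros n Hn. destruct (Nat.eq_dec n N) as [->|Hne]; [lra|].
      specialize (IH n ltac:(lia)). assert (X := Cmod_ge_0 (u N)); lra. }
  destruct F as (M & HM & F).
  exists (M + (Cmod l + 1)); split; [assert (X := Cmod_ge_0 l); lra|]. intros n.
  destruct (le_lt_dec N n) as [Hn|Hn].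
  - specialize (K n Hn). replace (u n) with (l + (u n - l))%C by ring.
    eapply Rle_trans; [apply Cmod_triangle|]. lra.
  - specialize (F n Hn). assert (X := Cmod_ge_0 l); lra.
Qed.

Lemma climit_mult u v l m : climit u l -> climit v m -> climit (fun n => u n * v n)%C (l * m)%C.
Proof.
  intros H1 H2. destruct (climit_bounded _ _ H2) as (M & HM & B).
  intros eps He.
  assert (Hl : 0 < Cmod l + 1) by (assert (X := Cmod_ge_0 l); lra).
  destruct (H1 (eps / (2 * M))) as (N1 & K1); [apply Rdiv_lt_0_compat; lra|].
  destruct (H2 (eps / (2 * (Cmod l + 1)))) as (N2 & K2); [apply Rdiv_lt_0_compat; lra|].
  exists (Nat.max N1 N2); intros n Hn.
  specialize (K1 n ltac:(lia)); specialize (K2 n ltac:(lia)); specialize (B n).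
  replace (u n * v n - l * m)%C with ((u n - l) * v n + l * (v n - m))%C by ring.
  eapply Rle_lt_trans; [apply Cmod_triangle|]. rewrite !Cmod_mult.
  assert (X1 := Cmod_ge_0 (u n - l)). assert (X2 := Cmod_ge_0 (v n - m)).
  assert (Y1 := Cmod_ge_0 l). assert (Y2 := Cmod_ge_0 (v n)).
  assert (P1 : Cmod (u n - l) * Cmod (v n) <= Cmod (u n - l) * M) by (apply Rmult_le_compat_l; auto).
  assert (P2 : Cmod (u n - l) * M < eps / (2 * M) * M) by (apply Rmult_lt_compat_r; auto).
  replace (eps / (2 * M) * M) with (eps / 2) in P2 by (field; lra).
  assert (P3 : Cmod l * Cmod (v n - m) <= (Cmod l + 1) * Cmod (v n - m)) by nra.
  assert (P4 : (Cmod l + 1) * Cmod (v n - m) < (Cmod l + 1) * (eps / (2 * (Cmod l + 1))))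
    by (apply Rmult_lt_compat_l; auto).
  replace ((Cmod l + 1) * (eps / (2 * (Cmod l + 1)))) with (eps / 2) in P4 by (field; lra).
  lra.
Qed.

Lemma climit_shift u l : climit (fun n => u (S n)) l -> climit u l.
Proof.
  intros H eps He. destruct (H eps He) as (N & K). exists (S N); intros n Hn.
  destruct n as [|n]; [lia|]. apply K; lia.
Qed.

Lemma cprod_bound (a : nat -> C) M : (forall n, rsum (fun k => Cmod (a k)) (seq 0 n) <= M) ->
  forall n, Cmod (cprod (fun k => RtoC 1 + a k)%C n) <= exp M.
Proof.
  intros H n.
  assert (E : Cmod (cprod (fun k => RtoC 1 + a k)%C n) <= exp (rsum (fun k => Cmod (a k)) (seq 0 n))).
  { clear H; induction n as [|n IH].
    - simpl. rewrite Cmod_1, exp_0; lra.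
    - rewrite seq_S, rsum_app. cbn [cprod Nat.add rsum fold_right]. rewrite Cmod_mult, exp_plus.
      apply Rmult_le_compat; auto; try apply Cmod_ge_0. rewrite Rplus_0_r.
      eapply Rle_trans; [apply Cmod_triangle|]. rewrite Cmod_1.
      destruct (Req_dec (Cmod (a n)) 0) as [->|Hn]; [rewrite exp_0; lra|].
      left; apply exp_ineq1; auto. }
  eapply Rle_trans; [apply E|]. specialize (H n). destruct H as [H|H].
  - left; apply exp_increasing; auto.
  - right; rewrite H; easy.
Qed.

(** The partial products P_n telescope to 1 + sum of P_k a_k over k < n, and the P_k are bounded by
    exp M, so absolute summability of a suffices. *)
Lemma cprod_conv (a : nat -> C) M : (forall n, rsum (fun k => Cmod (a k)) (seq 0 n) <= M) ->
  exists l, climit (cprod (fun k => RtoC 1 + a k)%C) l.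
Proof.
  intros H. set (P := cprod (fun k => RtoC 1 + a k)%C).
  set (F := fun k => (P k * a k)%C).
  assert (AF : asum F).
  { apply (asum_le _ (fun k => exp M * Cmod (a k)) (exp M * M)).
    - intros k. unfold F. rewrite Cmod_mult. apply Rmult_le_compat_r; [apply Cmod_ge_0|].
      apply cprod_bound; auto.
    - intros L HL. rewrite rsum_scal. apply Rmult_le_compat_l; [left; apply exp_pos|].
      apply rsum_nat_bound; auto. intros; apply Cmod_ge_0. }
  exists (RtoC 1 + tsum F)%C.
  assert (X := hs_lists F _ (seq 0) (asum_hs _ AF) (fun N => seq_NoDup N 0)).
  assert (E : forall n, P n = (RtoC 1 + lsum F (seq 0 n))%C).
  { induction n as [|n IH]; [unfold P; simpl; ring|].
    rewrite seq_S, lsum_app. cbn [Nat.add lsum fold_right]. unfold P in *. cbn [cprod].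
    unfold F, P. rewrite IH at 1. fold P. fold (P n). unfold P at 2. rewrite IH. unfold F, P. ring. }
  intros eps He. destruct (X ltac:(intros t; exists (S t); intros n Hn; apply in_seq; lia) eps He) as (N & K).
  exists N; intros n Hn. rewrite E. specialize (K n Hn).
  replace (RtoC 1 + lsum F (seq 0 n) - (RtoC 1 + tsum F))%C with (lsum F (seq 0 n) - tsum F)%C by ring.
  auto.
Qed.

(* Convergence of the product of the inverses shows that the limit is nonzero. *)
Lemma cprod_conv_nz (a : nat -> C) M d : 0 < d ->
  (forall n, rsum (fun k => Cmod (a k)) (seq 0 n) <= M) ->
  (forall k, d <= Cmod (RtoC 1 + a k)) ->
  exists l, climit (cprod (fun k => RtoC 1 + a k)%C) l /\ l <> RtoC 0.
Proof.
  intros Hd H Hb. destruct (cprod_conv a M H) as (l & Hl).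
  assert (NZ : forall k, (RtoC 1 + a k)%C <> RtoC 0).
  { intros k X. specialize (Hb k). rewrite X, Cmod_0 in Hb. lra. }
  set (b := fun k => (- a k / (RtoC 1 + a k))%C).
  destruct (cprod_conv b (/ d * M)) as (m & Hm).
  { intros n. eapply Rle_trans; [apply (rsum_le _ (fun k => / d * Cmod (a k)))|].
    - intros k _. unfold b, Cdiv. rewrite Cmod_mult, Cmod_opp, Cmod_inv by auto.
      rewrite Rmult_comm. apply Rmult_le_compat_r; [apply Cmod_ge_0|].
      apply Rinv_le_contravar; auto.
    - rewrite rsum_scal. apply Rmult_le_compat_l; auto. left; apply Rinv_0_lt_compat; auto. }
  exists l; split; auto. intros ->.
  assert (X := climit_mult _ _ _ _ Hl Hm).
  assert (Y : climit (fun _ => RtoC 1) (RtoC 0 * m)%C).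
  { eapply climit_ext; [|exact X]. intros n; simpl. rewrite <- cprod_mult.
    induction n as [|n IH]; simpl; [easy|]. rewrite IH. unfold b. field. auto. }
  assert (Z := climit_unique _ _ _ (climit_const _) Y).
  apply (f_equal Cmod) in Z. rewrite Cmod_mult, Cmod_0, Cmod_1 in Z. lra.
Qed.

Section Products.
Variable tau : C.
Hypothesis Ht : 0 < Im tau.
Notation e x := (epow x tau).

Lemma Cmod_e_lt1 x : 0 < x -> Cmod (e x) < 1.
Proof.
  intros Hx. rewrite Cmod_epow, <- exp_0. apply exp_increasing.
  assert (X := PI_RGT_0). assert (0 < 2 * PI * x) by nra. nra.
Qed.

Lemma e_INR n x : e (x * INR n) = Cpow (e x) n.
Proof. rewrite Rmult_comm; apply epow_nat. Qed.

Lemma e_geom (s : C) x y : Cmod s = 1 -> 0 < x -> exists M, forall n,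
  rsum (fun k => Cmod (s * e (y + x * INR k))) (seq 0 n) <= M.
Proof.
  intros Hs Hx. exists (Cmod (e y) * (Cmod (e x) ^ 0 / (1 - Cmod (e x)))). intros n.
  rewrite (Rmult_comm (Cmod _)).
  apply Rle_trans with (rsum (fun k => Cmod (e y) * Cmod (e x) ^ k) (seq 0 n)).
  - apply rsum_le; intros k _. right.
    rewrite Cmod_mult, Hs, epow_add, e_INR, Cmod_mult, Cmod_pow. ring.
  - rewrite rsum_scal, Rmult_comm. apply Rmult_le_compat_r; [apply Cmod_ge_0|].
    apply geom_bound. split; [apply Cmod_ge_0|apply Cmod_e_lt1; auto].
Qed.

(* The q-shifted factorials (q; q)_n for q = e l, and their limit. *)
Definition qf (l : R) (n : nat) : C := cprod (fun k => RtoC 1 - e (l * INR (S k)))%C n.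
Definition qlim (l : R) : C := Clim_seq (qf l).

Lemma qf_lim l : 0 < l -> climit (qf l) (qlim l) /\ qlim l <> RtoC 0.
Proof.
  intros Hl.
  assert (E : forall k, (RtoC 1 - e (l * INR (S k)) = RtoC 1 + RtoC (-1) * e (l + l * INR k))%C).
  { intros k. rewrite S_INR. replace (l * (INR k + 1)) with (l + l * INR k) by ring. ring. }
  destruct (e_geom (RtoC (-1)) l l) as (M & HM); auto.
  { rewrite Cmod_R, Rabs_left; lra. }
  destruct (cprod_conv_nz (fun k => RtoC (-1) * e (l + l * INR k))%C M (1 - Cmod (e l))) as (m & Hm & Hn); auto.
  - assert (X := Cmod_e_lt1 l Hl); lra.
  - intros k.
    assert (X : Cmod (e (l + l * INR k)) <= Cmod (e l)).
    { rewrite epow_add, e_INR, Cmod_mult, Cmod_pow.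
      assert (Y := Cmod_e_lt1 l Hl). assert (Z := Cmod_ge_0 (e l)).
      assert (Cmod (e l) ^ k <= 1) by (rewrite <- (pow1 k); apply pow_incr; lra). nra. }
    assert (T := Cmod_triangle (RtoC 1 + RtoC (-1) * e (l + l * INR k)) (e (l + l * INR k))).
    replace (RtoC 1 + RtoC (-1) * e (l + l * INR k) + e (l + l * INR k))%C with (RtoC 1) in T by ring.
    rewrite Cmod_1 in T. lra.
  - assert (L : climit (qf l) m).
    { eapply climit_ext; [|exact Hm]. intros n. apply cprod_ext; intros; symmetry; apply E. }
    unfold qlim. rewrite (Clim_seq_climit _ _ L); auto.
Qed.

Lemma one_minus_e_nz x : 0 < x -> (RtoC 1 - e x)%C <> RtoC 0.
Proof.
  intros Hx H. assert (X := Cmod_e_lt1 x Hx).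
  replace (e x) with (RtoC 1 - (RtoC 1 - e x))%C in X by ring. rewrite H in X.
  replace (RtoC 1 - RtoC 0)%C with (RtoC 1) in X by ring. rewrite Cmod_1 in X; lra.
Qed.

Lemma qf_nz l n : 0 < l -> qf l n <> RtoC 0.
Proof.
  intros Hl. apply cprod_nz; intros k. apply one_minus_e_nz.
  apply Rmult_lt_0_compat; auto. apply lt_0_INR; lia.
Qed.

(** The reciprocal of (q; q)_m, extended by 0 to negative m. This makes the recursion [iq_pred] hold
    for every integer m, since at m = 0 its factor 1 - q^0 vanishes. *)
Definition iq (l : R) (m : Z) : C :=
  if (m <? 0)%Z then RtoC 0 else (/ qf l (Z.to_nat m))%C.

Lemma iq_pred l m : 0 < l -> iq l (m - 1) = ((RtoC 1 - e (l * IZR m)) * iq l m)%C.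
Proof.
  intros Hl. unfold iq.
  destruct (Z.ltb_spec (m - 1) 0), (Z.ltb_spec m 0); try lia.
  - ring.
  - replace m with 0%Z by lia. rewrite Rmult_0_r, epow_0. ring.
  - replace (Z.to_nat m) with (S (Z.to_nat (m - 1))) by lia.
    unfold qf at 2. cbn [cprod]. fold (qf l (Z.to_nat (m - 1))).
    replace (IZR m) with (INR (S (Z.to_nat (m - 1)))) by (rewrite INR_IZR_INZ; f_equal; lia).
    field. split; [|apply qf_nz; auto].
    apply one_minus_e_nz. apply Rmult_lt_0_compat; auto. apply lt_0_INR; lia.
Qed.

(** The Gaussian binomial coefficient of 2N over N + n in the base q^l; it is 0 for |n| > N. *)
Definition cc (l : R) (N : nat) (n : Z) : C :=
  (qf l (2 * N) * (iq l (Z.of_nat N + n) * iq l (Z.of_nat N - n)))%C.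

(** Two q-Pascal rules at once, matching the two factors that the finite triple product gains when N
    increases by 1. *)
Lemma cc_step l N n : 0 < l ->
  cc l (S N) n = (cc l N n * (RtoC 1 + e (l * (2 * INR N + 1)))
    + cc l N (n - 1) * e (l * (INR N + 1 - IZR n))
    + cc l N (n + 1) * e (l * (INR N + 1 + IZR n)))%C.
Proof.
  intros Hl. unfold cc.
  set (a := (Z.of_nat N + 1 + n)%Z). set (b := (Z.of_nat N + 1 - n)%Z).
  replace (Z.of_nat (S N) + n)%Z with a by (unfold a; lia).
  replace (Z.of_nat (S N) - n)%Z with b by (unfold b; lia).
  replace (Z.of_nat N + n)%Z with (a - 1)%Z by (unfold a; lia).
  replace (Z.of_nat N - n)%Z with (b - 1)%Z by (unfold b; lia).
  replace (Z.of_nat N + (n - 1))%Z with (a - 1 - 1)%Z by (unfold a; lia).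
  replace (Z.of_nat N - (n - 1))%Z with b by (unfold b; lia).
  replace (Z.of_nat N + (n + 1))%Z with a by (unfold a; lia).
  replace (Z.of_nat N - (n + 1))%Z with (b - 1 - 1)%Z by (unfold b; lia).
  rewrite !iq_pred by auto.
  replace (2 * S N)%nat with (S (S (2 * N))) by lia.
  unfold qf at 1. cbn [cprod]. fold (qf l (2 * N)).
  assert (Ia : IZR a = INR N + 1 + IZR n) by (unfold a; rewrite !plus_IZR, <- INR_IZR_INZ; easy).
  assert (Ib : IZR b = INR N + 1 - IZR n) by (unfold b; rewrite minus_IZR, plus_IZR, <- INR_IZR_INZ; easy).
  rewrite <- Ia, <- Ib, !minus_IZR.
  assert (X : e (l * IZR a) = (e l * e (l * (IZR a - 1)))%C)
    by (rewrite <- epow_add; f_equal; ring).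
  assert (Y : e (l * IZR b) = (e l * e (l * (IZR b - 1)))%C)
    by (rewrite <- epow_add; f_equal; ring).
  assert (W1 : e (l * INR (S (2 * N))) = (e l * (e (l * (IZR a - 1)) * e (l * (IZR b - 1))))%C).
  { rewrite <- !epow_add. f_equal. rewrite S_INR, mult_INR, Ia, Ib; simpl; ring. }
  assert (W2 : e (l * INR (S (S (2 * N)))) = (e l * e l * (e (l * (IZR a - 1)) * e (l * (IZR b - 1))))%C).
  { rewrite <- !epow_add. f_equal. rewrite !S_INR, mult_INR, Ia, Ib; simpl; ring. }
  replace (e (l * (2 * INR N + 1))) with (e (l * INR (S (2 * N))))
    by (f_equal; rewrite S_INR, mult_INR; simpl; ring).
  rewrite W1, W2, X, Y. ring.
Qed.

Lemma cc_0 l n : cc l 0 n = if (n =? 0)%Z then RtoC 1 else RtoC 0.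
Proof.
  unfold cc, iq. destruct (Z.eqb_spec n 0) as [->|H].
  - simpl. unfold qf; simpl. field.
  - destruct (Z.ltb_spec (Z.of_nat 0 + n) 0), (Z.ltb_spec (Z.of_nat 0 - n) 0); try ring. lia.
Qed.

Lemma climit_inv u l : climit u l -> l <> RtoC 0 -> climit (fun n => / u n)%C (/ l)%C.
Proof.
  intros H Hl eps He. assert (Hp : 0 < Cmod l) by (apply Cmod_gt_0; auto).
  destruct (H (Rmin (Cmod l / 2) (eps * Cmod l * Cmod l / 2))) as (N & K).
  { apply Rmin_glb_lt; [lra|]. assert (0 < eps * Cmod l * Cmod l) by (repeat apply Rmult_lt_0_compat; auto). lra. }
  exists N; intros n Hn. specialize (K n Hn).
  assert (K1 := Rlt_le_trans _ _ _ K (Rmin_l _ _)). assert (K2 := Rlt_le_trans _ _ _ K (Rmin_r _ _)).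
  assert (X : Cmod l / 2 < Cmod (u n)).
  { assert (T := Cmod_triangle (u n) (- (u n - l))).
    replace (u n + - (u n - l))%C with l in T by ring. rewrite Cmod_opp in T. lra. }
  assert (Hu : u n <> RtoC 0) by (apply Cmod_gt_0; lra).
  replace (/ u n - / l)%C with (- ((u n - l) * / (u n * l)))%C by (field; auto).
  rewrite Cmod_opp, Cmod_mult, Cmod_inv, Cmod_mult by (apply Cmult_neq_0; auto).
  apply Rmult_lt_reg_r with (Cmod (u n) * Cmod l); [nra|].
  rewrite Rmult_assoc, Rinv_l by nra.
  assert (Cmod l / 2 * (eps * Cmod l) < Cmod (u n) * (eps * Cmod l)) by (apply Rmult_lt_compat_r; nra).
  nra.
Qed.

Lemma qf_inv_lim l : 0 < l -> climit (fun n => / qf l n)%C (/ qlim l)%C.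
Proof. intros Hl. apply climit_inv; apply qf_lim; auto. Qed.

Lemma iq_bound l : 0 < l -> exists M, 0 < M /\ forall m, Cmod (iq l m) <= M.
Proof.
  intros Hl. destruct (climit_bounded _ _ (qf_inv_lim l Hl)) as (M & HM & B).
  exists M; split; auto. intros m. unfold iq. destruct (m <? 0)%Z; [rewrite Cmod_0; lra|apply B].
Qed.

Lemma cc_lim l n : 0 < l -> climit (fun N => cc l N n) (/ qlim l)%C.
Proof.
  intros Hl. destruct (qf_lim l Hl) as (H1 & H2). assert (I := qf_inv_lim l Hl).
  assert (J : forall m : Z, climit (fun N => iq l (Z.of_nat N + m)) (/ qlim l)%C).
  { intros m eps He. destruct (I eps He) as (N & K). exists (N + Z.abs_nat m)%nat; intros k Hk.
    unfold iq. destruct (Z.ltb_spec (Z.of_nat k + m) 0); [lia|]. apply K. lia. }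
  replace (/ qlim l)%C with (qlim l * (/ qlim l * / qlim l))%C by (field; auto).
  apply climit_mult; [|apply climit_mult].
  - apply (climit_sub (qf l) _ (fun N => (2 * N)%nat)); auto. intros; lia.
  - apply J.
  - apply (J (- n)%Z).
Qed.

Lemma tsum_single {T} (F : T -> C) t0 : (forall t, t <> t0 -> F t = RtoC 0) -> tsum F = F t0.
Proof.
  intros H. apply hs_tsum. intros eps He. exists (t0 :: nil); intros L HL Hi.
  destruct (incl_split (t0 :: nil) L) as (L1 & HP & N1); auto.
  { constructor; [intros []|constructor]. }
  rewrite (lsum_perm _ _ _ HP). simpl. rewrite (lsum_0 F L1).
  - replace (F t0 + RtoC 0 - F t0)%C with (RtoC 0) by ring. rewrite Cmod_0; auto.
  - intros t Hin. apply H. intros ->.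
    assert (X := Permutation_NoDup HP HL). simpl in X. inversion X; auto.
Qed.

(** * The Jacobi triple product *)

Section JTP.
(** Setting for the series of s1^n q^(a n + b n^2) with s1 = 1 or s1 = -1; the sequence [s] is n ->
    s1^n over all integers. *)
Variables (a b : R) (s1 : C) (s : Z -> C).
Hypotheses (Hb : 0 < b) (Hs1 : (s1 * s1)%C = RtoC 1)
  (Hs0 : s 0%Z = RtoC 1) (Hs : forall n, s (n + 1)%Z = (s1 * s n)%C).

Definition jt (n : Z) : C := (s n * e (a * IZR n + b * IZR n ^ 2))%C.

Definition jp (k : nat) : C :=
  ((RtoC 1 + s1 * e (a + b * (2 * INR k + 1))) * (RtoC 1 + s1 * e (- a + b * (2 * INR k + 1))))%C.

Lemma Cmod_s1 : Cmod s1 = 1.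
Proof.
  assert (H := f_equal Cmod Hs1). rewrite Cmod_mult, Cmod_1 in H.
  assert (X := Cmod_ge_0 s1). nra.
Qed.

Lemma Cmod_s n : Cmod (s n) = 1.
Proof.
  assert (H : forall k : nat, Cmod (s (Z.of_nat k)) = 1 /\ Cmod (s (- Z.of_nat k)%Z) = 1).
  { induction k as [|k (I1 & I2)].
    - simpl. rewrite Hs0, Cmod_1; auto.
    - split.
      + rewrite Nat2Z.inj_succ. unfold Z.succ. rewrite Hs, Cmod_mult, Cmod_s1, I1. ring.
      + assert (Q := Hs (- Z.of_nat (S k))%Z).
        replace (- Z.of_nat (S k) + 1)%Z with (- Z.of_nat k)%Z in Q by lia.
        rewrite Q, Cmod_mult, Cmod_s1 in I2. lra. }
  destruct (Z_le_gt_dec 0 n) as [P|P].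
  - rewrite <- (Z2Nat.id n) by lia. apply H.
  - replace n with (- Z.of_nat (Z.to_nat (- n)))%Z by lia. apply H.
Qed.

Lemma asum_jt (c : Z -> C) M : (forall n, Cmod (c n) <= M) -> asum (fun n => c n * jt n)%C.
Proof.
  intros Hc.
  (* Completing the square bounds |jt n| by a Gaussian. *)
  set (K := exp (2 * PI * Im tau * (a ^ 2 / (2 * b)))).
  assert (A : asum (fun n => RtoC (Rmax 0 M * K) * epow (b / 2 * IZR n ^ 2) tau)%C).
  { apply (asum_gauss _ _ (b / 2)); auto; try lra.
    apply (pgrow_bound _ _ (Cmod (RtoC (Rmax 0 M * K)))); intros; lra. }
  eapply asum_dom; [|exact A]. intros n. unfold jt.
  rewrite !Cmod_mult, Cmod_s, Cmod_R, Rmult_1_l, !Cmod_epow.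
  assert (K0 : 0 < K) by apply exp_pos. assert (M0 := Rmax_l 0 M). assert (M1 := Rmax_r 0 M).
  rewrite Rabs_pos_eq by nra. rewrite (Rmult_assoc (Rmax 0 M) K).
  apply Rmult_le_compat; [apply Cmod_ge_0|left; apply exp_pos|eapply Rle_trans; [apply Hc|auto]|].
  unfold K. rewrite <- exp_plus.
  set (x := IZR n). assert (P : 0 < 2 * PI * Im tau) by (assert (X := PI_RGT_0); nra).
  assert (Q : 0 <= b / 2 * (x + a / b) ^ 2) by (apply Rmult_le_pos; [lra|apply pow2_ge_0]).
  replace (b / 2 * (x + a / b) ^ 2) with (b / 2 * x ^ 2 + a * x + a ^ 2 / (2 * b)) in Q by (field; lra).
  assert (R : - (2 * PI * (a * x + b * x ^ 2) * Im tau) <=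
    2 * PI * Im tau * (a ^ 2 / (2 * b)) + - (2 * PI * (b / 2 * x ^ 2) * Im tau)).
  { assert (Z := Rmult_le_pos _ _ (Rlt_le _ _ P) Q). lra. }
  destruct R as [R|R]; [left; apply exp_increasing; auto|right; f_equal; auto].
Qed.

Lemma asum_cc N : asum (fun n => cc (2 * b) N n * jt n)%C.
Proof.
  destruct (iq_bound (2 * b)) as (M & HM & B); [lra|].
  apply (asum_jt _ (Cmod (qf (2 * b) (2 * N)) * (M * M))). intros n.
  unfold cc. rewrite !Cmod_mult. apply Rmult_le_compat_l; [apply Cmod_ge_0|].
  apply Rmult_le_compat; auto; apply Cmod_ge_0.
Qed.

Lemma jt_next n : jt (n + 1) = (s1 * e (a + b * (2 * IZR n + 1)) * jt n)%C.
Proof.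
  unfold jt. rewrite Hs, plus_IZR.
  transitivity (s1 * s n * (e (a + b * (2 * IZR n + 1)) * e (a * IZR n + b * IZR n ^ 2)))%C; [|ring].
  rewrite <- epow_add. f_equal. f_equal. ring.
Qed.

Lemma finite_jtp N : cprod jp N = tsum (fun n => cc (2 * b) N n * jt n)%C.
Proof.
  induction N as [|N IH].
  - rewrite (tsum_single _ 0%Z).
    + rewrite cc_0. unfold jt. simpl (cprod jp 0). rewrite Hs0.
      replace (a * 0 + b * 0 ^ 2) with 0 by ring. rewrite epow_0. simpl. ring.
    + intros t H. rewrite cc_0. destruct (Z.eqb_spec t 0); [easy|ring].
  - cbn [cprod]. rewrite IH.
    set (c := fun n => cc (2 * b) N n).
    assert (Hbb : exists M, forall n, Cmod (c n) <= M).
    { destruct (iq_bound (2 * b)) as (M & HM & B); [lra|].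
      exists (Cmod (qf (2 * b) (2 * N)) * (M * M)). intros n.
      unfold c, cc. rewrite !Cmod_mult. apply Rmult_le_compat_l; [apply Cmod_ge_0|].
      apply Rmult_le_compat; auto; apply Cmod_ge_0. }
    destruct Hbb as (Mc & Hc).
    set (F0 := fun n => (c n * jt n)%C).
    (* [F1] and [F2] are the contributions of the two neighbours n - 1 and n + 1 in [cc_step]. A
       shift of the index turns each into a constant multiple of [F0], the constants being the two
       new terms of [jp]. *)
    set (F1 := fun n => (c (n - 1)%Z * e (2 * b * (INR N + 1 - IZR n)) * jt n)%C).
    set (F2 := fun n => (c (n + 1)%Z * e (2 * b * (INR N + 1 + IZR n)) * jt n)%C).
    assert (A0 : asum F0) by apply asum_cc.
    assert (G1 : forall n, F1 (n + 1)%Z = (s1 * e (a + b * (2 * INR N + 1)) * F0 n)%C).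
    { intros n. unfold F1, F0. rewrite jt_next, plus_IZR.
      replace (n + 1 - 1)%Z with n by ring.
      transitivity (s1 * c n * (e (2 * b * (INR N + 1 - (IZR n + 1))) * e (a + b * (2 * IZR n + 1))) * jt n)%C; [ring|].
      rewrite <- epow_add.
      replace (2 * b * (INR N + 1 - (IZR n + 1)) + (a + b * (2 * IZR n + 1))) with (a + b * (2 * INR N + 1)) by ring.
      ring. }
    assert (G2 : forall n, F2 (n - 1)%Z = (s1 * e (- a + b * (2 * INR N + 1)) * F0 n)%C).
    { intros n. unfold F2, F0. assert (J := jt_next (n - 1)).
      replace (n - 1 + 1)%Z with n in * by ring. rewrite J, !minus_IZR.
      transitivity (c n * e (2 * b * (INR N + 1 + (IZR n - 1))) * jt (n - 1))%C; [ring|].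
      transitivity ((s1 * s1) * c n * (e (- a + b * (2 * INR N + 1)) * e (a + b * (2 * (IZR n - 1) + 1))) * jt (n - 1))%C; [|ring].
      rewrite Hs1, <- epow_add, Cmult_1_l. f_equal. f_equal. f_equal. ring. }
    assert (A1 : asum F1).
    { apply (asum_ext (fun n => F1 (n - 1 + 1)%Z)); [intros; f_equal; ring|].
      apply (asum_inj (fun n => (n - 1)%Z) (fun n => F1 (n + 1)%Z)); [intros; lia|].
      eapply asum_ext; [intros; symmetry; apply G1|]. apply asum_scal; auto. }
    assert (A2 : asum F2).
    { apply (asum_ext (fun n => F2 (n + 1 - 1)%Z)); [intros; f_equal; ring|].
      apply (asum_inj (fun n => (n + 1)%Z) (fun n => F2 (n - 1)%Z)); [intros; lia|].
      eapply asum_ext; [intros; symmetry; apply G2|]. apply asum_scal; auto. }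
    assert (S1 : tsum F1 = (s1 * e (a + b * (2 * INR N + 1)) * tsum F0)%C).
    { rewrite <- (tsum_bij (fun n => (n + 1)%Z) (fun n => (n - 1)%Z) F1); auto; try (intros; lia).
      rewrite <- tsum_scal by auto. apply tsum_ext, G1. }
    assert (S2 : tsum F2 = (s1 * e (- a + b * (2 * INR N + 1)) * tsum F0)%C).
    { rewrite <- (tsum_bij (fun n => (n - 1)%Z) (fun n => (n + 1)%Z) F2); auto; try (intros; lia).
      rewrite <- tsum_scal by auto. apply tsum_ext, G2. }
    set (u := e (2 * b * (2 * INR N + 1))).
    transitivity (tsum (fun n => (RtoC 1 + u) * F0 n + (F1 n + F2 n))%C).
    + rewrite !tsum_plus, tsum_scal, S1, S2; auto using asum_scal, asum_plus.
      unfold jp. fold F0.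
      assert (U : u = (s1 * s1 * (e (a + b * (2 * INR N + 1)) * e (- a + b * (2 * INR N + 1))))%C).
      { rewrite Hs1, <- epow_add, Cmult_1_l. unfold u; f_equal; ring. }
      rewrite U. ring.
    + apply tsum_ext; intros n. unfold F0, F1, F2, c. rewrite cc_step by lra. unfold u. ring.
Qed.

(** The limit N -> oo of [finite_jtp], where the Gaussian binomials tend to the reciprocal of [qlim]
    and stay bounded. The value of the product is a hypothesis so that each application can supply
    its own quotient of [qlim]. *)
Lemma jtp l : climit (cprod jp) l -> tsum jt = (qlim (2 * b) * l)%C.
Proof.
  intros Hl. assert (H2b : 0 < 2 * b) by lra.
  destruct (qf_lim (2 * b) H2b) as (Q1 & Q2).
  destruct (iq_bound (2 * b) H2b) as (M & HM & B).
  destruct (climit_bounded _ _ Q1) as (M' & HM' & B').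
  set (K := M' * (M * M)).
  assert (A : asum (fun n => RtoC K * jt n)%C).
  { apply (asum_jt (fun _ => RtoC K) (Cmod (RtoC K))); intros; lra. }
  assert (Aj : asum jt).
  { apply (asum_ext (fun n => RtoC 1 * jt n)%C); [intros; ring|].
    apply (asum_jt (fun _ => RtoC 1) (Cmod (RtoC 1))); intros; lra. }
  destruct A as (MA & HA).
  assert (T : climit (fun N => tsum (fun n => cc (2 * b) N n * jt n)%C)
     (tsum (fun n => / qlim (2 * b) * jt n)%C)).
  { apply (tannery _ _ (fun n => Cmod (RtoC K * jt n)) MA); auto.
    - intros N n. rewrite !Cmod_mult. apply Rmult_le_compat_r; [apply Cmod_ge_0|].
      rewrite Cmod_R, Rabs_pos_eq by (unfold K; nra).
      unfold cc. rewrite !Cmod_mult. unfold K.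
      apply Rmult_le_compat; auto; try apply Cmod_ge_0.
      + apply Rmult_le_pos; apply Cmod_ge_0.
      + apply Rmult_le_compat; auto; apply Cmod_ge_0.
    - intros n. apply climit_mult; [apply cc_lim; auto|apply climit_const]. }
  rewrite tsum_scal in T by auto.
  assert (E : l = (/ qlim (2 * b) * tsum jt)%C).
  { apply (climit_unique (cprod jp)); auto.
    eapply climit_ext; [|exact T]. intros N; symmetry; apply finite_jtp. }
  rewrite E. field; auto.
Qed.

End JTP.
End Products.

(** * Product formulas for the theta constants *)

(** Coefficients of theta3 when the exponents are written as n^2/8: theta3 and theta4 live on even n
    with [chev] and [chie], and theta2 on odd n with [chi4]. *)
Definition chev (n : Z) : Z := if Z.even n then 1%Z else 0%Z.
Lemma chev_b : bounded1 chev.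
Proof. intros n; unfold chev; destruct (Z.even n); lia. Qed.
#[local] Hint Resolve chev_b : chars.
Lemma chev_48 n k : chev (n + 48 * k) = chev n.
Proof. unfold chev. rewrite Z.even_add, Z.even_mul. destruct (Z.even n); easy. Qed.
#[local] Hint Resolve chev_b chi8_b chi12_8_b : chars.

Lemma Mom0_eq c l tau :
  Mom c l 0 tau = tsum (fun n => zC (c n) * epow (l * IZR n ^ 2) tau)%C.
Proof. unfold Mom. apply tsum_ext; intros n. simpl ((_ ^ 0)). ring. Qed.

Lemma asum_Mom0 c l tau : bounded1 c -> 0 < l -> 0 < Im tau ->
  asum (fun n => zC (c n) * epow (l * IZR n ^ 2) tau)%C.
Proof.
  intros Hc Hl Ht. apply (asum_gauss _ _ l); auto. apply pgrow_bounded1, Hc.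
Qed.

(* Restriction to the arithmetic progression u n + r on which the sum is supported. *)
Lemma Mom0_prog c l tau (u r : Z) : bounded1 c -> 0 < l -> 0 < Im tau -> u <> 0%Z ->
  (forall m, (forall n, u * n + r <> m)%Z -> c m = 0%Z) ->
  Mom c l 0 tau = tsum (fun n => zC (c (u * n + r)%Z) * epow (l * IZR (u * n + r) ^ 2) tau)%C.
Proof.
  intros Hc Hl Ht Hu H0. rewrite Mom0_eq.
  symmetry. apply (tsum_inj (fun n => u * n + r)%Z (fun n => zC (c n) * epow (l * IZR n ^ 2) tau)%C).
  - intros x y H. assert (u * x = u * y)%Z by lia. apply Z.mul_reg_l in H1; auto.
  - intros m H. rewrite (H0 m H). unfold zC; ring.
  - apply asum_Mom0; auto.
Qed.

Lemma pm_succ n : zC (pm (n + 1)) = (RtoC (-1) * zC (pm n))%C.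
Proof.
  unfold pm. rewrite Z.even_add. change (Z.even 1) with false.
  destruct (Z.even n); simpl; unfold zC; ring.
Qed.

Lemma periodic_zero (c : Z -> Z) u r : (u <> 0)%Z -> (48 mod u = 0)%Z ->
  (forall n k, c (n + 48 * k) = c n)%Z ->
  forallb (fun n => (c n =? 0)%Z || ((n - r) mod u =? 0)%Z)%bool res48 = true ->
  forall m, (forall n, u * n + r <> m)%Z -> c m = 0%Z.
Proof.
  intros Hu H48 Hp H m Hm.
  rewrite (periodic_mod c Hp). rewrite forallb_forall in H. assert (I := res48_mod m).
  specialize (H _ I). apply Bool.orb_true_iff in H. destruct H as [H|H]; [lia|].
  exfalso. apply Z.eqb_eq in H. apply Z.mod_divide in H; auto. apply Z.mod_divide in H48; auto.
  destruct H as (x & Hx), H48 as (y & Hy).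
  apply (Hm (x + y * (m / 48))%Z). assert (X := Z.div_mod m 48 ltac:(lia)).
  replace (u * (x + y * (m / 48)) + r)%Z with (x * u + (y * u) * (m / 48) + r)%Z by ring.
  rewrite <- Hx, <- Hy. lia.
Qed.

Section Eval.
Variable tau : C.
Hypothesis Ht : 0 < Im tau.
Notation e x := (epow x tau).
Notation qft := (qf tau).
Notation qlt := (qlim tau).

Lemma qf_odd_split b N :
  (cprod (fun k => RtoC 1 - e (b * (2 * INR k + 1)))%C N * qft (2 * b) N)%C = qft b (2 * N).
Proof.
  induction N as [|N IH]; [unfold qf; simpl; ring|].
  replace (2 * S N)%nat with (S (S (2 * N))) by lia.
  unfold qf in *. cbn [cprod]. rewrite <- IH.
  replace (b * INR (S (2 * N))) with (b * (2 * INR N + 1)) by (rewrite S_INR, mult_INR; simpl; ring).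
  replace (b * INR (S (S (2 * N)))) with (2 * b * INR (S N)) by (rewrite !S_INR, mult_INR; simpl; ring).
  ring.
Qed.

Lemma cprod_sub_odd_lim b : 0 < b ->
  climit (cprod (fun k => RtoC 1 - e (b * (2 * INR k + 1)))%C) (qlt b * / qlt (2 * b))%C.
Proof.
  intros Hb.
  eapply climit_ext; [|apply climit_mult;
    [apply (climit_sub _ _ (fun N => (2 * N)%nat) ltac:(intros; lia) (proj1 (qf_lim tau Ht b Hb)))
    |apply (qf_inv_lim tau Ht (2 * b)); lra]].
  intros N; cbn beta. rewrite <- qf_odd_split. field. apply qf_nz; auto; lra.
Qed.

(** By (1 + x) (1 - x) = 1 - x^2 the product with plus signs is a quotient of two products with
    minus signs, each of which [qf_odd_split] expresses through [qf]. *)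
Lemma cprod_add_odd_lim b : 0 < b ->
  climit (cprod (fun k => RtoC 1 + e (b * (2 * INR k + 1)))%C)
    (qlt (2 * b) * qlt (2 * b) * / (qlt (4 * b) * qlt b))%C.
Proof.
  intros Hb. destruct (qf_lim tau Ht b Hb) as (L1 & N1).
  destruct (qf_lim tau Ht (2 * b) ltac:(lra)) as (L2 & N2).
  destruct (qf_lim tau Ht (4 * b) ltac:(lra)) as (L4 & N4).
  replace (qlt (2 * b) * qlt (2 * b) * / (qlt (4 * b) * qlt b))%C with
    ((qlt (2 * b) * / qlt (4 * b)) * (qlt (2 * b) * / qlt b))%C by (field; auto).
  eapply climit_ext; [|apply climit_mult; [apply climit_mult|apply climit_mult]].
  2: { apply (climit_sub _ _ (fun N => (2 * N)%nat) ltac:(intros; lia) L2). }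
  2: { apply (qf_inv_lim tau Ht (4 * b)); lra. }
  2: { apply L2. }
  2: { apply (climit_sub _ _ (fun N => (2 * N)%nat) ltac:(intros; lia) (qf_inv_lim tau Ht b Hb)). }
  intros N; cbn beta.
  assert (E1 := qf_odd_split b N). assert (E2 := qf_odd_split (2 * b) N).
  replace (2 * (2 * b)) with (4 * b) in E2 by ring.
  assert (E3 : (cprod (fun k => RtoC 1 + e (b * (2 * INR k + 1)))%C N *
     cprod (fun k => RtoC 1 - e (b * (2 * INR k + 1)))%C N)%C =
     cprod (fun k => RtoC 1 - e (2 * b * (2 * INR k + 1)))%C N).
  { rewrite <- cprod_mult. apply cprod_ext; intros k _.
    replace (2 * b * (2 * INR k + 1)) with (b * (2 * INR k + 1) + b * (2 * INR k + 1)) by ring.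
    rewrite epow_add. ring. }
  rewrite <- E2, <- E3, <- E1.
  assert (Z1 : qft (2 * b) N <> RtoC 0) by (apply qf_nz; auto; lra).
  assert (Z2 : qft (4 * b) N <> RtoC 0) by (apply qf_nz; auto; lra).
  assert (Z3 : cprod (fun k => RtoC 1 - e (b * (2 * INR k + 1)))%C N <> RtoC 0).
  { apply cprod_nz; intros k. apply one_minus_e_nz; auto.
    apply Rmult_lt_0_compat; auto. assert (X := pos_INR k); lra. }
  field. auto.
Qed.

Lemma Mom_chie_prod b : 0 < b -> Mom chie (b / 4) 0 tau = (qlt b * qlt b / qlt (2 * b))%C.
Proof.
  intros Hb. rewrite (Mom0_prog _ _ _ 2 0); auto with chars; try lra; try lia.
  2: { apply periodic_zero; [lia|easy|exact chie_48|vm_compute; easy]. }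
  destruct (qf_lim tau Ht (2 * b) ltac:(lra)) as (L2 & N2).
  transitivity (tsum (jt tau 0 b (fun n => zC (pm n)))).
  - apply tsum_ext; intros n. unfold jt.
    assert (X : chie (2 * n + 0) = pm n).
    { revert n; apply (periodic_eq (fun n => chie (2 * n + 0)) pm); [|exact pm_48|vm_compute; easy].
      intros n k. replace (2 * (n + 48 * k) + 0)%Z with (2 * n + 0 + 48 * (2 * k))%Z by ring.
      apply chie_48. }
    rewrite X. f_equal. f_equal. rewrite plus_IZR, mult_IZR. field.
  - assert (L := cprod_sub_odd_lim b Hb).
    rewrite (jtp tau Ht 0 b (RtoC (-1)) (fun n => zC (pm n)) Hb) with
      (l := ((qlt b * / qlt (2 * b)) * (qlt b * / qlt (2 * b)))%C).
    + field; auto.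
    + rewrite <- RtoC_mult; f_equal; ring.
    + easy.
    + apply pm_succ.
    + eapply climit_ext; [|apply (climit_mult _ _ _ _ L L)].
      intros N; simpl. rewrite <- cprod_mult. apply cprod_ext; intros k _. unfold jp.
      rewrite Ropp_0, !Rplus_0_l. ring.
Qed.

Lemma Mom_chev_prod b : 0 < b -> Mom chev (b / 4) 0 tau =
  (qlt (2 * b) * ((qlt (2 * b) * qlt (2 * b) / (qlt (4 * b) * qlt b)) *
     (qlt (2 * b) * qlt (2 * b) / (qlt (4 * b) * qlt b))))%C.
Proof.
  intros Hb. rewrite (Mom0_prog _ _ _ 2 0); auto with chars; try lra; try lia.
  2: { apply periodic_zero; [lia|easy|exact chev_48|vm_compute; easy]. }
  transitivity (tsum (jt tau 0 b (fun n => RtoC 1))).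
  - apply tsum_ext; intros n. unfold jt, chev.
    rewrite Z.even_add, Z.even_mul. cbn [Z.even orb Bool.eqb].
    unfold zC at 1. f_equal. f_equal. rewrite plus_IZR, mult_IZR. field.
  - assert (L := cprod_add_odd_lim b Hb).
    apply (jtp tau Ht 0 b (RtoC 1) (fun n => RtoC 1) Hb); try (intros; ring).
    eapply climit_ext; [|apply (climit_mult _ _ _ _ L L)].
    intros N; simpl. rewrite <- cprod_mult. apply cprod_ext; intros k _. unfold jp.
    rewrite Ropp_0, !Rplus_0_l. ring.
Qed.

Lemma Mom_chi4_prod b : 0 < b -> Mom chi4 (b / 4) 0 tau =
  (RtoC 2 * e (b / 4) * (qlt (4 * b) * qlt (4 * b) / qlt (2 * b)))%C.
Proof.
  intros Hb. rewrite (Mom0_prog _ _ _ 2 1); auto with chars; try lra; try lia.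
  2: { apply periodic_zero; [lia|easy|exact chi4_48|vm_compute; easy]. }
  destruct (qf_lim tau Ht (2 * b) ltac:(lra)) as (L2 & N2).
  destruct (qf_lim tau Ht (4 * b) ltac:(lra)) as (L4 & N4).
  set (J := jt tau b b (fun n => RtoC 1)).
  assert (EJ : tsum J = (RtoC 2 * (qlt (4 * b) * qlt (4 * b) / qlt (2 * b)))%C).
  { set (G' := cprod (fun k => RtoC 1 + e (2 * b * INR (S k)))%C).
    assert (EG : forall N, (G' N * qft (2 * b) N)%C = qft (4 * b) N).
    { intros N. unfold G', qf. rewrite <- cprod_mult. apply cprod_ext; intros k _.
      replace (4 * b * INR (S k)) with (2 * b * INR (S k) + 2 * b * INR (S k)) by ring.
      rewrite epow_add. ring. }
    assert (LG : climit G' (qlt (4 * b) * / qlt (2 * b))%C).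
    { eapply climit_ext; [|apply climit_mult; [apply L4|apply (qf_inv_lim tau Ht (2 * b)); lra]].
      intros N; simpl. rewrite <- EG. field. apply qf_nz; auto; lra. }
    unfold J. rewrite (jtp tau Ht b b (RtoC 1) (fun n => RtoC 1) Hb) with
      (l := ((RtoC 2 * (qlt (4 * b) * / qlt (2 * b))) * (qlt (4 * b) * / qlt (2 * b)))%C);
      try (intros; ring).
    - field; auto.
    (* For a = b the second factors of [jp] begin with 1 + q^0 = 2. Once this is split off, their
       product lags one index behind that of the first factors, hence the passage to [S N]. *)
    - apply climit_shift.
      eapply climit_ext; [|apply climit_mult; [apply climit_mult; [apply climit_const|apply LG]
         |apply (climit_sub _ _ S ltac:(intros; lia) LG)]].
      intros N; cbn beta.
      transitivity (cprod (fun k => RtoC 1 + e (2 * b * INR k))%C (S N) * G' (S N))%C.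
      + cbn [cprod]. rewrite (cprod_shift (fun k => RtoC 1 + e (2 * b * INR k))%C).
        unfold G'. change (INR 0) with 0. rewrite Rmult_0_r, epow_0. cbn [cprod]. ring.
      + unfold G'. rewrite <- cprod_mult. apply cprod_ext; intros k _. unfold jp.
        replace (b + b * (2 * INR k + 1)) with (2 * b * INR (S k)) by (rewrite S_INR; ring).
        replace (- b + b * (2 * INR k + 1)) with (2 * b * INR k) by ring. ring. }
  replace (RtoC 2 * e (b / 4) * (qlt (4 * b) * qlt (4 * b) / qlt (2 * b)))%C with
    (e (b / 4) * tsum J)%C by (rewrite EJ; ring).
  rewrite <- tsum_scal.
  2: { apply (asum_ext (fun n => RtoC 1 * J n)%C); [intros; ring|].
       apply (asum_jt tau Ht b b (RtoC 1) (fun _ => RtoC 1) Hb) with (M := 1); try (intros; ring).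
       intros; rewrite Cmod_1; lra. }
  apply tsum_ext; intros n. unfold J, jt, chi4.
  rewrite Z.even_add, Z.even_mul. cbn [Z.even orb Bool.eqb].
  transitivity (e (b / 4) * e (b * IZR n + b * IZR n ^ 2))%C; [|ring].
  rewrite <- epow_add. unfold zC. rewrite Cmult_1_l. f_equal.
  rewrite plus_IZR, mult_IZR. field.
Qed.

(** The support of [chi12] is split into the progressions 6n + 1 and -6n - 1. Both carry the sign
    (-1)^n and the same exponents, which accounts for the factor 2 in [Mom_chi12_prod]. *)
Definition chi12p (n : Z) : Z := (chi12 n * b2Z (n mod 6 =? 1))%Z.
Definition chi12n (n : Z) : Z := (chi12 n * b2Z (n mod 6 =? 5))%Z.

Lemma chi12p_b : bounded1 chi12p.
Proof. apply (bounded1_mult chi12); [apply chi12_b|intros n; apply b2Z_b]. Qed.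
Lemma chi12n_b : bounded1 chi12n.
Proof. apply (bounded1_mult chi12); [apply chi12_b|intros n; apply b2Z_b]. Qed.
Lemma chi12p_48 n k : chi12p (n + 48 * k) = chi12p n.
Proof.
  unfold chi12p. rewrite chi12_48. replace (n + 48 * k)%Z with (n + (8 * k) * 6)%Z by ring.
  rewrite Z_mod_plus_full; easy.
Qed.
Lemma chi12n_48 n k : chi12n (n + 48 * k) = chi12n n.
Proof.
  unfold chi12n. rewrite chi12_48. replace (n + 48 * k)%Z with (n + (8 * k) * 6)%Z by ring.
  rewrite Z_mod_plus_full; easy.
Qed.

(* Euler's pentagonal number theorem. *)
Lemma Mom_chi12_prod l : 0 < l -> Mom chi12 l 0 tau = (RtoC 2 * e l * qlt (24 * l))%C.
Proof.
  intros Hl.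
  transitivity (Mom chi12p l 0 tau + Mom chi12n l 0 tau)%C.
  { rewrite !Mom0_eq, <- tsum_plus by (apply asum_Mom0; auto using chi12p_b, chi12n_b).
    apply tsum_ext; intros n.
    assert (X : chi12 n = (chi12p n + chi12n n)%Z).
    { revert n; apply (periodic_eq chi12 (fun n => (chi12p n + chi12n n)%Z));
        [exact chi12_48| |vm_compute; easy].
      intros; rewrite chi12p_48, chi12n_48; easy. }
    rewrite X, zC_plus. ring. }
  set (J := jt tau (12 * l) (36 * l) (fun n => zC (pm n))).
  assert (H36 : 0 < 36 * l) by lra.
  assert (M1 : (RtoC (-1) * RtoC (-1))%C = RtoC 1) by (rewrite <- RtoC_mult; f_equal; ring).
  assert (AJ : asum J).
  { apply (asum_ext (fun n => RtoC 1 * J n)%C); [intros; ring|].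
    apply (asum_jt tau Ht (12 * l) (36 * l) (RtoC (-1)) (fun n => zC (pm n)) H36) with (M := 1); auto.
    - apply pm_succ.
    - intros; rewrite Cmod_1; lra. }
  destruct (qf_lim tau Ht (72 * l) ltac:(lra)) as (L72 & N72).
  destruct (qf_lim tau Ht (24 * l) ltac:(lra)) as (L24 & N24).
  assert (EJ : tsum J = qlt (24 * l)).
  { unfold J.
    rewrite (jtp tau Ht (12 * l) (36 * l) (RtoC (-1)) (fun n => zC (pm n)) H36) with
      (l := (qlt (24 * l) * / qlt (72 * l))%C); auto using pm_succ.
    - replace (2 * (36 * l)) with (72 * l) by ring. field; auto.
    - eapply climit_ext; [|apply climit_mult;
       [apply (climit_sub _ _ (fun N => (3 * N)%nat) ltac:(intros; lia) L24)
       |apply (qf_inv_lim tau Ht (72 * l)); lra]].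
      intros N; cbn beta.
      (* The two factors of [jp] supply the exponents congruent to 2 and 1 modulo 3, and
         [qft (72 * l)] supplies the multiples of 3. *)
      assert (E : (cprod (jp tau (12 * l) (36 * l) (RtoC (-1))) N * qft (72 * l) N)%C = qft (24 * l) (3 * N)).
      { induction N as [|N IH]; [unfold qf; simpl; ring|].
        replace (3 * S N)%nat with (S (S (S (3 * N)))) by lia.
        unfold qf in *. cbn [cprod]. rewrite <- IH. unfold jp.
        replace (12 * l + 36 * l * (2 * INR N + 1)) with (24 * l * INR (S (S (3 * N))))
          by (rewrite !S_INR, mult_INR; simpl; ring).
        replace (- (12 * l) + 36 * l * (2 * INR N + 1)) with (24 * l * INR (S (3 * N)))
          by (rewrite !S_INR, mult_INR; simpl; ring).
        replace (72 * l * INR (S N)) with (24 * l * INR (S (S (S (3 * N)))))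
          by (rewrite !S_INR, mult_INR; simpl; ring).
        ring. }
      rewrite <- E. field. apply qf_nz; auto; lra. }
  assert (Ep : Mom chi12p l 0 tau = (e l * tsum J)%C).
  { rewrite (Mom0_prog _ _ _ 6 1); auto using chi12p_b; try lra; try lia.
    2: { apply periodic_zero; [lia|easy|exact chi12p_48|vm_compute; easy]. }
    rewrite <- tsum_scal by auto. apply tsum_ext; intros n. unfold J, jt.
    assert (X : chi12p (6 * n + 1) = pm n).
    { revert n; apply (periodic_eq (fun n => chi12p (6 * n + 1)) pm); [|exact pm_48|vm_compute; easy].
      intros n k. replace (6 * (n + 48 * k) + 1)%Z with (6 * n + 1 + 48 * (6 * k))%Z by ring.
      apply chi12p_48. }
    rewrite X. transitivity (zC (pm n) * (e l * e (12 * l * IZR n + 36 * l * IZR n ^ 2)))%C; [|ring].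
    rewrite <- epow_add. f_equal. f_equal. rewrite plus_IZR, mult_IZR. ring. }
  assert (En : Mom chi12n l 0 tau = (e l * tsum J)%C).
  { rewrite (Mom0_prog _ _ _ (-6) (-1)); auto using chi12n_b; try lra; try lia.
    2: { apply periodic_zero; [lia|easy|exact chi12n_48|vm_compute; easy]. }
    rewrite <- tsum_scal by auto. apply tsum_ext; intros n. unfold J, jt.
    assert (X : chi12n (-6 * n + -1) = pm n).
    { revert n; apply (periodic_eq (fun n => chi12n (-6 * n + -1)) pm); [|exact pm_48|vm_compute; easy].
      intros n k. replace (-6 * (n + 48 * k) + -1)%Z with (-6 * n + -1 + 48 * (-6 * k))%Z by ring.
      apply chi12n_48. }
    rewrite X. transitivity (zC (pm n) * (e l * e (12 * l * IZR n + 36 * l * IZR n ^ 2)))%C; [|ring].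
    rewrite <- epow_add. f_equal. f_equal. rewrite plus_IZR, mult_IZR. ring. }
  rewrite Ep, En, EJ. ring.
Qed.

Lemma eta_qlim : eta tau = (e (1 / 24) * qlt 1)%C.
Proof.
  unfold eta. f_equal. unfold Cprod_inf. apply Clim_seq_climit.
  eapply climit_ext; [|apply (qf_lim tau Ht 1 Rlt_0_1)].
  intros N. unfold qf.
  assert (G : forall (f : nat -> C) a n, fold_right (fun n acc => (f n * acc)%C) (RtoC 1) (seq a n) =
    cprod (fun k => f (a + k)%nat) n).
  { intros f a n; revert a; induction n as [|n IH]; intros a; [easy|].
    etransitivity; [|symmetry; exact (cprod_shift (fun k => f (a + k)%nat) n)].
    cbn [seq fold_right]. rewrite IH, Nat.add_0_r. f_equal.
    apply cprod_ext; intros; f_equal; lia. }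
  rewrite (G (fun n => RtoC 1 - e (INR n))%C). apply cprod_ext; intros k _.
  rewrite Rmult_1_l. easy.
Qed.

Lemma qlim_nz l : 0 < l -> qlt l <> RtoC 0.
Proof. intros H; apply qf_lim; auto. Qed.

Lemma eta_nz : eta tau <> RtoC 0.
Proof. rewrite eta_qlim. apply Cmult_neq_0; [apply epow_nz|apply qlim_nz; lra]. Qed.

Lemma Mom_chi12_eta : Mom chi12 (/ 24) 0 tau = (RtoC 2 * eta tau)%C.
Proof.
  rewrite Mom_chi12_prod, eta_qlim by lra.
  replace (24 * / 24) with 1 by field. replace (1 / 24) with (/ 24) by field. ring.
Qed.

Lemma eta_double_prod :
  (Mom chi12 (1 / 12) 0 tau * Mom chie (3 / 12) 0 tau)%C = (RtoC 2 * (eta tau * eta tau))%C.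
Proof.
  replace (3 / 12) with (1 / 4) by field.
  rewrite Mom_chi12_prod, Mom_chie_prod, eta_qlim by lra.
  replace (24 * (1 / 12)) with 2 by field. replace (2 * 1) with 2 by ring.
  replace (1 / 12) with (1 / 24 + 1 / 24) by field. rewrite epow_add.
  field. apply qlim_nz; lra.
Qed.

Lemma eta_half_prod :
  (Mom chi12 (1 / 48) 0 tau * Mom chi4 (3 / 48) 0 tau)%C = (RtoC 4 * (eta tau * eta tau))%C.
Proof.
  replace (3 / 48) with ((1 / 4) / 4) by field.
  rewrite Mom_chi12_prod, Mom_chi4_prod, eta_qlim by lra.
  replace (24 * (1 / 48)) with (1 / 2) by field. replace (2 * (1 / 4)) with (1 / 2) by field.
  replace (4 * (1 / 4)) with 1 by field.
  assert (X : (e (1 / 48) * e (1 / 4 / 4))%C = (e (1 / 24) * e (1 / 24))%C)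
    by (rewrite <- !epow_add; f_equal; field).
  transitivity (RtoC 4 * (e (1 / 48) * e (1 / 4 / 4)) * (qlt 1 * qlt 1))%C;
    [|rewrite X; ring].
  field. apply qlim_nz; lra.
Qed.

Lemma theta_prod_eta :
  (Mom chi4 (1 / 8) 0 tau * Mom chev (1 / 8) 0 tau * Mom chie (1 / 8) 0 tau)%C =
  (RtoC 2 * (eta tau * eta tau * eta tau))%C.
Proof.
  replace (1 / 8) with ((1 / 2) / 4) by field.
  rewrite Mom_chi4_prod, Mom_chev_prod, Mom_chie_prod, eta_qlim by lra.
  replace (2 * (1 / 2)) with 1 by field. replace (4 * (1 / 2)) with 2 by field.
  assert (X : e (1 / 2 / 4) = (e (1 / 24) * e (1 / 24) * e (1 / 24))%C)
    by (rewrite <- !epow_add; f_equal; field).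
  rewrite X. field. repeat split; apply qlim_nz; lra.
Qed.

Lemma Mom0_nz : Mom chi12 (1 / 12) 0 tau <> RtoC 0 /\ Mom chie (3 / 12) 0 tau <> RtoC 0 /\
  Mom chi12 (1 / 48) 0 tau <> RtoC 0 /\ Mom chi4 (3 / 48) 0 tau <> RtoC 0 /\
  Mom chi4 (1 / 8) 0 tau <> RtoC 0 /\ Mom chev (1 / 8) 0 tau <> RtoC 0 /\
  Mom chie (1 / 8) 0 tau <> RtoC 0.
Proof.
  assert (E := eta_nz).
  assert (N : forall k x, 0 < k -> x <> RtoC 0 -> (RtoC k * x)%C <> RtoC 0).
  { intros k x Hk Hx. apply Cmult_neq_0; auto. intros X; apply RtoC_inj in X; lra. }
  assert (H1 : (Mom chi12 (1 / 12) 0 tau * Mom chie (3 / 12) 0 tau)%C <> RtoC 0)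
    by (rewrite eta_double_prod; apply N; [lra|apply Cmult_neq_0; auto]).
  assert (H2 : (Mom chi12 (1 / 48) 0 tau * Mom chi4 (3 / 48) 0 tau)%C <> RtoC 0)
    by (rewrite eta_half_prod; apply N; [lra|apply Cmult_neq_0; auto]).
  assert (H3 : (Mom chi4 (1 / 8) 0 tau * Mom chev (1 / 8) 0 tau * Mom chie (1 / 8) 0 tau)%C <> RtoC 0)
    by (rewrite theta_prod_eta; apply N; [lra|apply Cmult_neq_0; [apply Cmult_neq_0|]; auto]).
  assert (K : forall x y : C, (x * y)%C <> RtoC 0 -> x <> RtoC 0 /\ y <> RtoC 0)
    by (intros x y H; split; intros ->; apply H; ring).
  apply K in H1, H2, H3. destruct H3 as (H3 & H4). apply K in H3. tauto.
Qed.

End Eval.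

(** * Quadratic relations from rotating the lattice *)

Lemma chie_chev n : chie n = (chev n * chie n)%Z.
Proof.
  revert n; apply (periodic_eq chie (fun n => chev n * chie n)%Z);
    [exact chie_48| |vm_compute; easy].
  intros; rewrite chev_48, chie_48; easy.
Qed.

Lemma periodic2 (f g : Z -> Z -> Z) :
  (forall m n a b, f (m + 48 * a) (n + 48 * b) = f m n)%Z ->
  (forall m n a b, g (m + 48 * a) (n + 48 * b) = g m n)%Z ->
  forallb (fun m => forallb (fun n => (f m n - g m n =? 0)%Z) res48) res48 = true ->
  forall m n, f m n = g m n.
Proof.
  intros Hf Hg H m n. apply Zminus_eq. revert m n.
  apply (periodic_check (fun m n => f m n - g m n)%Z); auto.
  intros; rewrite Hf, Hg; easy.
Qed.

Ltac rot_periodic :=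
  intros;
  repeat match goal with
  | |- context [(?m + 48 * ?a + (?n + 48 * ?b))%Z] =>
      replace (m + 48 * a + (n + 48 * b))%Z with (m + n + 48 * (a + b))%Z by ring
  | |- context [(?m + 48 * ?a - (?n + 48 * ?b))%Z] =>
      replace (m + 48 * a - (n + 48 * b))%Z with (m - n + 48 * (a - b))%Z by ring
  end;
  rewrite ?chev_48, ?chie_48, ?chi4_48, ?chim4_48; reflexivity.

(** This and the four identities that follow are what the bilinear theta relations become on
    coefficients after the substitution m = r + s, n = r - s. *)
Lemma rot_chev_chev : forall r s,
  (chev (r + s) * chev (r - s) = chev r * chev s + chi4 r * chi4 s)%Z.
Proof. apply (periodic2 (fun r s => chev (r + s) * chev (r - s))%Z
  (fun r s => chev r * chev s + chi4 r * chi4 s)%Z); [rot_periodic|rot_periodic|vm_compute; reflexivity]. Qed.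

Lemma rot_chie_chie : forall r s,
  (chie (r + s) * chie (r - s) = chev r * chev s - chi4 r * chi4 s)%Z.
Proof. apply (periodic2 (fun r s => chie (r + s) * chie (r - s))%Z
  (fun r s => chev r * chev s - chi4 r * chi4 s)%Z); [rot_periodic|rot_periodic|vm_compute; reflexivity]. Qed.

Lemma rot_chi4_chi4 : forall r s,
  (chi4 (r + s) * chi4 (r - s) = chev r * chi4 s + chi4 r * chev s)%Z.
Proof. apply (periodic2 (fun r s => chi4 (r + s) * chi4 (r - s))%Z
  (fun r s => chev r * chi4 s + chi4 r * chev s)%Z); [rot_periodic|rot_periodic|vm_compute; reflexivity]. Qed.

Lemma rot_chev_chie : forall r s,
  (chev (r + s) * chie (r - s) = chie r * chie s + chim4 r * chim4 s)%Z.
Proof. apply (periodic2 (fun r s => chev (r + s) * chie (r - s))%Z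
  (fun r s => chie r * chie s + chim4 r * chim4 s)%Z); [rot_periodic|rot_periodic|vm_compute; reflexivity]. Qed.

Lemma rot_chim4_chi4 : forall r s,
  (chim4 (r + s) * chi4 (r - s) = chim4 r * chie s + chie r * chim4 s)%Z.
Proof. apply (periodic2 (fun r s => chim4 (r + s) * chi4 (r - s))%Z
  (fun r s => chim4 r * chie s + chie r * chim4 s)%Z); [rot_periodic|rot_periodic|vm_compute; reflexivity]. Qed.

Section Lattice.
Variable tau : C.
Hypothesis Ht : 0 < Im tau.
Notation e x := (epow x tau).

Definition gs (f : Z -> C) (l : R) : C := tsum (fun n => f n * e (l * IZR n ^ 2))%C.
Definition gsum (f : Z -> C) (l : R) : Prop := asum (fun n => f n * e (l * IZR n ^ 2))%C.
Definition gs2 (h : Z * Z -> C) (l : R) : C :=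
  tsum (fun p => h p * e (l * IZR (fst p) ^ 2 + l * IZR (snd p) ^ 2))%C.
Definition gsum2 (h : Z * Z -> C) (l : R) : Prop :=
  asum (fun p => h p * e (l * IZR (fst p) ^ 2 + l * IZR (snd p) ^ 2))%C.
Definition tens (f g : Z -> C) (p : Z * Z) : C := (f (fst p) * g (snd p))%C.

Lemma gsum2_tens f g l : gsum f l -> gsum g l -> gsum2 (tens f g) l.
Proof.
  intros Hf Hg. eapply asum_ext; [|apply (asum_prod _ _ Hf Hg)].
  intros p; unfold tens; cbn beta. rewrite epow_add. ring.
Qed.

Lemma gs2_tens f g l : gsum f l -> gsum g l -> gs2 (tens f g) l = (gs f l * gs g l)%C.
Proof.
  intros Hf Hg. unfold gs. rewrite <- (tsum_prod _ _ Hf Hg).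
  apply tsum_ext; intros p; unfold tens. rewrite epow_add. ring.
Qed.

Lemma gs2_plus h k l : gsum2 h l -> gsum2 k l ->
  gs2 (fun p => h p + k p)%C l = (gs2 h l + gs2 k l)%C.
Proof.
  intros H K. unfold gs2. rewrite <- tsum_plus by auto. apply tsum_ext; intros; ring.
Qed.

Lemma gs2_scal c h l : gsum2 h l -> gs2 (fun p => c * h p)%C l = (c * gs2 h l)%C.
Proof.
  intros H. unfold gs2. rewrite <- tsum_scal by auto. apply tsum_ext; intros; ring.
Qed.

Lemma gsum2_plus h k l : gsum2 h l -> gsum2 k l -> gsum2 (fun p => h p + k p)%C l.
Proof.
  intros H K. eapply asum_ext; [|apply (asum_plus _ _ H K)]. intros; simpl; ring.
Qed.

Lemma gsum2_scal c h l : gsum2 h l -> gsum2 (fun p => c * h p)%C l.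
Proof.
  intros H. eapply asum_ext; [|apply (asum_scal c _ H)]. intros; simpl; ring.
Qed.

Lemma gs2_ext h k l : (forall m n, h (m, n) = k (m, n)) -> gs2 h l = gs2 k l.
Proof. intros H. apply tsum_ext; intros (m, n). rewrite H; easy. Qed.

Lemma gs2_rot h l : gsum2 h l ->
  (forall m n, ((m - n) mod 2 <> 0)%Z -> h (m, n) = RtoC 0) ->
  gs2 h l = gs2 (fun p => h (fst p + snd p, fst p - snd p)%Z) (2 * l).
Proof.
  intros Hh H0. unfold gs2.
  rewrite tsum_rotate; auto.
  - apply tsum_ext; intros (r, s). cbn [fst snd]. f_equal. f_equal.
    rewrite plus_IZR, minus_IZR. ring.
  - intros m n H. rewrite H0 by auto. ring.
Qed.

Lemma gs_odd f l : gsum f l -> (forall n, f (- n)%Z = (- f n)%C) -> gs f l = RtoC 0.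
Proof.
  intros A Ho. apply tsum_odd; auto. intros n.
  rewrite Ho, opp_IZR. replace (l * (- IZR n) ^ 2) with (l * IZR n ^ 2) by ring. ring.
Qed.

Definition wt (c : Z -> Z) (l : R) (j : nat) (n : Z) : C :=
  (zC (c n) * RtoC ((l * IZR n ^ 2) ^ j))%C.

Lemma Mom_gs c l j : Mom c l j tau = gs (wt c l j) l.
Proof. easy. Qed.

Lemma gsum_wt c l j : bounded1 c -> 0 < l -> gsum (wt c l j) l.
Proof. intros; apply asum_Mom; auto. Qed.

Definition lin (c : Z -> Z) (n : Z) : C := (zC (c n) * zC n)%C.

Lemma gsum_lin c l : bounded1 c -> 0 < l -> gsum (lin c) l.
Proof.
  intros Hc Hl. eapply asum_ext; [|apply (asum_pow c 1 l tau); auto].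
  intros n; unfold lin; simpl. ring.
Qed.

(** The derivative theta1'(0) up to a constant factor. *)
Definition Jac (l : R) : C := gs (lin chim4) l.

Lemma gs_lin_chie l : 0 < l -> gs (lin chie) l = RtoC 0.
Proof.
  intros Hl. apply gs_odd; [apply gsum_lin; auto with chars|].
  intros n. unfold lin. rewrite chie_even, zC_opp. ring.
Qed.

Lemma Mom_chim4 l : 0 < l -> gs (wt chim4 l 0) l = RtoC 0.
Proof.
  intros Hl. apply gs_odd; [apply gsum_wt; auto with chars|].
  intros n. unfold wt. rewrite (proj1 (proj2 (chi_opp n))), zC_opp. simpl; ring.
Qed.

Lemma par_tens r f g m n : (r = 0 \/ r = 1)%Z -> ((m - n) mod 2 <> 0)%Z ->
  (forall k, (k mod 2 = r)%Z -> f k = RtoC 0) -> (forall k, (k mod 2 = r)%Z -> g k = RtoC 0) ->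
  tens f g (m, n) = RtoC 0.
Proof.
  intros Hr H Hf Hg. unfold tens; cbn [fst snd].
  assert (D : (m mod 2 = r \/ n mod 2 = r)%Z) by (Z.to_euclidean_division_equations; lia).
  destruct D as [D|D]; [rewrite (Hf _ D)|rewrite (Hg _ D)]; ring.
Qed.

Lemma mod2_even k : (k mod 2 = 1)%Z -> chev k = 0%Z /\ chie k = 0%Z.
Proof.
  intros H. assert (E : chev k = 0%Z).
  { unfold chev. rewrite Zeven_mod, H. easy. }
  split; auto. rewrite chie_chev, E. easy.
Qed.

Lemma mod2_odd k : (k mod 2 = 0)%Z -> chi4 k = 0%Z /\ chim4 k = 0%Z.
Proof.
  intros H. assert (E : chi4 k = 0%Z).
  { unfold chi4. rewrite Zeven_mod, H. easy. }
  split; auto.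
  assert (X : chim4 k = (chi4 k * chim4 k)%Z).
  { revert k H E; intros k _ _; revert k. apply (periodic_eq chim4 (fun n => chi4 n * chim4 n)%Z);
    [exact chim4_48| |vm_compute; easy]. intros; rewrite chi4_48, chim4_48; easy. }
  rewrite X, E. easy.
Qed.

Lemma wt_even0 c l j k : c k = 0%Z -> wt c l j k = RtoC 0.
Proof. intros H; unfold wt; rewrite H. unfold zC; ring. Qed.
Lemma lin_even0 c k : c k = 0%Z -> lin c k = RtoC 0.
Proof. intros H; unfold lin; rewrite H. unfold zC; ring. Qed.

Lemma IZR_zC n : RtoC (IZR n) = zC n. Proof. easy. Qed.

Section Level.
Variable l : R.
Hypothesis Hl : 0 < l.
Notation M c k j := (gs (wt c k j) k).

Lemma H2l : 0 < 2 * l. Proof. lra. Qed.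
#[local] Hint Resolve H2l : chars.

Lemma chev_sqr : (M chev l 0 * M chev l 0)%C =
  (M chev (2 * l) 0 * M chev (2 * l) 0 + M chi4 (2 * l) 0 * M chi4 (2 * l) 0)%C.
Proof.
  rewrite <- !gs2_tens by (apply gsum_wt; auto with chars).
  rewrite <- gs2_plus by (apply gsum2_tens; apply gsum_wt; auto with chars).
  rewrite gs2_rot.
  - apply gs2_ext; intros r s. unfold tens, wt; cbn [fst snd pow].
    assert (X := f_equal zC (rot_chev_chev r s)). rewrite zC_plus, !zC_mult in X.
    transitivity (zC (chev (r + s)) * zC (chev (r - s)))%C; [ring|rewrite X; ring].
  - apply gsum2_tens; apply gsum_wt; auto with chars.
  - intros m n H. apply (par_tens 1); auto; intros k Hk; apply wt_even0; apply mod2_even; auto.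
Qed.

Lemma chie_sqr : (M chie l 0 * M chie l 0)%C =
  (M chev (2 * l) 0 * M chev (2 * l) 0 + RtoC (-1) * (M chi4 (2 * l) 0 * M chi4 (2 * l) 0))%C.
Proof.
  rewrite <- !gs2_tens by (apply gsum_wt; auto with chars).
  rewrite <- gs2_scal by (apply gsum2_tens; apply gsum_wt; auto with chars).
  rewrite <- gs2_plus by auto using gsum2_scal, gsum2_tens, gsum_wt, chev_b, chi4_b, H2l.
  rewrite gs2_rot.
  - apply gs2_ext; intros r s. unfold tens, wt; cbn [fst snd pow].
    assert (X := f_equal zC (rot_chie_chie r s)). unfold Z.sub in X at 2.
    rewrite zC_plus, zC_opp, !zC_mult in X.
    transitivity (zC (chie (r + s)) * zC (chie (r - s)))%C; [ring|rewrite X; ring].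
  - apply gsum2_tens; apply gsum_wt; auto with chars.
  - intros m n H. apply (par_tens 1); auto; intros k Hk; apply wt_even0; apply mod2_even; auto.
Qed.

Lemma chi4_sqr : (M chi4 l 0 * M chi4 l 0)%C =
  (RtoC 2 * (M chi4 (2 * l) 0 * M chev (2 * l) 0))%C.
Proof.
  transitivity (M chev (2 * l) 0 * M chi4 (2 * l) 0 + M chi4 (2 * l) 0 * M chev (2 * l) 0)%C; [|ring].
  rewrite <- !gs2_tens by (apply gsum_wt; auto with chars).
  rewrite <- gs2_plus by (apply gsum2_tens; apply gsum_wt; auto with chars).
  rewrite gs2_rot.
  - apply gs2_ext; intros r s. unfold tens, wt; cbn [fst snd pow].
    assert (X := f_equal zC (rot_chi4_chi4 r s)). rewrite zC_plus, !zC_mult in X.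
    transitivity (zC (chi4 (r + s)) * zC (chi4 (r - s)))%C; [ring|rewrite X; ring].
  - apply gsum2_tens; apply gsum_wt; auto with chars.
  - intros m n H. apply (par_tens 0); auto; intros k Hk; apply wt_even0; apply mod2_odd; auto.
Qed.

Lemma chev_chie : (M chev l 0 * M chie l 0)%C = (M chie (2 * l) 0 * M chie (2 * l) 0)%C.
Proof.
  transitivity (M chie (2 * l) 0 * M chie (2 * l) 0 + M chim4 (2 * l) 0 * M chim4 (2 * l) 0)%C.
  2: { rewrite Mom_chim4 by lra. ring. }
  rewrite <- !gs2_tens by (apply gsum_wt; auto with chars).
  rewrite <- gs2_plus by (apply gsum2_tens; apply gsum_wt; auto with chars).
  rewrite gs2_rot.
  - apply gs2_ext; intros r s. unfold tens, wt; cbn [fst snd pow].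
    assert (X := f_equal zC (rot_chev_chie r s)). rewrite zC_plus, !zC_mult in X.
    transitivity (zC (chev (r + s)) * zC (chie (r - s)))%C; [ring|rewrite X; ring].
  - apply gsum2_tens; apply gsum_wt; auto with chars.
  - intros m n H. apply (par_tens 1); auto; intros k Hk; apply wt_even0; apply mod2_even; auto.
Qed.

(** The left side is the lattice sum with weight (l m^2 - l n^2)^2 / 2. Rotation turns l m^2 - l n^2
    into 4 l r s, so the weight becomes 2 (2 l r^2) (2 l s^2) and the double sum separates into
    first moments at the doubled exponent. *)
Lemma chev_second : (M chev l 0 * M chev l 2 - M chev l 1 * M chev l 1)%C =
  (RtoC 2 * (M chev (2 * l) 1 * M chev (2 * l) 1 + M chi4 (2 * l) 1 * M chi4 (2 * l) 1))%C.
Proof.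
  transitivity (RtoC (1 / 2) * (M chev l 0 * M chev l 2 + M chev l 2 * M chev l 0 +
     RtoC (-2) * (M chev l 1 * M chev l 1)))%C.
  { assert (E : (RtoC (1 / 2) * RtoC 2)%C = RtoC 1) by (rewrite <- RtoC_mult; f_equal; field).
    transitivity ((RtoC (1 / 2) * RtoC 2) * (M chev l 0 * M chev l 2 - M chev l 1 * M chev l 1))%C;
      [rewrite E|]; ring. }
  transitivity (RtoC 2 * gs2 (fun p => tens (wt chev (2 * l) 1) (wt chev (2 * l) 1) p +
     tens (wt chi4 (2 * l) 1) (wt chi4 (2 * l) 1) p)%C (2 * l))%C.
  2: { rewrite gs2_plus, !gs2_tens by (try apply gsum2_tens; apply gsum_wt; auto with chars). ring. }
  rewrite <- !gs2_tens by (apply gsum_wt; auto with chars).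
  assert (A : forall i j, gsum2 (tens (wt chev l i) (wt chev l j)) l)
    by (intros; apply gsum2_tens; apply gsum_wt; auto with chars).
  rewrite <- gs2_scal by auto.
  rewrite <- (gs2_plus (tens (wt chev l 0) (wt chev l 2))) by auto.
  rewrite <- gs2_plus by auto using gsum2_plus, gsum2_scal.
  rewrite <- gs2_scal by auto using gsum2_plus, gsum2_scal.
  rewrite <- gs2_scal.
  2: { apply gsum2_plus; apply gsum2_tens; apply gsum_wt; auto with chars. }
  rewrite gs2_rot.
  - apply gs2_ext; intros r s. unfold tens, wt; cbn [fst snd pow].
    assert (X := f_equal zC (rot_chev_chev r s)). rewrite zC_plus, !zC_mult in X.
    transitivity (zC (chev (r + s)) * zC (chev (r - s)) *
      RtoC (1 / 2 * (l * IZR (r + s) ^ 2 - l * IZR (r - s) ^ 2) ^ 2))%C.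
    + simpl pow. rewrite !RtoC_mult, RtoC_minus, !RtoC_mult. ring.
    + rewrite X, plus_IZR, minus_IZR.
      replace (1 / 2 * (l * (IZR r + IZR s) ^ 2 - l * (IZR r - IZR s) ^ 2) ^ 2) with
        (2 * ((2 * l * IZR r ^ 2) * (2 * l * IZR s ^ 2))) by field.
      simpl pow. rewrite !RtoC_mult. ring.
  - auto 10 using gsum2_plus, gsum2_scal.
  - intros m n H.
    rewrite !(par_tens 1) by (auto; intros k Hk; apply wt_even0; apply mod2_even; auto). ring.
Qed.

(** The weight l m^2 - l n^2 becomes 4 l r s. The part with [chie] is a product of series of odd
    functions and vanishes; the part with [chim4] is the square of [Jac]. *)
Lemma chev_chie_wronskian : (M chev l 1 * M chie l 0 - M chev l 0 * M chie l 1)%C =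
  (RtoC (4 * l) * (Jac (2 * l) * Jac (2 * l)))%C.
Proof.
  transitivity (M chev l 1 * M chie l 0 + RtoC (-1) * (M chev l 0 * M chie l 1))%C; [ring|].
  transitivity (RtoC (4 * l) * gs2 (fun p => tens (lin chie) (lin chie) p +
     tens (lin chim4) (lin chim4) p)%C (2 * l))%C.
  2: { rewrite gs2_plus, !gs2_tens, gs_lin_chie by (try apply gsum2_tens; try apply gsum_lin; auto with chars).
       unfold Jac; ring. }
  rewrite <- !gs2_tens by (apply gsum_wt; auto with chars).
  assert (A : forall i j, gsum2 (tens (wt chev l i) (wt chie l j)) l)
    by (intros; apply gsum2_tens; apply gsum_wt; auto with chars).
  rewrite <- gs2_scal by auto.
  rewrite <- gs2_plus by auto using gsum2_plus, gsum2_scal.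
  rewrite <- gs2_scal.
  2: { apply gsum2_plus; apply gsum2_tens; apply gsum_lin; auto with chars. }
  rewrite gs2_rot.
  - apply gs2_ext; intros r s. unfold tens, wt, lin; cbn [fst snd pow].
    assert (X := f_equal zC (rot_chev_chie r s)). rewrite zC_plus, !zC_mult in X.
    transitivity (zC (chev (r + s)) * zC (chie (r - s)) *
      RtoC (l * IZR (r + s) ^ 2 - l * IZR (r - s) ^ 2))%C.
    + simpl pow. rewrite RtoC_minus, !RtoC_mult. ring.
    + rewrite X, plus_IZR, minus_IZR.
      replace (l * (IZR r + IZR s) ^ 2 - l * (IZR r - IZR s) ^ 2) with
        (4 * l * (IZR r * IZR s)) by ring.
      rewrite (RtoC_mult (4 * l)), (RtoC_mult (IZR r)), !IZR_zC. ring.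
  - auto using gsum2_plus, gsum2_scal.
  - intros m n H.
    rewrite !(par_tens 1) by (auto; intros k Hk; apply wt_even0; apply mod2_even; auto). ring.
Qed.

(** The weight m becomes r + s. Of the four resulting products, two contain a vanishing odd series
    and the other two are equal. *)
Lemma Jac_double : (Jac l * M chi4 l 0)%C = (RtoC 2 * (Jac (2 * l) * M chie (2 * l) 0))%C.
Proof.
  transitivity (gs2 (fun p => tens (lin chim4) (wt chie (2 * l) 0) p + tens (wt chim4 (2 * l) 0) (lin chie) p
     + (tens (lin chie) (wt chim4 (2 * l) 0) p + tens (wt chie (2 * l) 0) (lin chim4) p))%C (2 * l)).
  2: { assert (B1 : gsum (lin chim4) (2 * l)) by (apply gsum_lin; auto with chars).
       assert (B2 : gsum (lin chie) (2 * l)) by (apply gsum_lin; auto with chars).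
       assert (B3 : gsum (wt chim4 (2 * l) 0) (2 * l)) by (apply gsum_wt; auto with chars).
       assert (B4 : gsum (wt chie (2 * l) 0) (2 * l)) by (apply gsum_wt; auto with chars).
       rewrite !gs2_plus, !gs2_tens, Mom_chim4 by auto using gsum2_plus, gsum2_tens, H2l.
       unfold Jac; ring. }
  unfold Jac. rewrite <- gs2_tens by auto using gsum_lin, gsum_wt, chim4_b, chi4_b.
  rewrite gs2_rot.
  - apply gs2_ext; intros r s. unfold tens, wt, lin; cbn [fst snd pow].
    assert (X := f_equal zC (rot_chim4_chi4 r s)). rewrite zC_plus, !zC_mult in X.
    transitivity (zC (chim4 (r + s)) * zC (chi4 (r - s)) * zC (r + s))%C; [ring|].
    rewrite X, zC_plus. ring.
  - apply gsum2_tens; [apply gsum_lin|apply gsum_wt]; auto with chars.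
  - intros m n H. apply (par_tens 0); auto; intros k Hk; [apply lin_even0|apply wt_even0]; apply mod2_odd; auto.
Qed.

End Level.
End Lattice.

(** * Jacobi's derivative formula *)

Section Derivative.
Variable tau : C.
Hypothesis Ht : 0 < Im tau.
Notation e x := (epow x tau).
Notation M c l j := (Mom c l j tau).

Lemma theta_nz l : 0 < l -> M chi4 l 0 <> RtoC 0 /\ M chev l 0 <> RtoC 0 /\ M chie l 0 <> RtoC 0.
Proof.
  intros Hl. replace l with ((4 * l) / 4) by field.
  assert (Q := qlim_nz tau Ht).
  rewrite Mom_chi4_prod, Mom_chev_prod, Mom_chie_prod by (auto; lra).
  assert (Q1 : qlim tau (4 * l) <> RtoC 0) by (apply Q; lra).
  assert (Q2 : qlim tau (2 * (4 * l)) <> RtoC 0) by (apply Q; lra).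
  assert (Q3 : qlim tau (4 * (4 * l)) <> RtoC 0) by (apply Q; lra).
  assert (D : forall x y : C, x <> RtoC 0 -> y <> RtoC 0 -> (x / y)%C <> RtoC 0).
  { intros x y Hx Hy H. apply Hx. replace x with (x / y * y)%C by (field; auto). rewrite H; ring. }
  assert (T : RtoC 2 <> RtoC 0) by (intros X; apply RtoC_inj in X; lra).
  repeat split.
  - apply Cmult_neq_0; [apply Cmult_neq_0; [auto|apply epow_nz]|apply D; auto; apply Cmult_neq_0; auto].
  - apply Cmult_neq_0; auto. apply Cmult_neq_0; apply D; try apply Cmult_neq_0; auto.
  - apply D; auto. apply Cmult_neq_0; auto.
Qed.

Definition W (l : R) : C := (M chi4 l 0 * (M chev l 0 * M chie l 0))%C.

Lemma Jac_W_double l : 0 < l -> (Jac tau l * W (2 * l))%C = (Jac tau (2 * l) * W l)%C.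
Proof.
  intros Hl. destruct (theta_nz l Hl) as (N2 & _ & _).
  assert (J := Jac_double tau Ht l Hl).
  assert (S := chi4_sqr tau Ht l Hl). assert (P := chev_chie tau Ht l Hl).
  unfold W in *. rewrite !Mom_gs in *.
  set (t2 := gs tau (wt chi4 l 0) l) in *. set (t3 := gs tau (wt chev l 0) l) in *.
  set (t4 := gs tau (wt chie l 0) l) in *.
  set (s2 := gs tau (wt chi4 (2 * l) 0) (2 * l)) in *.
  set (s3 := gs tau (wt chev (2 * l) 0) (2 * l)) in *.
  set (s4 := gs tau (wt chie (2 * l) 0) (2 * l)) in *.
  set (j := Jac tau l) in *. set (j2 := Jac tau (2 * l)) in *.
  assert (X : (t2 * (j * (s2 * (s3 * s4))))%C = (t2 * (j2 * (t2 * (t3 * t4))))%C).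
  { transitivity ((j * t2) * (s2 * (s3 * s4)))%C; [ring|]. rewrite J.
    transitivity (j2 * ((RtoC 2 * (s2 * s3)) * (s4 * s4)))%C; [ring|].
    rewrite <- S, <- P. ring. }
  transitivity (/ t2 * (t2 * (j * (s2 * (s3 * s4)))))%C; [field; auto|].
  rewrite X. field; auto.
Qed.

Fixpoint dbl (l : R) (k : nat) : R := match k with O => l | S k => 2 * dbl l k end.

Lemma dbl_ge l k : 0 < l -> l <= dbl l k /\ (INR k + 1) * l <= 2 * dbl l k.
Proof.
  intros Hl. induction k as [|k (I1 & I2)]; [simpl; lra|].
  rewrite S_INR. cbn [dbl]. lra.
Qed.

Lemma Jac_W_dbl l k : 0 < l -> (Jac tau l * W (dbl l k))%C = (Jac tau (dbl l k) * W l)%C.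
Proof.
  intros Hl.
  assert (NW : forall x, 0 < x -> W x <> RtoC 0).
  { intros x Hx. destruct (theta_nz x Hx) as (A & B & D). unfold W.
    apply Cmult_neq_0; auto; apply Cmult_neq_0; auto. }
  induction k as [|k IH]; [easy|]. cbn [dbl].
  assert (Hd : 0 < dbl l k) by (destruct (dbl_ge l k Hl); lra).
  assert (X := Jac_W_double _ Hd). assert (N := NW _ Hd).
  assert (Y : (W (dbl l k) * (Jac tau l * W (2 * dbl l k)))%C = (W (dbl l k) * (Jac tau (2 * dbl l k) * W l))%C).
  { transitivity ((Jac tau l * W (dbl l k)) * W (2 * dbl l k))%C; [ring|]. rewrite IH.
    transitivity ((Jac tau (dbl l k) * W (2 * dbl l k)) * W l)%C; [ring|]. rewrite X. ring. }
  transitivity (/ W (dbl l k) * (W (dbl l k) * (Jac tau l * W (2 * dbl l k))))%C; [field; auto|].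
  rewrite Y. field; auto.
Qed.

Lemma e_dbl_lim l x : 0 < l -> 0 < x -> climit (fun k => e (dbl l k * x)) (RtoC 0).
Proof.
  intros Hl Hx eps He.
  set (d := PI * Im tau * (l * x)).
  assert (Hd : 0 < d).
  { assert (X := PI_RGT_0). unfold d. apply Rmult_lt_0_compat; [apply Rmult_lt_0_compat; auto|].
    apply Rmult_lt_0_compat; auto. }
  destruct (archimed_cor1 (eps * d)) as (N & HN & HN0); [apply Rmult_lt_0_compat; auto|].
  exists N; intros n Hn.
  replace (e (dbl l n * x) - RtoC 0)%C with (e (dbl l n * x)) by ring.
  rewrite Cmod_epow.
  assert (P : (INR n + 1) * d <= 2 * PI * (dbl l n * x) * Im tau).
  { destruct (dbl_ge l n Hl) as (_ & G). assert (X := PI_RGT_0).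
    assert (Z : 0 < PI * Im tau * x) by (apply Rmult_lt_0_compat; auto; apply Rmult_lt_0_compat; auto).
    unfold d. nra. }
  assert (Hn' : 0 < INR N) by (apply lt_0_INR; lia).
  assert (Hle : INR N <= INR n) by (apply le_INR; auto).
  assert (Q : INR N * d < exp (2 * PI * (dbl l n * x) * Im tau)).
  { apply Rlt_trans with (1 + (INR n + 1) * d); [nra|].
    eapply Rle_lt_trans; [apply Rplus_le_compat_l, P|]. apply exp_ineq1.
    assert (0 < (INR n + 1) * d) by nra. lra. }
  rewrite exp_Ropp.
  apply Rlt_trans with (/ (INR N * d)).
  - apply Rinv_lt_contravar; auto. apply Rmult_lt_0_compat; [nra|apply exp_pos].
  - rewrite Rinv_mult. apply Rmult_lt_reg_r with d; auto.
    replace (/ INR N * / d * d) with (/ INR N) by (field; lra). auto.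
Qed.

(* Along l, 2l, 4l, ... only the terms with the smallest exponent m survive. *)
Lemma theta_dbl_lim (f : Z -> C) (m : R) l : 0 < l -> gsum tau f l ->
  (forall n, f n = RtoC 0 \/ m <= IZR n ^ 2) ->
  climit (fun k => gs tau f (dbl l k) * e (- (dbl l k * m)))%C
    (tsum (fun n => if Req_EM_T (IZR n ^ 2) m then f n else RtoC 0)).
Proof.
  intros Hl (M0 & HM) Hf.
  assert (AS : forall k, gsum tau f (dbl l k)).
  { intros k. apply (asum_dom _ (fun n => f n * e (l * IZR n ^ 2))%C); [|exists M0; auto].
    intros n. rewrite !Cmod_mult. apply Rmult_le_compat_l; [apply Cmod_ge_0|].
    rewrite !Cmod_epow. destruct (dbl_ge l k Hl) as (G & _).
    assert (X := PI_RGT_0). assert (Y := pow2_ge_0 (IZR n)).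
    assert (Z : 2 * PI * (l * IZR n ^ 2) * Im tau <= 2 * PI * (dbl l k * IZR n ^ 2) * Im tau).
    { apply Rmult_le_compat_r; [lra|]. apply Rmult_le_compat_l; [lra|]. nra. }
    destruct Z as [Z|Z]; [left; apply exp_increasing; lra|right; f_equal; lra]. }
  apply (climit_ext (fun k => tsum (fun n => e (- (dbl l k * m)) * (f n * e (dbl l k * IZR n ^ 2)))%C)).
  { intros k. rewrite tsum_scal by apply AS. unfold gs. ring. }
  apply (tannery _ _ (fun n => Cmod (e (- (l * m)) * (f n * e (l * IZR n ^ 2))%C)) (Cmod (e (- (l * m))) * M0)).
  - intros L HL. eapply Rle_trans; [|apply Rmult_le_compat_l; [apply Cmod_ge_0|apply (HM L HL)]].
    rewrite <- rsum_scal. apply rsum_le; intros; rewrite Cmod_mult; lra.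
  - intros k n. destruct (Hf n) as [H|H].
    { rewrite H. rewrite !Cmult_0_l, !Cmult_0_r. lra. }
    replace (e (- (dbl l k * m)) * (f n * e (dbl l k * IZR n ^ 2)))%C with
      (f n * e (dbl l k * (IZR n ^ 2 - m)))%C.
    2: { replace (dbl l k * (IZR n ^ 2 - m)) with (- (dbl l k * m) + dbl l k * IZR n ^ 2) by ring.
         rewrite epow_add; ring. }
    replace (e (- (l * m)) * (f n * e (l * IZR n ^ 2)))%C with (f n * e (l * (IZR n ^ 2 - m)))%C.
    2: { replace (l * (IZR n ^ 2 - m)) with (- (l * m) + l * IZR n ^ 2) by ring.
         rewrite epow_add; ring. }
    rewrite !Cmod_mult. apply Rmult_le_compat_l; [apply Cmod_ge_0|].
    rewrite !Cmod_epow. destruct (dbl_ge l k Hl) as (G & _). assert (X := PI_RGT_0).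
    assert (Z : 2 * PI * (l * (IZR n ^ 2 - m)) * Im tau <= 2 * PI * (dbl l k * (IZR n ^ 2 - m)) * Im tau).
    { apply Rmult_le_compat_r; [lra|]. apply Rmult_le_compat_l; [lra|]. nra. }
    destruct Z as [Z|Z]; [left; apply exp_increasing; lra|right; f_equal; lra].
  - intros n. destruct (Hf n) as [H|H].
    { replace (if Req_EM_T (IZR n ^ 2) m then f n else RtoC 0) with (RtoC 0)
        by (rewrite H; destruct (Req_EM_T (IZR n ^ 2) m); easy).
      eapply climit_ext; [|apply (climit_const (RtoC 0))]. intros k. rewrite H. ring. }
    apply (climit_ext (fun k => f n * e (dbl l k * (IZR n ^ 2 - m)))%C).
    { intros k. replace (dbl l k * (IZR n ^ 2 - m)) with (- (dbl l k * m) + dbl l k * IZR n ^ 2) by ring.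
      rewrite epow_add; ring. }
    destruct (Req_EM_T (IZR n ^ 2) m) as [E|E].
    + eapply climit_ext; [|apply (climit_const (f n))]. intros k. rewrite E.
      replace (dbl l k * (m - m)) with 0 by ring. rewrite epow_0; ring.
    + replace (RtoC 0) with (f n * RtoC 0)%C by ring.
      apply climit_mult; [apply climit_const|]. apply e_dbl_lim; auto. lra.
Qed.

Lemma tsum_at_0 (f : Z -> C) :
  tsum (fun n => if Req_EM_T (IZR n ^ 2) 0 then f n else RtoC 0) = f 0%Z.
Proof.
  rewrite (tsum_single _ 0%Z).
  - destruct (Req_EM_T (0 ^ 2) 0) as [_|H]; [easy|]. exfalso; apply H; ring.
  - intros t H. destruct (Req_EM_T (IZR t ^ 2) 0) as [E|_]; [|easy].
    exfalso. apply H. apply eq_IZR. assert (IZR t * IZR t = 0) by lra. nra.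
Qed.

Lemma tsum_at_1 (f : Z -> C) :
  tsum (fun n => if Req_EM_T (IZR n ^ 2) 1 then f n else RtoC 0) = (f 1%Z + f (-1)%Z)%C.
Proof.
  set (d := fun a n => if Z.eq_dec n a then f n else RtoC 0).
  assert (D : forall a, tsum (d a) = f a /\ asum (d a)).
  { intros a; split.
    - rewrite (tsum_single _ a); unfold d; [destruct (Z.eq_dec a a); easy|].
      intros t H. destruct (Z.eq_dec t a); easy.
    - exists (Cmod (f a)); intros L HL.
      destruct (in_dec Z.eq_dec a L) as [Hi|Hi].
      + destruct (incl_split (a :: nil) L) as (L1 & HP & N1); auto.
        { constructor; [intros []|constructor]. }
        { intros x [<-|[]]; auto. }
        rewrite (rsum_perm _ _ _ HP). simpl. unfold d at 1. destruct (Z.eq_dec a a); [|easy].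
        assert (X := Permutation_NoDup HP HL). simpl in X. inversion X as [|x0 l0 Hn _]; subst.
        replace (rsum (fun t => Cmod (d a t)) L1) with 0; [lra|].
        clear - Hn. induction L1 as [|t L1 IH]; simpl; [easy|]. simpl in Hn.
        rewrite <- IH by tauto. unfold d. destruct (Z.eq_dec t a); [tauto|]. rewrite Cmod_0; ring.
      + replace (rsum (fun t => Cmod (d a t)) L) with 0; [apply Cmod_ge_0|].
        clear - Hi. induction L as [|t L IH]; simpl; [easy|]. simpl in Hi.
        rewrite <- IH by tauto. unfold d. destruct (Z.eq_dec t a); [tauto|]. rewrite Cmod_0; ring. }
  destruct (D 1%Z) as (E1 & A1), (D (-1)%Z) as (E2 & A2).
  rewrite <- E1, <- E2, <- tsum_plus by auto. apply tsum_ext; intros n. unfold d.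
  destruct (Req_EM_T (IZR n ^ 2) 1) as [E|E].
  - assert (H : (n * n = 1)%Z) by (apply eq_IZR; rewrite mult_IZR; lra).
    destruct (Z.eq_dec n 1) as [->|H1]; [simpl; ring|].
    destruct (Z.eq_dec n (-1)) as [->|H2]; [ring|]. nia.
  - destruct (Z.eq_dec n 1) as [->|H1]; [exfalso; apply E; ring|].
    destruct (Z.eq_dec n (-1)) as [->|H2]; [exfalso; apply E; ring|ring].
Qed.

Lemma odd_sq_ge1 n : (n mod 2 <> 0)%Z -> 1 <= IZR n ^ 2.
Proof.
  intros H. assert (Hn : n <> 0%Z) by (intros ->; apply H; easy).
  replace (IZR n ^ 2) with (IZR (n * n)) by (rewrite mult_IZR; ring). apply IZR_le. nia.
Qed.

Theorem Jac_W l : 0 < l -> Jac tau l = W l.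
Proof.
  intros Hl.
  assert (G0 : forall c : Z -> Z, forall n, wt c l 0 n = RtoC 0 \/ 0 <= IZR n ^ 2)
    by (intros; right; apply pow2_ge_0).
  assert (C3 := theta_dbl_lim (wt chev l 0) 0 l Hl (gsum_wt tau Ht _ _ _ chev_b Hl) (G0 chev)).
  assert (C4 := theta_dbl_lim (wt chie l 0) 0 l Hl (gsum_wt tau Ht _ _ _ chie_b Hl) (G0 chie)).
  assert (G2 : forall n, wt chi4 l 0 n = RtoC 0 \/ 1 <= IZR n ^ 2).
  { intros n. destruct (Z.eq_dec (n mod 2) 0) as [H|H]; [left|right; apply odd_sq_ge1; auto].
    apply wt_even0, mod2_odd; auto. }
  assert (GJ : forall n, lin chim4 n = RtoC 0 \/ 1 <= IZR n ^ 2).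
  { intros n. destruct (Z.eq_dec (n mod 2) 0) as [H|H]; [left|right; apply odd_sq_ge1; auto].
    apply lin_even0, mod2_odd; auto. }
  assert (C2 := theta_dbl_lim (wt chi4 l 0) 1 l Hl (gsum_wt tau Ht _ _ _ chi4_b Hl) G2).
  assert (CJ := theta_dbl_lim (lin chim4) 1 l Hl (gsum_lin tau Ht _ _ chim4_b Hl) GJ).
  rewrite tsum_at_0 in C3, C4. rewrite tsum_at_1 in C2, CJ.
  replace (wt chev l 0 0%Z) with (RtoC 1) in C3
    by (unfold wt; change (chev 0) with 1%Z; unfold zC; simpl; ring).
  replace (wt chie l 0 0%Z) with (RtoC 1) in C4
    by (unfold wt; change (chie 0) with 1%Z; unfold zC; simpl; ring).
  replace (wt chi4 l 0 1%Z + wt chi4 l 0 (-1)%Z)%C with (RtoC 2) in C2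
    by (unfold wt; change (chi4 1) with 1%Z; change (chi4 (-1)) with 1%Z; unfold zC; simpl; ring).
  replace (lin chim4 1%Z + lin chim4 (-1)%Z)%C with (RtoC 2) in CJ
    by (unfold lin; change (chim4 1) with 1%Z; change (chim4 (-1)) with (-1)%Z; unfold zC; ring).
  assert (L1 := climit_mult _ _ _ _ (climit_const (Jac tau l)) (climit_mult _ _ _ _ C2 (climit_mult _ _ _ _ C3 C4))).
  assert (L2 := climit_mult _ _ _ _ CJ (climit_const (W l))).
  (* Series whose lowest terms sit at n = 1 and n = -1 have normalised limit 2, those starting at n
     = 0 have limit 1; this fixes the constant ratio of [Jac] and [W] as 1. *)
  assert (E : (Jac tau l * (RtoC 2 * (RtoC 1 * RtoC 1)))%C = (RtoC 2 * W l)%C).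
  { apply (climit_unique _ _ _ L1). eapply climit_ext; [|exact L2]. intros k; simpl.
    assert (X := Jac_W_dbl l k Hl). unfold Jac at 2 in X.
    transitivity ((gs tau (lin chim4) (dbl l k) * W l) * epow (- (dbl l k * 1)) tau)%C; [ring|].
    rewrite <- X. unfold W. rewrite !Mom_gs.
    assert (Ew : forall c, gs tau (wt c l 0) (dbl l k) = gs tau (wt c (dbl l k) 0) (dbl l k)) by easy.
    rewrite <- !Ew. rewrite Rmult_0_r, Ropp_0, epow_0. ring. }
  assert (T : RtoC 2 <> RtoC 0) by (intros X; apply RtoC_inj in X; lra).
  transitivity (/ RtoC 2 * (Jac tau l * (RtoC 2 * (RtoC 1 * RtoC 1))))%C; [field; auto|].
  rewrite E. field; auto.
Qed.

End Derivative.

(** * The ring of quasimodular forms of level 2 *)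

Section Horner.
Context {R : Type} (zero : R) (add mul : R -> R -> R).

Fixpoint hadd (p q : list R) : list R :=
  match p, q with
  | nil, _ => q
  | _, nil => p
  | c :: p, d :: q => add c d :: hadd p q
  end.

Fixpoint hmul (p q : list R) : list R :=
  match p with nil => nil | c :: p => hadd (map (mul c) q) (zero :: hmul p q) end.

Variables (e : R -> C) (X : C).

Fixpoint hev (p : list R) : C :=
  match p with nil => RtoC 0 | c :: p => (e c + X * hev p)%C end.

Lemma hev_map f k p : (forall c, e (f c) = (k * e c)%C) -> hev (map f p) = (k * hev p)%C.
Proof. intros H. induction p as [|c p IH]; simpl; [ring|]. rewrite H, IH; ring. Qed.

Lemma hev_zero iz p : (forall c, iz c = true -> e c = RtoC 0) -> forallb iz p = true ->
  hev p = RtoC 0.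
Proof.
  intros H. induction p as [|c p IH]; simpl; [easy|].
  intros E. apply andb_prop in E; destruct E as (E1 & E2). rewrite H, IH; auto. ring.
Qed.

Hypotheses (e_zero : e zero = RtoC 0) (e_add : forall c d, e (add c d) = (e c + e d)%C)
  (e_mul : forall c d, e (mul c d) = (e c * e d)%C).

Lemma hev_add p q : hev (hadd p q) = (hev p + hev q)%C.
Proof.
  revert q; induction p as [|c p IH]; intros [|d q]; simpl; try ring.
  rewrite e_add, IH; ring.
Qed.

Lemma hev_mul p q : hev (hmul p q) = (hev p * hev q)%C.
Proof.
  induction p as [|c p IH]; cbn [hmul]; [simpl; ring|].
  rewrite hev_add, (hev_map (mul c) (e c)) by (intros; apply e_mul).
  cbn [hev]. rewrite e_zero, IH; ring.
Qed.

End Horner.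

(* Nested Horner form, with P outermost and B innermost: this keeps the kernel computation
   behind [weight12_identity] small. *)
Definition poly : Type := list (list (list Z)).

Definition ev (p : poly) (x y z : C) : C := hev (hev (hev zC z) y) x p.

Definition padd : poly -> poly -> poly := hadd (hadd (hadd Z.add)).
Definition pmul : poly -> poly -> poly :=
  hmul nil (hadd (hadd Z.add)) (hmul nil (hadd Z.add) (hmul 0%Z Z.add Z.mul)).
Definition pscal (k : Z) : poly -> poly := map (map (map (Z.mul k))).
Definition pconst (c : Z) : poly := ((c :: nil) :: nil) :: nil.
Definition pzero : poly -> bool := forallb (forallb (forallb (Z.eqb 0))).

Lemma ev_padd p q x y z : ev (padd p q) x y z = (ev p x y z + ev q x y z)%C.
Proof. repeat (apply hev_add; intros). apply zC_plus. Qed.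

Lemma ev_pmul p q x y z : ev (pmul p q) x y z = (ev p x y z * ev q x y z)%C.
Proof.
  repeat first [apply zC_plus|apply zC_mult|reflexivity|apply hev_mul; intros|apply hev_add; intros].
Qed.

Lemma ev_pscal k p x y z : ev (pscal k p) x y z = (zC k * ev p x y z)%C.
Proof. repeat (apply hev_map; intros). apply zC_mult. Qed.

Lemma ev_pconst c x y z : ev (pconst c) x y z = zC c.
Proof. unfold ev; simpl. ring. Qed.

Lemma ev_zero p x y z : pzero p = true -> ev p x y z = RtoC 0.
Proof.
  apply hev_zero; intros q; apply hev_zero; intros r; apply hev_zero; intros c H.
  apply Z.eqb_eq in H; subst; easy.
Qed.

Definition pP : poly := nil :: ((1%Z :: nil) :: nil) :: nil.
Definition pA : poly := (nil :: (1%Z :: nil) :: nil) :: nil.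
Definition pB : poly := ((0%Z :: 1%Z :: nil) :: nil) :: nil.

Lemma ev_pP x y z : ev pP x y z = x.
Proof. unfold ev, zC; simpl. ring. Qed.
Lemma ev_pA x y z : ev pA x y z = y.
Proof. unfold ev, zC; simpl. ring. Qed.
Lemma ev_pB x y z : ev pB x y z = z.
Proof. unfold ev, zC; simpl. ring. Qed.

Definition plin (a b c : Z) : poly := padd (pscal a pP) (padd (pscal b pA) (pscal c pB)).
Lemma ev_plin a b c x y z : ev (plin a b c) x y z = (zC a * x + zC b * y + zC c * z)%C.
Proof. unfold plin. rewrite !ev_padd, !ev_pscal, ev_pP, ev_pA, ev_pB. ring. Qed.

(* 48 times the derivation, on the generators P (the weight 2 Eisenstein series),
   A and B (fourth powers of theta constants). *)
Definition dP : poly := pscal 4 (padd (pmul pP pP)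
  (padd (pscal (-1) (pmul pA pA)) (padd (pmul pA pB) (pscal (-1) (pmul pB pB))))).
Definition dA : poly := pscal 8 (pmul pA (plin 1 (-1) 2)).
Definition dB : poly := pscal 8 (pmul pB (plin 1 2 (-1))).

Section Derivation.
Context {R : Type} (dR : R -> poly) (emb : list R -> poly) (X dX : poly).

(** The Leibniz rule on the Horner step c + X p; [emb] views the tail p of an inner level as an
    element of [poly]. *)
Fixpoint hder (p : list R) : poly :=
  match p with
  | nil => nil
  | c :: p => padd (dR c) (padd (pmul dX (emb p)) (pmul X (hder p)))
  end.

Fixpoint hsub (p : list R) : poly :=
  match p with nil => nil | c :: p => padd (dR c) (pmul X (hsub p)) end.

Lemma ev_hsub e x0 x y z p : (forall c, ev (dR c) x y z = e c) -> ev X x y z = x0 ->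
  ev (hsub p) x y z = hev e x0 p.
Proof.
  intros H HX. induction p as [|c p IH]; [easy|]. cbn [hsub hev].
  rewrite ev_padd, ev_pmul, H, HX, IH; easy.
Qed.

End Derivation.

Definition pder : poly -> poly :=
  hder (hder (hder (fun _ => nil) (fun p => (p :: nil) :: nil) pB dB) (fun p => p :: nil) pA dA)
    (fun p => p) pP dP.

(* [tower G j] is 48^j (D^j f) / f when 48 (D f) / f = G. *)
Fixpoint tower (G : poly) (j : nat) : poly :=
  match j with
  | O => pconst 1
  | S j => let h := tower G j in padd (pder h) (pmul G h)
  end.

Definition PhiP (f g : nat -> poly) : poly :=
  padd (pmul (f 0%nat) (g 6%nat)) (padd (pscal (-66) (pmul (f 1%nat) (g 5%nat)))
   (padd (pscal 495 (pmul (f 2%nat) (g 4%nat))) (padd (pscal (-924) (pmul (f 3%nat) (g 3%nat)))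
   (padd (pscal 495 (pmul (f 4%nat) (g 2%nat))) (padd (pscal (-66) (pmul (f 5%nat) (g 1%nat)))
    (pmul (f 6%nat) (g 0%nat))))))).

Lemma ev_PhiP f g x y z :
  ev (PhiP f g) x y z = Phi (fun j => ev (f j) x y z) (fun j => ev (g j) x y z).
Proof.
  unfold PhiP. rewrite !ev_padd, !ev_pscal, !ev_pmul. unfold Phi, zC. ring.
Qed.

(* The substitution A -> A - B, B -> -B induced by tau -> tau + 1. *)
Definition pshift : poly -> poly :=
  hsub (hsub (hsub pconst (plin 0 0 (-1))) (plin 0 1 (-1))) pP.

Lemma ev_pshift p x y z : ev (pshift p) x y z = ev p x (y - z)%C (- z)%C.
Proof.
  apply ev_hsub; [|apply ev_pP]. intros q.
  apply ev_hsub; [|rewrite ev_plin; unfold zC; ring]. intros r.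
  apply ev_hsub; [intros c; apply ev_pconst|rewrite ev_plin; unfold zC; ring].
Qed.

(** The arguments are the logarithmic derivatives 48 D f / f of the two theta constants in each
    bracket. In each pair they add up to 4 P, the value for eta^2. *)
Definition P12 := PhiP (tower (plin 2 2 (-1))) (tower (plin 2 (-2) 1)).
Definition P34 := PhiP (tower (plin 2 (-1) (-1))) (tower (plin 2 1 1)).
Definition P55 := PhiP (tower (plin 2 0 0)) (tower (plin 2 0 0)).

Lemma ev_identity p q r s k x y z :
  let D := pmul pA (pmul pB (plin 0 1 (-1))) in
  pzero (padd (pscal 2 p) (padd q (padd r (padd (pscal 4 s) (pscal (- k) (pmul D D)))))) = true ->
  (RtoC 2 * ev p x y z + ev q x y z + ev r x y z + RtoC 4 * ev s x y z)%C =
  (zC k * Cpow (y * z * (y - z)) 2)%C.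
Proof.
  intros D H. apply (ev_zero _ x y z) in H. unfold D in H.
  rewrite !ev_padd, !ev_pscal, !ev_pmul, ev_plin, ev_pA, ev_pB, zC_opp in H.
  replace (zC 0 * x + zC 1 * y + zC (-1) * z)%C with (y - z)%C in H by (unfold zC; ring).
  match type of H with ?l = _ => transitivity (l + zC k * Cpow (y * z * (y - z)) 2)%C end.
  - simpl Cpow. unfold zC at 1 2. ring.
  - rewrite H. ring.
Qed.

(** The weights 2, 1, 1, 4 come from the coefficients 1/2, 1/8, 1/8, 1/2 of the brackets: with E
    equal to twice eta, the first product of theta constants is E^2 / 2 and the others may be taken
    as E^2, so that E^2 / 8 is a common factor. The constant contains 4^6 = 48^6 / 12^6. *)
Lemma weight12_identity x y z :
  (RtoC 2 * ev P12 x y z + ev P34 x y z + ev P34 x (y - z) (- z) + RtoC 4 * ev P55 x y z)%C =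
  (zC (2 * 4 ^ 6 * 3 ^ 4 * 11 ^ 2 * 13) * Cpow (y * z * (y - z)) 2)%C.
Proof.
  rewrite <- ev_pshift. apply ev_identity. vm_compute. reflexivity.
Qed.

(** * Derivatives along a horizontal line *)

(** Here g is D f: along tau0 + t with t real, d/dt equals 2 pi i q d/dq, so a real derivative
    replaces holomorphy in tau. *)
Definition DD (f g : R -> C) : Prop := forall t, dC f t (RtoC (2 * PI) * Ci * g t)%C.

Lemma DD_ext f f' g g' : (forall t, f t = f' t) -> (forall t, g t = g' t) -> DD f g -> DD f' g'.
Proof. intros E E' H t. rewrite <- E'. eapply dC_ext; [exact E|apply H]. Qed.

(** Allows an identity that holds along the whole line to be differentiated; relations between first
    derivatives of theta constants are obtained from their products in this way. *)
Lemma DD_unique f f' g g' : (forall t, f t = f' t) -> DD f g -> DD f' g' -> forall t, g t = g' t.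
Proof.
  intros E H H' t. assert (X := dC_unique _ _ _ _ (dC_ext _ _ _ _ E (H t)) (H' t)).
  assert (N := TwoPiI_nz).
  transitivity (/ (RtoC (2 * PI) * Ci) * (RtoC (2 * PI) * Ci * g t))%C.
  - rewrite Cmult_assoc, Cinv_l, Cmult_1_l; auto.
  - rewrite X, Cmult_assoc, Cinv_l, Cmult_1_l; auto.
Qed.

Lemma DD_const c : DD (fun _ => c) (fun _ => RtoC 0).
Proof. intros t. rewrite Cmult_0_r. apply dC_const. Qed.

Lemma DD_plus f g f' g' : DD f f' -> DD g g' -> DD (fun t => f t + g t)%C (fun t => f' t + g' t)%C.
Proof. intros H K t. rewrite Cmult_plus_distr_l. apply dC_plus; auto. Qed.

Lemma DD_mult f g f' g' : DD f f' -> DD g g' ->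
  DD (fun t => f t * g t)%C (fun t => f' t * g t + f t * g' t)%C.
Proof.
  intros H K t. replace (RtoC (2 * PI) * Ci * (f' t * g t + f t * g' t))%C with
    (RtoC (2 * PI) * Ci * f' t * g t + f t * (RtoC (2 * PI) * Ci * g' t))%C by ring.
  apply dC_mult; auto.
Qed.

Lemma DD_scal c f f' : DD f f' -> DD (fun t => c * f t)%C (fun t => c * f' t)%C.
Proof.
  intros H. eapply DD_ext; [| |apply (DD_mult _ _ _ _ (DD_const c) H)]; intros t; simpl; ring.
Qed.

Lemma DD_div f g f' g' : DD f f' -> DD g g' -> (forall t, g t <> RtoC 0) ->
  DD (fun t => f t / g t)%C (fun t => (f' t * g t - f t * g' t) / (g t * g t))%C.
Proof.
  intros H K N t. assert (X := dC_mult _ _ _ _ _ (H t) (dC_inv _ _ _ (K t) (N t))).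
  replace (RtoC (2 * PI) * Ci * ((f' t * g t - f t * g' t) / (g t * g t)))%C with
    (RtoC (2 * PI) * Ci * f' t * / g t + f t * - (RtoC (2 * PI) * Ci * g' t / (g t * g t)))%C.
  - exact X.
  - field. apply N.
Qed.

Lemma DD_pow f f' n : DD f f' -> DD (fun t => Cpow (f t) n)
  (fun t => zC (Z.of_nat n) * Cpow (f t) (pred n) * f' t)%C.
Proof.
  intros H. induction n as [|n IH].
  - eapply DD_ext; [| |apply (DD_const (RtoC 1))]; intros t; simpl; unfold zC; ring.
  - eapply DD_ext; [| |apply (DD_mult _ _ _ _ H IH)]; intros t; [easy|].
    cbn [pred]. rewrite Nat2Z.inj_succ. unfold Z.succ. rewrite zC_plus. simpl (zC 1).
    destruct n as [|n]; [unfold zC; simpl; ring|]. cbn [pred]. rewrite Cpow_S. unfold zC at 3. ring.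
Qed.

(** * Theta constants along a horizontal line and closure under D *)

Section Horizontal.
Variable tau0 : C.
Hypothesis Ht0 : 0 < Im tau0.
Definition line (t : R) : C := (tau0 + RtoC t)%C.

Lemma line_im t : 0 < Im (line t).
Proof. unfold line, Im in *; simpl. lra. Qed.
#[local] Hint Resolve line_im : chars.

Definition Mt (c : Z -> Z) (l : R) (j : nat) (t : R) : C := Mom c l j (line t).

Lemma DD_Mt c l j : bounded1 c -> 0 < l -> DD (Mt c l j) (Mt c l (S j)).
Proof.
  intros Hc Hl t.
  set (q := fun n => (zC (c n) * RtoC ((l * IZR n ^ 2) ^ j) * epow (l * IZR n ^ 2) tau0)%C).
  assert (X := dC_series q (fun n => l * IZR n ^ 2) t (asum_Mom c l j tau0 Hc Hl Ht0)).
  assert (Y : asum (fun n => RtoC ((l * IZR n ^ 2) ^ 2) * q n)%C).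
  { eapply asum_ext; [|apply (asum_Mom c l (2 + j) tau0 Hc Hl Ht0)].
    intros n; unfold q. rewrite pow_add, RtoC_mult. ring. }
  specialize (X Y).
  replace (Mt c l (S j) t) with (tsum (fun n => RtoC (l * IZR n ^ 2) * q n * epow (l * IZR n ^ 2) (RtoC t))%C).
  - eapply dC_ext; [|exact X]. intros s. apply tsum_ext; intros n. unfold q, line.
    rewrite epow_wadd. ring.
  - apply tsum_ext; intros n. unfold q, line. rewrite epow_wadd.
    cbn [pow]. rewrite (RtoC_mult (l * IZR n ^ 2)). cbn [pow]. ring.
Qed.

Notation t2 := (Mt chi4 (1 / 8)).
Notation t3 := (Mt chev (1 / 8)).
Notation t4 := (Mt chie (1 / 8)).
Notation a := (Mt chev (3 / 12)).
Notation b := (Mt chi4 (3 / 12)).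
Notation d := (Mt chie (3 / 12)).
Notation E := (Mt chi12 (/ 24)).

Lemma two_eighth : 2 * (1 / 8) = 3 / 12. Proof. field. Qed.

Lemma theta3_sq t : (t3 0 t * t3 0 t)%C = (a 0 t * a 0 t + b 0 t * b 0 t)%C.
Proof.
  assert (H := chev_sqr (line t) (line_im t) (1 / 8) ltac:(lra)). rewrite two_eighth in H. exact H.
Qed.
Lemma theta4_sq t : (t4 0 t * t4 0 t)%C = (a 0 t * a 0 t + RtoC (-1) * (b 0 t * b 0 t))%C.
Proof.
  assert (H := chie_sqr (line t) (line_im t) (1 / 8) ltac:(lra)). rewrite two_eighth in H. exact H.
Qed.
Lemma theta2_sq t : (t2 0 t * t2 0 t)%C = (RtoC 2 * (b 0 t * a 0 t))%C.
Proof.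
  assert (H := chi4_sqr (line t) (line_im t) (1 / 8) ltac:(lra)). rewrite two_eighth in H. exact H.
Qed.
Lemma theta34_prod t : (t3 0 t * t4 0 t)%C = (d 0 t * d 0 t)%C.
Proof.
  assert (H := chev_chie (line t) (line_im t) (1 / 8) ltac:(lra)). rewrite two_eighth in H. exact H.
Qed.
Lemma theta3_second t : (t3 0 t * t3 2 t - t3 1 t * t3 1 t)%C =
  (RtoC 2 * (a 1 t * a 1 t + b 1 t * b 1 t))%C.
Proof.
  assert (H := chev_second (line t) (line_im t) (1 / 8) ltac:(lra)). rewrite two_eighth in H. exact H.
Qed.
Lemma theta34_wronskian t : (t3 1 t * t4 0 t - t3 0 t * t4 1 t)%C =
  (RtoC (1 / 2) * ((b 0 t * (a 0 t * d 0 t)) * (b 0 t * (a 0 t * d 0 t))))%C.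
Proof.
  assert (H := chev_chie_wronskian (line t) (line_im t) (1 / 8) ltac:(lra)). rewrite two_eighth in H.
  rewrite Jac_W in H by (auto using line_im; lra).
  replace (4 * (1 / 8)) with (1 / 2) in H by field. exact H.
Qed.
Lemma E_eta t : E 0 t = (RtoC 2 * eta (line t))%C.
Proof. apply Mom_chi12_eta, line_im. Qed.
Lemma theta_prod_E t : (RtoC 4 * (t2 0 t * t3 0 t * t4 0 t))%C = (E 0 t * E 0 t * E 0 t)%C.
Proof.
  rewrite E_eta. assert (H := theta_prod_eta (line t) (line_im t)).
  change (Mom chi4 (1 / 8) 0 (line t)) with (t2 0 t) in H.
  change (Mom chev (1 / 8) 0 (line t)) with (t3 0 t) in H.
  change (Mom chie (1 / 8) 0 (line t)) with (t4 0 t) in H. rewrite H. ring.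
Qed.
Lemma eta_double_E t : (RtoC 2 * (Mt chi12 (1 / 12) 0 t * d 0 t))%C = (E 0 t * E 0 t)%C.
Proof.
  rewrite E_eta. assert (H := eta_double_prod (line t) (line_im t)).
  change (Mom chi12 (1 / 12) 0 (line t)) with (Mt chi12 (1 / 12) 0 t) in H.
  change (Mom chie (3 / 12) 0 (line t)) with (d 0 t) in H. rewrite H. ring.
Qed.
Lemma eta_half_E t : (Mt chi12 (1 / 48) 0 t * Mt chi4 (3 / 48) 0 t)%C = (E 0 t * E 0 t)%C.
Proof.
  rewrite E_eta. assert (H := eta_half_prod (line t) (line_im t)).
  change (Mom chi12 (1 / 48) 0 (line t)) with (Mt chi12 (1 / 48) 0 t) in H.
  change (Mom chi4 (3 / 48) 0 (line t)) with (Mt chi4 (3 / 48) 0 t) in H. rewrite H. ring.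
Qed.
Lemma theta2_half_sq t : (Mt chi4 (3 / 48) 0 t * Mt chi4 (3 / 48) 0 t)%C = (RtoC 2 * (t2 0 t * t3 0 t))%C.
Proof.
  assert (H := chi4_sqr (line t) (line_im t) (3 / 48) ltac:(lra)).
  replace (2 * (3 / 48)) with (1 / 8) in H by field. exact H.
Qed.

Lemma all_nz t : t2 0 t <> RtoC 0 /\ t3 0 t <> RtoC 0 /\ t4 0 t <> RtoC 0 /\ a 0 t <> RtoC 0 /\
  b 0 t <> RtoC 0 /\ d 0 t <> RtoC 0 /\ E 0 t <> RtoC 0 /\
  Mt chi12 (1 / 12) 0 t <> RtoC 0 /\ Mt chi12 (1 / 48) 0 t <> RtoC 0 /\ Mt chi4 (3 / 48) 0 t <> RtoC 0.
Proof.
  destruct (theta_nz (line t) (line_im t) (1 / 8) ltac:(lra)) as (H1 & H2 & H3).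
  destruct (theta_nz (line t) (line_im t) (3 / 12) ltac:(lra)) as (H4 & H5 & H6).
  destruct (Mom0_nz (line t) (line_im t)) as (H7 & _ & H8 & H9 & _).
  assert (H10 : E 0 t <> RtoC 0).
  { rewrite E_eta. apply Cmult_neq_0; [intros X; apply RtoC_inj in X; lra|apply eta_nz, line_im]. }
  repeat split; auto.
Qed.

Lemma theta2_nz t : t2 0 t <> RtoC 0. Proof. exact (proj1 (all_nz t)). Qed.
Lemma theta3_nz t : t3 0 t <> RtoC 0. Proof. exact (proj1 (proj2 (all_nz t))). Qed.
Lemma theta3_double_nz t : a 0 t <> RtoC 0. Proof. exact (proj1 (proj2 (proj2 (proj2 (all_nz t))))). Qed.
Lemma theta2_double_nz t : b 0 t <> RtoC 0. Proof. exact (proj1 (proj2 (proj2 (proj2 (proj2 (all_nz t)))))). Qed.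
Lemma theta4_double_nz t : d 0 t <> RtoC 0.
Proof. exact (proj1 (proj2 (proj2 (proj2 (proj2 (proj2 (all_nz t))))))). Qed.
Lemma E_nz t : E 0 t <> RtoC 0.
Proof. exact (proj1 (proj2 (proj2 (proj2 (proj2 (proj2 (proj2 (all_nz t)))))))). Qed.
Lemma theta2_half_nz t : Mt chi4 (3 / 48) 0 t <> RtoC 0.
Proof. exact (proj2 (proj2 (proj2 (proj2 (proj2 (proj2 (proj2 (proj2 (proj2 (all_nz t)))))))))). Qed.

Lemma two_nz : RtoC 2 <> RtoC 0.
Proof. intros X; apply RtoC_inj in X; lra. Qed.

Lemma Ccancel (k x y : C) : k <> RtoC 0 -> (k * x = k * y)%C -> x = y.
Proof.
  intros H E. transitivity (/ k * (k * x))%C; [field; auto|]. rewrite E. field; auto.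
Qed.

Definition u (t : R) : C := (t3 1 t / t3 0 t)%C.
Definition fA (t : R) : C := Cpow (t3 0 t) 4.
Definition fB (t : R) : C := Cpow (t2 0 t) 4.

Lemma fA_ab t : fA t = Cpow (a 0 t * a 0 t + b 0 t * b 0 t) 2.
Proof. rewrite <- theta3_sq. unfold fA. ring. Qed.
Lemma fB_ab t : fB t = (RtoC 4 * (a 0 t * a 0 t * (b 0 t * b 0 t)))%C.
Proof. replace (fB t) with (Cpow (t2 0 t * t2 0 t) 2) by (unfold fB; ring). rewrite theta2_sq. ring. Qed.
Lemma theta4_pow4 t : Cpow (t4 0 t) 4 = (fA t - fB t)%C.
Proof.
  rewrite fA_ab, fB_ab. replace (Cpow (t4 0 t) 4) with (Cpow (t4 0 t * t4 0 t) 2) by ring.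
  rewrite theta4_sq. ring.
Qed.

Lemma DD_sq f f' : DD f f' -> DD (fun t => f t * f t)%C (fun t => RtoC 2 * (f t * f' t))%C.
Proof. intros H. eapply DD_ext; [| |apply (DD_mult _ _ _ _ H H)]; intros t; simpl; ring. Qed.

Lemma D_t2 j : DD (t2 j) (t2 (S j)). Proof. apply DD_Mt; auto with chars; lra. Qed.
Lemma D_t3 j : DD (t3 j) (t3 (S j)). Proof. apply DD_Mt; auto with chars; lra. Qed.
Lemma D_t4 j : DD (t4 j) (t4 (S j)). Proof. apply DD_Mt; auto with chars; lra. Qed.
Lemma D_a j : DD (a j) (a (S j)). Proof. apply DD_Mt; auto with chars; lra. Qed.
Lemma D_b j : DD (b j) (b (S j)). Proof. apply DD_Mt; auto with chars; lra. Qed.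
Lemma D_d j : DD (d j) (d (S j)). Proof. apply DD_Mt; auto with chars; lra. Qed.
Lemma D_E j : DD (E j) (E (S j)). Proof. apply DD_Mt; auto with chars; lra. Qed.

Lemma theta3_sq' t : (t3 0 t * t3 1 t)%C = (a 0 t * a 1 t + b 0 t * b 1 t)%C.
Proof.
  assert (H := DD_unique _ _ _ _ theta3_sq (DD_sq _ _ (D_t3 0)) (DD_plus _ _ _ _ (DD_sq _ _ (D_a 0)) (DD_sq _ _ (D_b 0))) t).
  simpl in H. apply (Ccancel (RtoC 2)); [apply two_nz|]. rewrite H. ring.
Qed.
Lemma theta4_sq' t : (t4 0 t * t4 1 t)%C = (a 0 t * a 1 t - b 0 t * b 1 t)%C.
Proof.
  assert (H := DD_unique _ _ _ _ theta4_sq (DD_sq _ _ (D_t4 0))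
    (DD_plus _ _ _ _ (DD_sq _ _ (D_a 0)) (DD_scal (RtoC (-1)) _ _ (DD_sq _ _ (D_b 0)))) t).
  simpl in H. apply (Ccancel (RtoC 2)); [apply two_nz|]. rewrite H. ring.
Qed.
Lemma theta2_sq' t : (t2 0 t * t2 1 t)%C = (b 1 t * a 0 t + b 0 t * a 1 t)%C.
Proof.
  assert (H := DD_unique _ _ _ _ theta2_sq (DD_sq _ _ (D_t2 0)) (DD_scal (RtoC 2) _ _ (DD_mult _ _ _ _ (D_b 0) (D_a 0))) t).
  simpl in H. apply (Ccancel (RtoC 2)); [apply two_nz|]. rewrite H. ring.
Qed.

Lemma theta3_deriv t : t3 1 t = (u t * t3 0 t)%C.
Proof. unfold u. field. apply theta3_nz. Qed.

(** By Jacobi's formula the wronskian of theta3 and theta4 is (a b d)^2 / 2, and d^2 = theta3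
    theta4; dividing by theta3 theta4 gives the difference of the logarithmic derivatives. *)
Lemma theta4_deriv t : t4 1 t = ((u t - RtoC (1 / 2) * (a 0 t * a 0 t * (b 0 t * b 0 t))) * t4 0 t)%C.
Proof.
  apply (Ccancel (t3 0 t)); [apply theta3_nz|].
  assert (H6 := theta34_wronskian t). assert (H4 := theta34_prod t).
  transitivity (t3 1 t * t4 0 t - (t3 1 t * t4 0 t - t3 0 t * t4 1 t))%C; [ring|].
  rewrite H6, theta3_deriv.
  transitivity (u t * (t3 0 t * t4 0 t) - RtoC (1 / 2) * (a 0 t * a 0 t * (b 0 t * b 0 t)) * (d 0 t * d 0 t))%C; [ring|].
  rewrite <- H4. ring.
Qed.

Lemma half_two : (RtoC (1 / 2) * RtoC 2)%C = RtoC 1.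
Proof. rewrite <- RtoC_mult. f_equal. field. Qed.

(** The differentiated relations for theta3^2 and theta4^2 are a linear system for a a' and b b'.
    Their sum yields this formula, their difference the next one. *)
Lemma theta3_double_deriv t : a 1 t = (a 0 t * (u t - RtoC (1 / 4) * ((a 0 t * a 0 t - b 0 t * b 0 t) * (b 0 t * b 0 t))))%C.
Proof.
  apply (Ccancel (RtoC 2 * a 0 t)%C); [apply Cmult_neq_0; [apply two_nz|apply theta3_double_nz]|].
  transitivity ((a 0 t * a 1 t + b 0 t * b 1 t) + (a 0 t * a 1 t - b 0 t * b 1 t))%C; [ring|].
  rewrite <- theta3_sq', <- theta4_sq', theta3_deriv, theta4_deriv.
  transitivity (u t * (t3 0 t * t3 0 t) + (u t - RtoC (1 / 2) * (a 0 t * a 0 t * (b 0 t * b 0 t))) * (t4 0 t * t4 0 t))%C; [ring|].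
  rewrite theta3_sq, theta4_sq. replace (1 / 2) with (1 / 4 * 2) by field. rewrite RtoC_mult. ring.
Qed.

Lemma theta2_double_deriv t : b 1 t = (b 0 t * (u t + RtoC (1 / 4) * ((a 0 t * a 0 t - b 0 t * b 0 t) * (a 0 t * a 0 t))))%C.
Proof.
  apply (Ccancel (RtoC 2 * b 0 t)%C); [apply Cmult_neq_0; [apply two_nz|apply theta2_double_nz]|].
  transitivity ((a 0 t * a 1 t + b 0 t * b 1 t) - (a 0 t * a 1 t - b 0 t * b 1 t))%C; [ring|].
  rewrite <- theta3_sq', <- theta4_sq', theta3_deriv, theta4_deriv.
  transitivity (u t * (t3 0 t * t3 0 t) - (u t - RtoC (1 / 2) * (a 0 t * a 0 t * (b 0 t * b 0 t))) * (t4 0 t * t4 0 t))%C; [ring|].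
  rewrite theta3_sq, theta4_sq. replace (1 / 2) with (1 / 4 * 2) by field. rewrite RtoC_mult. ring.
Qed.

(** From theta2^2 = 2 a b the logarithmic derivative is half the sum of those of a and b, namely u +
    (a^2 - b^2)^2 / 8, and (a^2 - b^2)^2 = theta4^4 = A - B. *)
Lemma theta2_deriv t : (RtoC 8 * t2 1 t)%C = ((RtoC 8 * u t + (fA t - fB t)) * t2 0 t)%C.
Proof.
  apply (Ccancel (t2 0 t)); [apply theta2_nz|].
  transitivity (RtoC 8 * (t2 0 t * t2 1 t))%C; [ring|]. rewrite theta2_sq'.
  transitivity ((RtoC 8 * u t + (fA t - fB t)) * (t2 0 t * t2 0 t))%C; [|ring].
  rewrite theta2_sq, fA_ab, fB_ab, theta3_double_deriv, theta2_double_deriv.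
  replace (RtoC 8) with (RtoC 4 * RtoC 2)%C by (rewrite <- RtoC_mult; f_equal; ring).
  assert (Q : (RtoC 4 * RtoC (1 / 4))%C = RtoC 1) by (rewrite <- RtoC_mult; f_equal; field).
  set (k := RtoC (1 / 4)) in *. set (x := a 0 t). set (y := b 0 t). set (v := u t).
  transitivity (RtoC 2 * (RtoC 8 * v * (x * y) + (RtoC 4 * k) * (x * y * ((x * x - y * y) * (x * x - y * y)))))%C; [ring|].
  rewrite Q. ring.
Qed.

Lemma theta4_deriv' t : (RtoC 8 * t4 1 t)%C = ((RtoC 8 * u t - fB t) * t4 0 t)%C.
Proof.
  rewrite theta4_deriv, fB_ab. replace (1 / 2) with (/ 8 * 4) by field. rewrite RtoC_mult.
  assert (Q : (RtoC 8 * RtoC (/ 8))%C = RtoC 1) by (rewrite <- RtoC_mult; f_equal; field).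
  set (k := RtoC (/ 8)) in *. set (X := (a 0 t * a 0 t * (b 0 t * b 0 t))%C).
  transitivity ((RtoC 8 * u t - (RtoC 8 * k) * RtoC 4 * X) * t4 0 t)%C; [ring|]. rewrite Q. ring.
Qed.

(** theta3^2 D u is the left side of [theta3_second]. The second derivative of theta3 thus reduces
    to first derivatives at 2 tau, which are already expressed through u, a and b; this closes the
    ring. *)
Lemma D_u : DD u (fun t => RtoC 2 * (u t * u t) + RtoC (/ 32) * (fB t * (fA t - fB t)))%C.
Proof.
  eapply DD_ext; [| |apply (DD_div _ _ _ _ (D_t3 1) (D_t3 0))]; [easy| |intros; apply theta3_nz].
  intros t; cbn beta.
  apply (Ccancel (t3 0 t * t3 0 t)%C); [apply Cmult_neq_0; apply theta3_nz|].
  transitivity (t3 0 t * t3 2 t - t3 1 t * t3 1 t)%C; [field; apply theta3_nz|].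
  rewrite theta3_second, theta3_sq, theta3_double_deriv, theta2_double_deriv, fA_ab, fB_ab.
  replace (/ 32) with (1 / 4 * (1 / 4) * / 2) by field. rewrite !RtoC_mult.
  assert (Q : (RtoC (/ 2) * RtoC 2)%C = RtoC 1) by (rewrite <- RtoC_mult; f_equal; field).
  set (k := RtoC (1 / 4)). set (h := RtoC (/ 2)) in *. set (x := a 0 t). set (y := b 0 t). set (v := u t).
  transitivity (RtoC 2 * ((x * x + y * y) * (v * v) + k * k * ((x * x - y * y) * (x * x - y * y) * (x * x * (y * y)) * (x * x + y * y))))%C; [ring|].
  transitivity ((x * x + y * y) * (RtoC 2 * (v * v) + k * k * (RtoC 2 * (h * RtoC 2)) * (x * x * (y * y) * ((x * x - y * y) * (x * x - y * y)))))%C; [rewrite Q; ring|ring].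
Qed.

Lemma DD_pow4 f f' (g : R -> C) : DD f f' -> (forall t, (RtoC 8 * f' t)%C = (g t * f t)%C) ->
  DD (fun t => Cpow (f t) 4) (fun t => RtoC (1 / 2) * (g t * Cpow (f t) 4))%C.
Proof.
  intros H Hg. eapply DD_ext; [| |apply (DD_pow _ _ 4 H)]; [easy|]. intros t; cbn [pred].
  replace (zC (Z.of_nat 4)) with (RtoC (1 / 2) * RtoC 8)%C.
  - transitivity (RtoC (1 / 2) * Cpow (f t) 3 * (RtoC 8 * f' t))%C; [ring|]. rewrite Hg. ring.
  - unfold zC. rewrite <- RtoC_mult. f_equal. simpl. field.
Qed.

(** P = 24 D eta / eta. By theta2 theta3 theta4 = 2 eta^3 it is the sum of 8 u, 8 u + A - B and 8 u
    - B, eight times the logarithmic derivatives of theta3, theta2 and theta4. *)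
Definition fP (t : R) : C := (RtoC 24 * u t - RtoC 2 * fB t + fA t)%C.

Notation EV p := (fun t => ev p (fP t) (fA t) (fB t)).

Lemma mul_48 x y : x = (RtoC (/ 48) * y)%C <-> (RtoC 48 * x)%C = y.
Proof.
  assert (Q : (RtoC 48 * RtoC (/ 48))%C = RtoC 1) by (rewrite <- RtoC_mult; f_equal; field).
  split; intros H.
  - rewrite H, Cmult_assoc, Q. ring.
  - rewrite <- H, Cmult_assoc, (Cmult_comm (RtoC (/ 48))), Q. ring.
Qed.

Lemma D_fA : DD fA (fun t => RtoC (/ 48) * ev dA (fP t) (fA t) (fB t))%C.
Proof.
  eapply DD_ext; [| |apply (DD_pow4 _ _ (fun t => RtoC 8 * u t)%C (D_t3 0))]; [easy| |].
  - intros t; cbn beta. apply mul_48. fold (fA t).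
    unfold dA. rewrite ev_pscal, ev_pmul, ev_pA, ev_plin.
    unfold fP, zC. replace (RtoC 48) with (RtoC 24 * RtoC 2)%C by (rewrite <- RtoC_mult; f_equal; ring).
    transitivity (RtoC 24 * ((RtoC (1 / 2) * RtoC 2) * (RtoC 8 * u t * fA t)))%C; [ring|].
    rewrite half_two. ring.
  - intros t. rewrite theta3_deriv. ring.
Qed.

Lemma D_fB : DD fB (fun t => RtoC (/ 48) * ev dB (fP t) (fA t) (fB t))%C.
Proof.
  eapply DD_ext; [| |apply (DD_pow4 _ _ (fun t => RtoC 8 * u t + (fA t - fB t))%C (D_t2 0))]; [easy| |].
  - intros t; cbn beta. apply mul_48. fold (fB t).
    unfold dB. rewrite ev_pscal, ev_pmul, ev_pB, ev_plin.
    unfold fP, zC. replace (RtoC 48) with (RtoC 24 * RtoC 2)%C by (rewrite <- RtoC_mult; f_equal; ring).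
    transitivity (RtoC 24 * ((RtoC (1 / 2) * RtoC 2) * ((RtoC 8 * u t + (fA t - fB t)) * fB t)))%C; [ring|].
    rewrite half_two. ring.
  - intros t. apply theta2_deriv.
Qed.

(** Ramanujan's equation 12 D P = P^2 - Q, where Q = A^2 - A B + B^2 is the Eisenstein series of
    weight 4. *)
Lemma D_fP : DD fP (fun t => RtoC (/ 48) * ev dP (fP t) (fA t) (fB t))%C.
Proof.
  eapply DD_ext; [| |apply (DD_plus _ _ _ _ (DD_plus _ _ _ _ (DD_scal (RtoC 24) _ _ D_u)
     (DD_scal (RtoC (-2)) _ _ D_fB)) D_fA)].
  - intros t; unfold fP; ring.
  - intros t; cbn beta. apply mul_48.
    unfold dP, dA, dB. rewrite !ev_pscal, !ev_padd, !ev_pscal, !ev_pmul, !ev_plin, ev_pP, ev_pA, ev_pB.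
    assert (Q : (RtoC 48 * RtoC (/ 48))%C = RtoC 1) by (rewrite <- RtoC_mult; f_equal; field).
    assert (Q' : (RtoC 32 * RtoC (/ 32))%C = RtoC 1) by (rewrite <- RtoC_mult; f_equal; field).
    rewrite !Cmult_plus_distr_l.
    set (k := RtoC (/ 48)) in *. set (h := RtoC (/ 32)) in *. unfold fP.
    set (x := u t). set (y := fA t). set (z := fB t).
    match goal with |- (?l = ?r)%C => transitivity (RtoC 48 * RtoC 24 * (RtoC 2 * (x * x)) + RtoC 36 * (RtoC 32 * h) * (z * (y - z))
      + (RtoC 48 * k) * (RtoC (-2) * (zC 8 * (z * (zC 1 * (RtoC 24 * x - RtoC 2 * z + y) + zC 2 * y + zC (-1) * z))))
      + (RtoC 48 * k) * (zC 8 * (y * (zC 1 * (RtoC 24 * x - RtoC 2 * z + y) + zC (-1) * y + zC 2 * z))))%C end; [ring|].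
    rewrite Q, Q'. unfold zC. ring.
Qed.

Lemma D_hder {T} (dR : T -> poly) emb X dX (e : R -> T -> C) (x : R -> C) p :
  (forall c, DD (fun t => e t c) (fun t => RtoC (/ 48) * ev (dR c) (fP t) (fA t) (fB t))%C) ->
  (forall p t, ev (emb p) (fP t) (fA t) (fB t) = hev (e t) (x t) p) ->
  (forall t, ev X (fP t) (fA t) (fB t) = x t) ->
  DD x (fun t => RtoC (/ 48) * ev dX (fP t) (fA t) (fB t))%C ->
  DD (fun t => hev (e t) (x t) p)
    (fun t => RtoC (/ 48) * ev (hder dR emb X dX p) (fP t) (fA t) (fB t))%C.
Proof.
  intros HR He HX Hx. induction p as [|c p IH].
  - eapply DD_ext; [| |apply (DD_const (RtoC 0))]; intros t; [easy|]. unfold ev; simpl. ring.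
  - eapply DD_ext; [| |apply (DD_plus _ _ _ _ (HR c) (DD_mult _ _ _ _ Hx IH))]; intros t; [easy|].
    cbn [hder]. cbn beta. rewrite !ev_padd, !ev_pmul, He, HX. ring.
Qed.

Lemma D_ev p : DD (EV p) (fun t => RtoC (/ 48) * ev (pder p) (fP t) (fA t) (fB t))%C.
Proof.
  apply (D_hder _ _ _ _ (fun t => hev (hev zC (fB t)) (fA t))); [|easy|intros; apply ev_pP|apply D_fP].
  intros q; apply (D_hder _ _ _ _ (fun t => hev zC (fB t)));
    [|intros; unfold ev; simpl; ring|intros; apply ev_pA|apply D_fA].
  intros r; apply (D_hder _ _ _ _ (fun t => zC));
    [|intros; unfold ev; simpl; ring|intros; apply ev_pB|apply D_fB].
  intros c. eapply DD_ext; [| |apply (DD_const (zC c))]; intros t; [easy|]. unfold ev; simpl. ring.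
Qed.

Lemma tower_spec (f : nat -> R -> C) G : (forall j, DD (f j) (f (S j))) ->
  (forall t, (RtoC 48 * f 1%nat t)%C = (f 0%nat t * ev G (fP t) (fA t) (fB t))%C) ->
  forall j t, (RtoC (48 ^ j) * f j t)%C = (f 0%nat t * ev (tower G j) (fP t) (fA t) (fB t))%C.
Proof.
  intros HD H1 j. induction j as [|j IH]; intros t.
  - cbn [tower]. rewrite ev_pconst. unfold zC; simpl. ring.
  - assert (X := DD_unique _ _ _ _ IH (DD_scal (RtoC (48 ^ j)) _ _ (HD j)) (DD_mult _ _ _ _ (HD 0%nat) (D_ev (tower G j))) t).
    cbn beta in X. cbn [tower]. rewrite ev_padd, ev_pmul. simpl pow. rewrite RtoC_mult.
    assert (Q : (RtoC 48 * RtoC (/ 48))%C = RtoC 1) by (rewrite <- RtoC_mult; f_equal; field).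
    transitivity (RtoC 48 * (RtoC (48 ^ j) * f (S j) t))%C; [ring|]. rewrite X.
    transitivity ((RtoC 48 * f 1%nat t) * ev (tower G j) (fP t) (fA t) (fB t)
       + (RtoC 48 * RtoC (/ 48)) * (f 0%nat t * ev (pder (tower G j)) (fP t) (fA t) (fB t)))%C; [ring|].
    rewrite H1, Q. ring.
Qed.

Lemma eta_log t : (RtoC 48 * E 1 t)%C = (E 0 t * ev (plin 2 0 0) (fP t) (fA t) (fB t))%C.
Proof.
  assert (H := DD_unique _ _ _ _ theta_prod_E (DD_scal (RtoC 4) _ _ (DD_mult _ _ _ _ (DD_mult _ _ _ _ (D_t2 0) (D_t3 0)) (D_t4 0)))
    (DD_mult _ _ _ _ (DD_mult _ _ _ _ (D_E 0) (D_E 0)) (D_E 0)) t). cbn beta in H.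
  apply (Ccancel (E 0 t * E 0 t)%C); [apply Cmult_neq_0; apply E_nz|].
  transitivity (RtoC 16 * ((E 1 t * E 0 t + E 0 t * E 1 t) * E 0 t + E 0 t * E 0 t * E 1 t))%C; [ring|].
  rewrite <- H.
  transitivity (RtoC 8 * ((RtoC 8 * t2 1 t) * t3 0 t * t4 0 t + RtoC 8 * (t2 0 t * t3 1 t * t4 0 t) + t2 0 t * t3 0 t * (RtoC 8 * t4 1 t)))%C; [ring|].
  rewrite theta2_deriv, theta4_deriv', theta3_deriv.
  transitivity ((E 0 t * E 0 t * E 0 t) * ev (plin 2 0 0) (fP t) (fA t) (fB t))%C; [|ring].
  rewrite <- theta_prod_E, ev_plin. unfold fP, zC. ring.
Qed.

Lemma theta4_double_log t : (RtoC 48 * d 1 t)%C = (d 0 t * ev (plin 2 (-2) 1) (fP t) (fA t) (fB t))%C.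
Proof.
  assert (H := DD_unique _ _ _ _ theta34_prod (DD_mult _ _ _ _ (D_t3 0) (D_t4 0)) (DD_sq _ _ (D_d 0)) t). cbn beta in H.
  apply (Ccancel (d 0 t)); [apply theta4_double_nz|].
  transitivity (RtoC 24 * (RtoC 2 * (d 0 t * d 1 t)))%C; [ring|]. rewrite <- H.
  transitivity (RtoC 3 * (RtoC 8 * t3 1 t * t4 0 t + t3 0 t * (RtoC 8 * t4 1 t)))%C; [ring|].
  rewrite theta4_deriv', theta3_deriv.
  transitivity ((d 0 t * d 0 t) * ev (plin 2 (-2) 1) (fP t) (fA t) (fB t))%C; [|ring].
  rewrite <- theta34_prod, ev_plin. unfold fP, zC. ring.
Qed.

Lemma D_eta_type l j : 0 < l -> DD (Mt chi12 l j) (Mt chi12 l (S j)).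
Proof. intros; apply DD_Mt; auto with chars. Qed.

(** The logarithmic derivatives of eta(2 tau) and theta4(2 tau) add up to that of eta^2, so the
    known 4 P minus 2 P - 2 A + B remains. *)
Lemma eta_double_log t : (RtoC 48 * Mt chi12 (1 / 12) 1 t)%C =
  (Mt chi12 (1 / 12) 0 t * ev (plin 2 2 (-1)) (fP t) (fA t) (fB t))%C.
Proof.
  assert (D0 := D_eta_type (1 / 12) 0 ltac:(lra)).
  assert (H := DD_unique _ _ _ _ eta_double_E (DD_scal (RtoC 2) _ _ (DD_mult _ _ _ _ D0 (D_d 0))) (DD_sq _ _ (D_E 0)) t).
  cbn beta in H. set (F0 := Mt chi12 (1 / 12) 0 t) in *. set (F1 := Mt chi12 (1 / 12) 1 t) in *.
  apply (Ccancel (RtoC 2 * d 0 t)%C); [apply Cmult_neq_0; [apply two_nz|apply theta4_double_nz]|].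
  transitivity (RtoC 48 * (RtoC 2 * (F1 * d 0 t + F0 * d 1 t)) - RtoC 2 * F0 * (RtoC 48 * d 1 t))%C; [ring|].
  rewrite H, theta4_double_log.
  transitivity (RtoC 2 * E 0 t * (RtoC 48 * E 1 t) - RtoC 2 * F0 * (d 0 t * ev (plin 2 (-2) 1) (fP t) (fA t) (fB t)))%C; [ring|].
  rewrite eta_log. assert (R := eta_double_E t). fold F0 in R.
  transitivity (RtoC 2 * (E 0 t * E 0 t) * ev (plin 2 0 0) (fP t) (fA t) (fB t) - RtoC 2 * F0 * (d 0 t * ev (plin 2 (-2) 1) (fP t) (fA t) (fB t)))%C; [ring|].
  rewrite <- R, !ev_plin. unfold zC. ring.
Qed.

Lemma theta2_half_log t : (RtoC 48 * Mt chi4 (3 / 48) 1 t)%C =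
  (Mt chi4 (3 / 48) 0 t * ev (plin 2 1 1) (fP t) (fA t) (fB t))%C.
Proof.
  assert (D0 : DD (Mt chi4 (3 / 48) 0) (Mt chi4 (3 / 48) 1)) by (apply DD_Mt; auto with chars; lra).
  assert (H := DD_unique _ _ _ _ theta2_half_sq (DD_sq _ _ D0) (DD_scal (RtoC 2) _ _ (DD_mult _ _ _ _ (D_t2 0) (D_t3 0))) t).
  cbn beta in H. set (k0 := Mt chi4 (3 / 48) 0 t) in *. set (k1 := Mt chi4 (3 / 48) 1 t) in *.
  apply (Ccancel k0); [apply theta2_half_nz|].
  transitivity (RtoC 24 * (RtoC 2 * (k0 * k1)))%C; [ring|]. rewrite H.
  transitivity (RtoC 6 * ((RtoC 8 * t2 1 t) * t3 0 t + RtoC 8 * (t2 0 t * t3 1 t)))%C; [ring|].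
  rewrite theta2_deriv, theta3_deriv.
  transitivity ((k0 * k0) * ev (plin 2 1 1) (fP t) (fA t) (fB t))%C; [|ring].
  unfold k0. rewrite theta2_half_sq, ev_plin. unfold fP, zC. ring.
Qed.

Lemma eta_half_log t : (RtoC 48 * Mt chi12 (1 / 48) 1 t)%C =
  (Mt chi12 (1 / 48) 0 t * ev (plin 2 (-1) (-1)) (fP t) (fA t) (fB t))%C.
Proof.
  assert (D0 := D_eta_type (1 / 48) 0 ltac:(lra)).
  assert (D1 : DD (Mt chi4 (3 / 48) 0) (Mt chi4 (3 / 48) 1)) by (apply DD_Mt; auto with chars; lra).
  assert (H := DD_unique _ _ _ _ eta_half_E (DD_mult _ _ _ _ D0 D1) (DD_sq _ _ (D_E 0)) t).
  cbn beta in H. assert (R := eta_half_E t). assert (L := theta2_half_log t).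
  assert (N : Mt chi4 (3 / 48) 0 t <> RtoC 0) by apply theta2_half_nz.
  set (F0 := Mt chi12 (1 / 48) 0 t) in *. set (F1 := Mt chi12 (1 / 48) 1 t) in *.
  set (k0 := Mt chi4 (3 / 48) 0 t) in *. set (k1 := Mt chi4 (3 / 48) 1 t) in *.
  apply (Ccancel k0); auto.
  transitivity (RtoC 48 * (F1 * k0 + F0 * k1) - F0 * (RtoC 48 * k1))%C; [ring|].
  rewrite H, L.
  transitivity (RtoC 2 * E 0 t * (RtoC 48 * E 1 t) - F0 * (k0 * ev (plin 2 1 1) (fP t) (fA t) (fB t)))%C; [ring|].
  rewrite eta_log.
  transitivity (RtoC 2 * (E 0 t * E 0 t) * ev (plin 2 0 0) (fP t) (fA t) (fB t) - F0 * (k0 * ev (plin 2 1 1) (fP t) (fA t) (fB t)))%C; [ring|].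
  rewrite <- R, !ev_plin. unfold zC. ring.
Qed.

Lemma Phi_tower (f g : nat -> R -> C) G H t :
  (forall j, DD (f j) (f (S j))) -> (forall j, DD (g j) (g (S j))) ->
  (forall t, (RtoC 48 * f 1%nat t)%C = (f 0%nat t * ev G (fP t) (fA t) (fB t))%C) ->
  (forall t, (RtoC 48 * g 1%nat t)%C = (g 0%nat t * ev H (fP t) (fA t) (fB t))%C) ->
  (RtoC (48 ^ 6) * Phi (fun j => f j t) (fun j => g j t))%C =
  (f 0%nat t * g 0%nat t * ev (PhiP (tower G) (tower H)) (fP t) (fA t) (fB t))%C.
Proof.
  intros Df Dg Hf Hg. rewrite ev_PhiP.
  assert (T : forall i j, (i + j = 6)%nat -> (RtoC (48 ^ 6) * (f i t * g j t))%C =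
     (f 0%nat t * g 0%nat t * (ev (tower G i) (fP t) (fA t) (fB t) * ev (tower H j) (fP t) (fA t) (fB t)))%C).
  { intros i j E6. rewrite <- E6, pow_add, RtoC_mult.
    transitivity ((RtoC (48 ^ i) * f i t) * (RtoC (48 ^ j) * g j t))%C; [ring|].
    rewrite (tower_spec f G Df Hf i t), (tower_spec g H Dg Hg j t). ring. }
  unfold Phi. set (k := RtoC (48 ^ 6)) in *.
  transitivity (k * (f 0%nat t * g 6%nat t) - RtoC 66 * (k * (f 1%nat t * g 5%nat t)) + RtoC 495 * (k * (f 2%nat t * g 4%nat t))
   - RtoC 924 * (k * (f 3%nat t * g 3%nat t)) + RtoC 495 * (k * (f 4%nat t * g 2%nat t))
   - RtoC 66 * (k * (f 5%nat t * g 1%nat t)) + k * (f 6%nat t * g 0%nat t))%C; [ring|].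
  rewrite !T by easy. ring.
Qed.

Lemma Phi_eta_double t : (RtoC (48 ^ 6) * Phi (fun j => Mt chi12 (1 / 12) j t) (fun j => Mt chie (3 / 12) j t))%C =
  (Mt chi12 (1 / 12) 0 t * d 0 t * ev P12 (fP t) (fA t) (fB t))%C.
Proof.
  apply (Phi_tower (Mt chi12 (1 / 12)) (Mt chie (3 / 12)));
    [intros; apply D_eta_type; lra|intros; apply D_d|apply eta_double_log|apply theta4_double_log].
Qed.

Lemma Phi_eta_half t : (RtoC (48 ^ 6) * Phi (fun j => Mt chi12 (1 / 48) j t) (fun j => Mt chi4 (3 / 48) j t))%C =
  (E 0 t * E 0 t * ev P34 (fP t) (fA t) (fB t))%C.
Proof.
  rewrite <- eta_half_E.
  apply (Phi_tower (Mt chi12 (1 / 48)) (Mt chi4 (3 / 48)));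
    [intros; apply D_eta_type; lra|intros; apply DD_Mt; auto with chars; lra|apply eta_half_log|apply theta2_half_log].
Qed.

Lemma Phi_eta t : (RtoC (48 ^ 6) * Phi (fun j => E j t) (fun j => E j t))%C =
  (E 0 t * E 0 t * ev P55 (fP t) (fA t) (fB t))%C.
Proof.
  apply (Phi_tower E E); [intros; apply D_E|intros; apply D_E|apply eta_log|apply eta_log].
Qed.

Lemma discriminant t :
  Cpow (fA t * fB t * (fA t - fB t)) 2 = (RtoC (2 ^ 8) * Cpow (eta (line t)) 24)%C.
Proof.
  rewrite <- theta4_pow4. unfold fA, fB.
  transitivity (Cpow (t2 0 t * t3 0 t * t4 0 t) 8); [ring|].
  assert (H := theta_prod_eta (line t) (line_im t)).
  change (Mom chi4 (1 / 8) 0 (line t)) with (t2 0 t) in H.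
  change (Mom chev (1 / 8) 0 (line t)) with (t3 0 t) in H.
  change (Mom chie (1 / 8) 0 (line t)) with (t4 0 t) in H. rewrite H.
  rewrite RtoC_pow. ring.
Qed.

End Horizontal.

(** * The translation tau -> tau + 1 *)

Section Shift.
Variable tau : C.
Hypothesis Ht : 0 < Im tau.
Notation MM c l j t := (Mt tau c l j t).

(** The translate is read off at t = 1 on the line through tau. On the support of c the exponents l
    n^2 lie in x + Z/2, so the translation produces one common phase and the sign (-1)^(k n), which
    changes c into c'. *)
Lemma Mt_shift (c c' k : Z -> Z) l x j : bounded1 c' -> 0 < l ->
  (forall n, c n <> 0%Z -> l * IZR n ^ 2 = x + IZR (k n) / 2) ->
  (forall n, (c n * pm (k n))%Z = c' n) ->
  MM c l j 1 = (epow x (RtoC 1) * MM c' l j 0)%C.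
Proof.
  intros Hc Hl H1 H2. unfold Mt, Mom. rewrite <- tsum_scal.
  2: { apply asum_Mom; auto. apply line_im; auto. }
  apply tsum_ext; intros n. unfold line.
  replace (tau + RtoC 0)%C with tau by ring. rewrite epow_wadd, <- H2.
  destruct (Z.eq_dec (c n) 0) as [->|H]; [rewrite Z.mul_0_l; unfold zC; ring|].
  assert (E : epow (l * IZR n ^ 2) (RtoC 1) = (epow x (RtoC 1) * zC (pm (k n)))%C).
  { rewrite H1 by auto. rewrite epow_add, epow_half_Z; easy. }
  rewrite E, zC_mult. ring.
Qed.

Lemma sq_mod_check (c : Z -> Z) d r : (d <> 0)%Z -> (exists e, 48 = d * e)%Z ->
  (forall n k, c (n + 48 * k) = c n)%Z ->
  forallb (fun n => (c n =? 0)%Z || ((n * n - r) mod d =? 0)%Z)%bool res48 = true ->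
  forall n, c n <> 0%Z -> (n * n = r + d * ((n * n - r) / d))%Z.
Proof.
  intros Hd (e & He) Hp H n Hn.
  assert (K : (b2Z (negb (c n =? 0)) * ((n * n - r) mod d) = 0)%Z).
  { revert n Hn; intros n _; revert n.
    apply (periodic_eq (fun n => b2Z (negb (c n =? 0)) * ((n * n - r) mod d))%Z (fun _ => 0%Z)); auto.
    - intros n k. rewrite Hp.
      replace ((n + 48 * k) * (n + 48 * k) - r)%Z with (n * n - r + (e * (2 * n * k + 48 * k * k)) * d)%Z
        by (replace (e * (2 * n * k + 48 * k * k) * d)%Z with ((d * e) * (2 * n * k + 48 * k * k))%Z by ring;
            rewrite <- He; ring).
      rewrite Z_mod_plus_full; easy.
    - rewrite forallb_forall in *. intros m Hm. specialize (H m Hm).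
      apply Z.eqb_eq. destruct (c m =? 0)%Z; simpl in *; [easy|].
      apply Z.eqb_eq in H. rewrite H. easy. }
  destruct (Z.eqb_spec (c n) 0) as [E|_]; [easy|].
  cbn [negb b2Z] in K. rewrite Z.mul_1_l in K.
  assert (X := Z.div_mod (n * n - r) d Hd). lia.
Qed.

Lemma sq_real (n r d q : Z) : (n * n = r + d * q)%Z -> IZR n ^ 2 = IZR r + IZR d * IZR q.
Proof.
  intros H. replace (IZR n ^ 2) with (IZR (n * n)) by (rewrite mult_IZR; ring).
  rewrite H, plus_IZR, mult_IZR; easy.
Qed.

Lemma sq_div_48 n k r d e : (0 < d)%Z -> (48 = d * e)%Z -> (e mod 2 = 0)%Z ->
  pm (((n + 48 * k) * (n + 48 * k) - r) / d) = pm ((n * n - r) / d).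
Proof.
  intros Hd He H2.
  replace ((n + 48 * k) * (n + 48 * k) - r)%Z with (n * n - r + (e * (2 * n * k + 48 * k * k)) * d)%Z
    by (replace (e * (2 * n * k + 48 * k * k) * d)%Z with ((d * e) * (2 * n * k + 48 * k * k))%Z by ring;
        rewrite <- He; ring).
  rewrite Z.div_add by lia. unfold pm. rewrite Z.even_add, Z.even_mul, (Zeven_mod e), H2.
  simpl orb. destruct (Z.even _); easy.
Qed.

Lemma theta3_shift j : MM chev (1 / 8) j 1 = MM chie (1 / 8) j 0.
Proof.
  rewrite (Mt_shift chev chie (fun n => (n * n - 0) / 4)%Z (1 / 8) 0); auto with chars; try lra.
  - rewrite epow_0; ring.
  - intros n Hn. assert (E := sq_mod_check chev 4 0 ltac:(lia) (ex_intro _ 12%Z eq_refl) chev_48 eq_refl n Hn).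
    apply sq_real in E. rewrite E. field.
  - apply (periodic_eq (fun n => chev n * pm ((n * n - 0) / 4))%Z chie);
      [|exact chie_48|vm_compute; easy].
    intros n k. rewrite chev_48, (sq_div_48 n k 0 4 12); easy.
Qed.

Lemma theta2_shift j : MM chi4 (1 / 8) j 1 = (epow (1 / 8) (RtoC 1) * MM chi4 (1 / 8) j 0)%C.
Proof.
  apply (Mt_shift chi4 chi4 (fun n => (n * n - 1) / 4)%Z (1 / 8) (1 / 8)); auto with chars; try lra.
  - intros n Hn. assert (E := sq_mod_check chi4 4 1 ltac:(lia) (ex_intro _ 12%Z eq_refl) chi4_48 eq_refl n Hn).
    apply sq_real in E. rewrite E. field.
  - apply (periodic_eq (fun n => chi4 n * pm ((n * n - 1) / 4))%Z chi4);
      [|exact chi4_48|vm_compute; easy].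
    intros n k. rewrite chi4_48, (sq_div_48 n k 1 4 12); easy.
Qed.

Lemma eta_shift j : MM chi12 (/ 24) j 1 = (epow (/ 24) (RtoC 1) * MM chi12 (/ 24) j 0)%C.
Proof.
  apply (Mt_shift chi12 chi12 (fun n => (n * n - 1) / 12)%Z (/ 24) (/ 24)); auto with chars; try lra.
  - intros n Hn. assert (E := sq_mod_check chi12 12 1 ltac:(lia) (ex_intro _ 4%Z eq_refl) chi12_48 eq_refl n Hn).
    apply sq_real in E. rewrite E. field.
  - apply (periodic_eq (fun n => chi12 n * pm ((n * n - 1) / 12))%Z chi12);
      [|exact chi12_48|vm_compute; easy].
    intros n k. rewrite chi12_48, (sq_div_48 n k 1 12 4); easy.
Qed.

Lemma eta_half_shift j : MM chi12 (1 / 48) j 1 = (epow (1 / 48) (RtoC 1) * MM chi12_8 (1 / 48) j 0)%C.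
Proof.
  apply (Mt_shift chi12 chi12_8 (fun n => (n * n - 1) / 24)%Z (1 / 48) (1 / 48)); auto with chars; try lra.
  - intros n Hn. assert (E := sq_mod_check chi12 24 1 ltac:(lia) (ex_intro _ 2%Z eq_refl) chi12_48 eq_refl n Hn).
    apply sq_real in E. rewrite E. field.
  - apply (periodic_eq (fun n => chi12 n * pm ((n * n - 1) / 24))%Z chi12_8);
      [|exact chi12_8_48|vm_compute; easy].
    intros n k. rewrite chi12_48, (sq_div_48 n k 1 24 2); easy.
Qed.

Lemma theta2_half_shift j : MM chi4 (3 / 48) j 1 = (epow (3 / 48) (RtoC 1) * MM chi8 (3 / 48) j 0)%C.
Proof.
  apply (Mt_shift chi4 chi8 (fun n => (n * n - 1) / 8)%Z (3 / 48) (3 / 48)); auto with chars; try lra.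
  - intros n Hn. assert (E := sq_mod_check chi4 8 1 ltac:(lia) (ex_intro _ 6%Z eq_refl) chi4_48 eq_refl n Hn).
    apply sq_real in E. rewrite E. field.
  - apply (periodic_eq (fun n => chi4 n * pm ((n * n - 1) / 8))%Z chi8);
      [|exact chi8_48|vm_compute; easy].
    intros n k. rewrite chi4_48, (sq_div_48 n k 1 8 6); easy.
Qed.

Lemma fA_shift : fA tau 1 = (fA tau 0 - fB tau 0)%C.
Proof. unfold fA at 1. rewrite theta3_shift. apply theta4_pow4; auto. Qed.

Lemma fB_shift : fB tau 1 = (- fB tau 0)%C.
Proof.
  unfold fB. rewrite theta2_shift, Cpow_mult_l, <- epow_nat.
  replace (INR 4 * (1 / 8)) with (IZR 1 / 2) by (simpl; field). rewrite epow_half_Z.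
  unfold pm; simpl. unfold zC. ring.
Qed.

(** theta3 becomes theta4, so 8 u becomes 8 u - B; the resulting -3 B is compensated by the changes
    of A and B. *)
Lemma fP_shift : fP tau 1 = fP tau 0.
Proof.
  unfold fP. rewrite fA_shift, fB_shift. unfold u. rewrite !theta3_shift.
  assert (H := theta4_deriv' tau Ht 0). assert (N := all_nz tau Ht 0).
  assert (N4 : MM chie (1 / 8) 0 0 <> RtoC 0) by exact (proj1 (proj2 (proj2 N))). clear N.
  assert (E : (RtoC 8 * (MM chie (1 / 8) 1 0 / MM chie (1 / 8) 0 0))%C = (RtoC 8 * u tau 0 - fB tau 0)%C).
  { transitivity ((RtoC 8 * MM chie (1 / 8) 1 0) / MM chie (1 / 8) 0 0)%C; [field; auto|].
    rewrite H. field; auto. }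
  transitivity (RtoC 3 * (RtoC 8 * (MM chie (1 / 8) 1 0 / MM chie (1 / 8) 0 0)) - RtoC 2 * - fB tau 0 + (fA tau 0 - fB tau 0))%C; [ring|].
  rewrite E. fold (u tau 0). ring.
Qed.

Lemma Phi_scal (f g : nat -> C) k k' :
  Phi (fun j => k * f j)%C (fun j => k' * g j)%C = (k * k' * Phi f g)%C.
Proof. unfold Phi. ring. Qed.

Lemma shift_cancel (c k F x p : C) : k <> RtoC 0 ->
  (c * (k * k * F) = k * x * (k * x) * p)%C -> (c * F = x * x * p)%C.
Proof.
  intros N H. apply (Ccancel (k * k)%C); [apply Cmult_neq_0; auto|].
  transitivity (c * (k * k * F))%C; [ring|]. rewrite H. ring.
Qed.

Lemma Phi_eta_half_shift :
  (RtoC (48 ^ 6) * Phi (fun j => MM chi12_8 (1 / 48) j 0) (fun j => MM chi8 (3 / 48) j 0))%C =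
  (MM chi12 (/ 24) 0 0 * MM chi12 (/ 24) 0 0 *
    ev P34 (fP tau 0) (fA tau 0 - fB tau 0)%C (- fB tau 0)%C)%C.
Proof.
  assert (H := Phi_eta_half tau Ht 1). rewrite fA_shift, fB_shift, fP_shift, eta_shift in H.
  assert (G1 : (fun j => MM chi12 (1 / 48) j 1) =
     (fun j => epow (1 / 48) (RtoC 1) * MM chi12_8 (1 / 48) j 0)%C)
    by (apply functional_extensionality; exact eta_half_shift).
  assert (G2 : (fun j => MM chi4 (3 / 48) j 1) =
     (fun j => epow (3 / 48) (RtoC 1) * MM chi8 (3 / 48) j 0)%C)
    by (apply functional_extensionality; exact theta2_half_shift).
  rewrite G1, G2, Phi_scal in H. clear G1 G2.
  (* The phases of the two theta constants and of the two eta factors agree, as 1/48 + 3/48 = 1/24 +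
     1/24, and can be cancelled. *)
  assert (E : (epow (1 / 48) (RtoC 1) * epow (3 / 48) (RtoC 1))%C =
     (epow (/ 24) (RtoC 1) * epow (/ 24) (RtoC 1))%C)
    by (rewrite <- !epow_add; f_equal; field).
  rewrite E in H. exact (shift_cancel _ _ _ _ _ (epow_nz _ _) H).
Qed.

End Shift.

(** * The value at the origin as a multiple of eta^26 *)

Lemma assemble (F1 F2 F3 F4 A1 A2 A3 A4 m d E h X c : C) : c <> RtoC 0 ->
  (c * F1 = m * d * A1)%C -> (c * F2 = E * E * A2)%C -> (c * F3 = E * E * A3)%C ->
  (c * F4 = E * E * A4)%C -> (RtoC 2 * (m * d) = E * E)%C -> E = (RtoC 2 * h)%C ->
  (RtoC 2 * A1 + A2 + A3 + RtoC 4 * A4)%C = X ->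
  (c * (RtoC (1 / 2) * F1 + RtoC (1 / 8) * (F2 + F3) + RtoC (1 / 2) * F4))%C =
  (RtoC (1 / 2) * (h * h) * X)%C.
Proof.
  intros Hc H1 H2 H3 H4 HR HE HX.
  assert (Q : (RtoC (1 / 8) * RtoC 4)%C = RtoC (1 / 2)) by (rewrite <- RtoC_mult; f_equal; field).
  assert (Q' : (RtoC (1 / 8) * RtoC 8)%C = RtoC 1) by (rewrite <- RtoC_mult; f_equal; field).
  set (k := RtoC (1 / 8)) in *. clearbody k.
  rewrite <- Q.
  transitivity (k * (RtoC 4 * (c * F1) + (c * F2 + c * F3) + RtoC 4 * (c * F4)))%C; [ring|].
  rewrite H1, H2, H3, H4.
  transitivity (k * (RtoC 2 * (RtoC 2 * (m * d)) * A1 + E * E * (A2 + A3 + RtoC 4 * A4)))%C; [ring|].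
  rewrite HR, <- HX, HE. ring.
Qed.

Theorem Dz12_phi26_eta tau : 0 < Im tau ->
  Dz_n 12 (fun z => phi26 z tau) (RtoC 0) =
    (RtoC (2 ^ 8 * 3 ^ 4 * 11 ^ 2 * 13 / 12 ^ 12) * Cpow (eta tau) 26)%C.
Proof.
  intros Ht. rewrite Dz12_phi26 by auto.
  assert (L : line tau 0 = tau) by (unfold line; ring).
  assert (N : RtoC (48 ^ 6) <> RtoC 0) by (intros Q; apply RtoC_inj in Q; lra).
  assert (H := assemble _ _ _ _ _ _ _ _ _ _ _ _ _ _ N (Phi_eta_double tau Ht 0) (Phi_eta_half tau Ht 0)
    (Phi_eta_half_shift tau Ht) (Phi_eta tau Ht 0) (eta_double_E tau Ht 0) (E_eta tau Ht 0)
    (weight12_identity (fP tau 0) (fA tau 0) (fB tau 0))).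
  rewrite (discriminant tau Ht 0) in H. unfold Mt in H. rewrite L in H.
  apply (Ccancel _ _ _ N).
  rewrite Cmult_assoc, (Cmult_comm (RtoC (48 ^ 6))), <- Cmult_assoc, H. clear.
  set (h := eta tau). clearbody h.
  (* With 48^6 = 4^6 12^6 the factor 4^6 of [weight12_identity] disappears and the two powers 12^-6
     combine to 12^-12; 2^8 comes from [discriminant]. *)
  assert (K : (RtoC (/ 12 ^ 6) * (RtoC (1 / 2) * (zC (2 * 4 ^ 6 * 3 ^ 4 * 11 ^ 2 * 13) * RtoC (2 ^ 8))))%C =
    (RtoC (48 ^ 6) * RtoC (2 ^ 8 * 3 ^ 4 * 11 ^ 2 * 13 / 12 ^ 12))%C).
  { unfold zC. rewrite <- !RtoC_mult. f_equal.
    change (2 * 4 ^ 6 * 3 ^ 4 * 11 ^ 2 * 13)%Z with 1043767296%Z. field. }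
  rewrite (Cmult_assoc (RtoC (48 ^ 6))), <- K.
  generalize (RtoC (/ 12 ^ 6)) (RtoC (1 / 2)) (zC (2 * 4 ^ 6 * 3 ^ 4 * 11 ^ 2 * 13)) (RtoC (2 ^ 8)).
  intros. ring.
Qed.

Theorem theorem1p2 :
  forall tau : C, 0 < Im tau ->
  (forall (z : C) (z1 z2 z3 z4 : R),
     z = (RtoC z1 + Ci * RtoC z2)%C ->
     z = ((RtoC z3 + Ci * RtoC (sqrt 3) * RtoC z4) / RtoC 2)%C ->
     phi26 z tau =
       (RtoC (1 / 2) * (theta_star (RtoC (z3 / 6)) (RtoC 2 * tau)
                        * theta4 (RtoC (z4 / 2)) (RtoC 2 * tau))
        + RtoC (1 / 8) * (theta_star (RtoC (z3 / 12)) (tau / RtoC 2)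
                          * theta2 (RtoC (z4 / 4)) (tau / RtoC 2))
        + RtoC (1 / 16) *
            (theta_star (RtoC (z3 / 12 + 1 / 4)) (tau / RtoC 2)
             * theta2 (RtoC (z4 / 4 - 1 / 4)) (tau / RtoC 2)
             + theta2_star (RtoC (z3 / 12 + 1 / 4)) (tau / RtoC 2)
               * theta (RtoC (z4 / 4 - 1 / 4)) (tau / RtoC 2))
        + RtoC (1 / 16) *
            (theta_star (RtoC (z3 / 12 + 1 / 4)) (tau / RtoC 2)
             * theta2 (RtoC (z4 / 4 + 1 / 4)) (tau / RtoC 2)
             - theta2_star (RtoC (z3 / 12 + 1 / 4)) (tau / RtoC 2)
               * theta (RtoC (z4 / 4 + 1 / 4)) (tau / RtoC 2))
        - RtoC (1 / 2) * (theta_star (RtoC ((z1 + z2) / 6)) tau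
                          * theta_star (RtoC ((z1 - z2) / 6)) tau))%C)
  /\
  Dz_n 12 (fun z => phi26 z tau) (RtoC 0) =
    (RtoC (2 ^ 8 * 3 ^ 4 * 11 ^ 2 * 13 / 12 ^ 12) * Cpow (eta tau) 26)%C.
Proof.
  intros tau Ht; split; [|apply Dz12_phi26_eta, Ht].
  intros z z1 z2 z3 z4; apply phi26_theta, Ht.
Qed.
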